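(* The monoid variety $\mathbb A_0^1\vee\mathbb E^1\{\sigma_2\}\vee\overline{\mathbb E^1\{\sigma_2\}}$ is a limit variety, and it is different from each of the previously found limit varieties of aperiodic monoids, namely from each of the thirteen varieties $\mathbb A^1\vee\overline{\mathbb A^1}$, $\mathbb J$, $\overline{\mathbb J}$, $\mathbb J_1$, $\overline{\mathbb J_1}$, $\mathbb J_2$, $\overline{\mathbb J_2}$, $\mathbb K^1$, $\overline{\mathbb K^1}$, $\mathbb M(\{xzxyty\})$, $\mathbb M(\{xyzxty,xzytxy\})$, $\mathbb A^1\vee\mathbb E^1\{\sigma_2\}$, $\overline{\mathbb A^1}\vee\overline{\mathbb E^1\{\sigma_2\}}$.
   Context: Monoids are algebras with an associative multiplication and a constant $1$; varieties are varieties of monoids, identities are formal equalities $\mathbf u\approx\mathbf v$ of words in the free monoid $\mathfrak A^*$ over a countably infinite alphabet $\mathfrak A$, and $\operatorname{var}\Sigma$ is the variety of all monoids satisfying the identities in $\Sigma$. A variety is finitely based (FB) if it has a finite basis of identities, otherwise non-finitely based (NFB). A limit variety is an NFB variety all of whose proper subvarieties are FB. A monoid is aperiodic if all its subgroups are trivial. $\vee$ is the join of varieties. $\overline{\mathbb V}$ is the variety dual to $\mathbb V$ (all monoids anti-isomorphic to monoids in $\mathbb V$). For a semigroup $S$, $S^1$ is the monoid obtained by adjoining a new identity element. $\mathbb A_0^1$, $\mathbb A^1$, $\mathbb K^1$ are the monoid varieties generated by $A_0^1$, $A^1$, $K^1$, where (presentations of semigroups with zero $0$) $A_0=\langle a,b\mid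 a^2=a,\ b^2=b,\ ab=0\rangle$, $A=\langle a,b,c\mid a^2=a,\ b^2=b,\ ab=ca=0,\ ac=cb=c\rangle$, $K=\langle a,b,c\mid a^2=a,\ b^2=b^3,\ bcb^2=bcb,\ ca=c,\ abc=ac=ba=b^2c=0\rangle$. $\mathbb E^1\{\sigma_2\}=\operatorname{var}\{xtx\approx xtx^2\approx x^2tx,\ xy^2x\approx x^2y^2,\ xt_1yt_2x^2y^2\approx xt_1yt_2y^2x^2\}$. For a set $W$ of words, $M(W)$ is the Rees quotient monoid of $\mathfrak A^*$ over the ideal of all words that are not subwords (factors) of any word in $W$, and $\mathbb M(W)$ is the variety generated by $M(W)$. $S_n$ is the symmetric group on $\{1,\dots,n\}$ and $i\pi$ denotes the image of $i$ under $\pi$. $\mathbb J$ is defined by $x^2y^2\approx y^2x^2$, $xyx\approx xyx^2$, $xyzxy\approx yxzxy$, $xyxztx\approx xyxzxtx$ and, for all $n\ge1$, $\pi\in S_n$, $xz_{1\pi}z_{2\pi}\cdots z_{n\pi}xt_1z_1\cdots t_nz_n\approx x^2z_{1\pi}z_{2\pi}\cdots z_{n\pi}t_1z_1\cdots t_nz_n$. $\mathbb J_1$ is defined by $xyxz\approx xyxzx$, $xyxty\approx x^2yty$ and, for all $n\ge1$, $\pi,\tau\in S_{2n}$, by $\mathbf p\,t\,xy\,\mathbf q\approx\mathbf p\,t\,yx\,\mathbf q$ where $\mathbf p=(x_1t_1x_2t_2\cdots x_nt_n)\,x\,(z_1z_2\cdots z_{2n})\,y\,(t_{n+1}x_{n+1}\cdots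 t_{2n}x_{2n})$ and $\mathbf q=x_{1\pi}z_{1\tau}x_{2\pi}z_{2\tau}\cdots x_{(2n)\pi}z_{(2n)\tau}$. $\mathbb J_2$ is defined by $xyxz\approx xyxzx$, $xy_1ysxyx_1y_1tx_1\approx xy_1ysyxx_1y_1tx_1$ and, for all $n\ge1$, $\pi,\tau\in S_{2n}$, by $\mathbf p\,xy\,\mathbf q\approx\mathbf p\,yx\,\mathbf q$ where $\mathbf p=(x_1t_1x_2t_2\cdots x_{2n}t_{2n})\,x\,(z_1s_1z_2s_2\cdots z_ns_n)\,y\,(z_{n+1}z_{n+2}\cdots z_{2n})$ and $\mathbf q=(x_{1\pi}z_{1\tau}x_{2\pi}z_{2\tau}\cdots x_{(2n)\pi}z_{(2n)\tau})\,t\,(s_1s_2\cdots s_n)$. *)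

(* Defs.v *)
From HB Require Import structures.
From mathcomp Require Import all_boot perm generic_quotient.
From mathcomp Require Import boolp classical_sets.

Set Implicit Arguments.
Unset Strict Implicit.
Unset Printing Implicit Defensive.

Local Open Scope classical_set_scope.
Local Open Scope group_scope.

(* A countably infinite alphabet; [(k, i)] is the [i]-th letter of kind [k].
   Index 0 is used for the letters written without a subscript. *)
Definition letter : Type := (nat * nat)%type.
HB.instance Definition _ := Countable.on letter.

Definition word : Type := seq letter.
HB.instance Definition _ := Countable.on word.

Definition identity : Type := (word * word)%type.
HB.instance Definition _ := Countable.on identity.

Definition eval (M : monoidType) (f : letter -> M) (u : word) : M :=
  \big[mul/1]_(a <- u) f a.

Definition satisfies (M : monoidType) (e : identity) : Prop :=
  forall f : letter -> M, eval f e.1 = eval f e.2.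

Section Product.
Variables (I : Type) (M : I -> monoidType).

Definition product : Type := forall i, M i.
HB.instance Definition _ := Choice.on product.

Definition product_mul (p q : product) : product := fun i => p i * q i.
Definition product_one : product := fun=> 1.

Fact product_mulA : associative product_mul.
Proof. by move=> p q r; apply: functional_extensionality_dep => i; apply: mulgA. Qed.
Fact product_mul1 : left_id product_one product_mul.
Proof. by move=> p; apply: functional_extensionality_dep => i; apply: mul1g. Qed.
Fact product_1mul : right_id product_one product_mul.
Proof. by move=> p; apply: functional_extensionality_dep => i; apply: mulg1. Qed.

HB.instance Definition _ :=
  isMonoid.Build product product_mulA product_mul1 product_1mul.
End Product.

(* Not [set monoidType], which is a universe inconsistency. *)
Definition mclass := monoidType -> Prop.

Definition subclass (V W : mclass) : Prop := forall M, V M -> W M.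
Definition eqclass (V W : mclass) : Prop := forall M, V M <-> W M.

Definition variety (V : mclass) : Prop :=
  [/\ forall (M N : monoidType) (f : M -> N),
        monoid_morphism f -> (forall b, exists a, f a = b) -> V M -> V N,
      forall (M N : monoidType) (f : M -> N),
        monoid_morphism f -> injective f -> V N -> V M
    & forall (I : Type) (M : I -> monoidType),
        (forall i, V (M i)) -> V (product M)].

Definition var (Sigma : set identity) : mclass :=
  fun M => forall e, Sigma e -> satisfies M e.

Definition smallest_variety (K : mclass) : mclass :=
  fun M => forall V, variety V -> subclass K V -> V M.

Definition generated (M : monoidType) : mclass :=
  fun N => forall V, variety V -> V M -> V N.

Definition join (V W : mclass) : mclass :=
  smallest_variety (fun M => V M \/ W M).

Definition dual (V : mclass) : mclass :=
  fun M => exists (N : monoidType) (f : M -> N),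
    [/\ V N, bijective f, f 1 = 1 & forall a b, f (a * b) = f b * f a].

Definition finitely_based (V : mclass) : Prop :=
  exists Sigma : seq identity, eqclass V (var [set` Sigma]).

Definition limit_variety (V : mclass) : Prop :=
  [/\ variety V, ~ finitely_based V
    & forall W, variety W -> subclass W V -> ~ eqclass W V ->
        finitely_based W].

(* The free semigroup with zero: [None] is the zero and [Some (a, u)] is the
   nonempty word [a :: u]. *)
Section FreeSemigroup0.
Variable X : choiceType.

Definition free0 : Type := option (X * seq X).
HB.instance Definition _ := Choice.on free0.

Definition free0_mul (p q : free0) : free0 :=
  match p, q with
  | Some (a, u), Some (b, v) => Some (a, u ++ b :: v)
  | _, _ => None
  end.

Fact free0_mulA : associative free0_mul.
Proof. by move=> [[a u]|] [[b v]|] [[c w]|] //=; rewrite -catA. Qed.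

HB.instance Definition _ := isSemigroup.Build free0 free0_mulA.

Definition zero : free0 := None.
Definition gen (a : X) : free0 := Some (a, [::]).
End FreeSemigroup0.
Arguments zero {X}.

Section Presentation.
Variables (X : choiceType) (R : seq (free0 X * free0 X)).

Inductive congruence : free0 X -> free0 X -> Prop :=
| congruence_rel u v : (u, v) \in R -> congruence u v
| congruence_refl u : congruence u u
| congruence_sym u v : congruence u v -> congruence v u
| congruence_trans v u w : congruence u v -> congruence v w -> congruence u w
| congruence_mul u u' v v' :
    congruence u u' -> congruence v v' -> congruence (u * v) (u' * v').

Definition congruenceb : rel (free0 X) := fun u v => `[< congruence u v >].

Fact congruenceb_refl : reflexive congruenceb.
Proof. by move=> u; apply/asboolP/congruence_refl. Qed.
Fact congruenceb_sym : symmetric congruenceb.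
Proof. by move=> u v; apply/asboolP/asboolP; apply: congruence_sym. Qed.
Fact congruenceb_trans : transitive congruenceb.
Proof.
move=> v u w /asboolP uv /asboolP vw.
by apply/asboolP; apply: congruence_trans uv vw.
Qed.

Canonical congruenceb_equiv :=
  EquivRel congruenceb congruenceb_refl congruenceb_sym congruenceb_trans.

Local Open Scope quotient_scope.

Definition presented : Type := {eq_quot congruenceb}.
HB.instance Definition _ := EqQuotient.on presented.
HB.instance Definition _ := Choice.on presented.

Definition presented_mul (p q : presented) : presented :=
  \pi_presented (repr p * repr q).

Fact presented_piM (u v : free0 X) :
  presented_mul (\pi_presented u) (\pi_presented v) = \pi_presented (u * v).
Proof.
have reprP w : congruence (repr (\pi_presented w)) w.
  have : repr (\pi_presented w) = w %[mod presented] by rewrite reprK.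
  by move=> /eqmodP /asboolP.
by apply/eqmodP/asboolP/congruence_mul.
Qed.

Fact presented_mulA : associative presented_mul.
Proof.
elim/quotW=> u; elim/quotW=> v; elim/quotW=> w.
rewrite (presented_piM v w) (presented_piM u v).
by rewrite (presented_piM u (v * w)) (presented_piM (u * v) w) mulgA.
Qed.

HB.instance Definition _ := isSemigroup.Build presented presented_mulA.
End Presentation.

(* [S^1]; the identity element [None] is new even if [S] already has one. *)
Section Adjoin1.
Variable S : semigroupType.

Definition adjoin1 : Type := option S.
HB.instance Definition _ := Choice.on adjoin1.

Definition adjoin1_mul (p q : adjoin1) : adjoin1 :=
  match p, q with
  | Some a, Some b => Some (a * b)
  | Some a, None => Some a
  | None, _ => q
  end.

Fact adjoin1_mulA : associative adjoin1_mul.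
Proof. by move=> [a|] [b|] [c|] //=; rewrite mulgA. Qed.
Fact adjoin1_mul1 : left_id None adjoin1_mul.
Proof. by case. Qed.
Fact adjoin1_1mul : right_id None adjoin1_mul.
Proof. by case. Qed.

HB.instance Definition _ :=
  isMonoid.Build adjoin1 adjoin1_mulA adjoin1_mul1 adjoin1_1mul.
End Adjoin1.

Section PresentationA0.
Local Notation a := (gen (@Ordinal 2 0 isT)).
Local Notation b := (gen (@Ordinal 2 1 isT)).

Definition sgA0 : Type :=
  @presented 'I_2 [:: (a * a, a); (b * b, b); (a * b, zero)].
End PresentationA0.

Section PresentationsAK.
Local Notation a := (gen (@Ordinal 3 0 isT)).
Local Notation b := (gen (@Ordinal 3 1 isT)).
Local Notation c := (gen (@Ordinal 3 2 isT)).

Definition sgA : Type :=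
  @presented 'I_3
    [:: (a * a, a); (b * b, b); (a * b, zero); (c * a, zero);
        (a * c, c); (c * b, c)].

Definition sgK : Type :=
  @presented 'I_3
    [:: (a * a, a); (b * b, b * b * b); (b * c * b * b, b * c * b);
        (c * a, c); (a * b * c, zero); (a * c, zero); (b * a, zero);
        (b * b * c, zero)].
End PresentationsAK.

HB.instance Definition _ := Semigroup.on sgA0.
HB.instance Definition _ := Semigroup.on sgA.
HB.instance Definition _ := Semigroup.on sgK.

Definition varA01 : mclass := generated (adjoin1 sgA0).
Definition varA1 : mclass := generated (adjoin1 sgA).
Definition varK1 : mclass := generated (adjoin1 sgK).

(* [None] is the zero, i.e. the class of all words that are not factors of a
   word in [W]. *)
Section Rees.
Variable W : seq word.

Definition factor (u : word) : bool := has (infix u) W.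

Definition rees : Type := option {u : word | factor u}.
HB.instance Definition _ := Choice.on rees.

Definition rees_one : rees := insub [::].
Definition rees_mul (p q : rees) : rees :=
  match p, q with
  | Some u, Some v => insub (val u ++ val v)
  | _, _ => None
  end.

Fact factor_catl u v : factor (u ++ v) -> factor u.
Proof. by case/hasP=> w Ww /catr_infix uw; apply/hasP; exists w. Qed.
Fact factor_catr u v : factor (u ++ v) -> factor v.
Proof. by case/hasP=> w Ww /catl_infix uw; apply/hasP; exists w. Qed.

Fact rees_mulA : associative rees_mul.
Proof.
move=> [u|] [v|] [w|] //=; last by case: insub.
case: (insubP _ (val v ++ val w)) => [vw _ vwE|vwN];
    case: (insubP _ (val u ++ val v)) => [uv _ uvE|uvN] //=.
- by rewrite vwE uvE catA.
- rewrite insubN // vwE; apply: contra uvN; rewrite catA; exact: factor_catl.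
- rewrite insubN // uvE; apply: contra vwN; rewrite -catA; exact: factor_catr.
Qed.

Fact rees_mul1 : left_id rees_one rees_mul.
Proof.
move=> [[u Wu]|]; rewrite /rees_one /rees_mul; last by case: insub.
have W0 : factor [::] by apply: (@factor_catl [::] u).
by rewrite insubT /= insubT.
Qed.

Fact rees_1mul : right_id rees_one rees_mul.
Proof.
move=> [[u Wu]|] //; rewrite /rees_one /rees_mul.
have W0 : factor [::] by apply: (@factor_catl [::] u).
by rewrite insubT /= insubT ?cats0 //= => Wu'; congr Some; apply: val_inj.
Qed.

HB.instance Definition _ :=
  isMonoid.Build rees rees_mulA rees_mul1 rees_1mul.
End Rees.

Definition varM (W : seq word) : mclass := generated (rees W).

Local Close Scope group_scope.

Module Letters.
Definition x_ (i : nat) : letter := (0, i).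
Definition y_ (i : nat) : letter := (1, i).
Definition z_ (i : nat) : letter := (2, i).
Definition s_ (i : nat) : letter := (3, i).
Definition t_ (i : nat) : letter := (4, i).
Definition x : letter := x_ 0.
Definition y : letter := y_ 0.
Definition z : letter := z_ 0.
Definition s : letter := s_ 0.
Definition t : letter := t_ 0.
End Letters.

Section Varieties.
Import Letters.

Definition varE1sigma2 : mclass := var
  [set` [:: ([:: x; t; x], [:: x; t; x; x]);
            ([:: x; t; x; x], [:: x; x; t; x]);
            ([:: x; y; y; x], [:: x; x; y; y]);
            ([:: x; t_ 1; y; t_ 2; x; x; y; y],
             [:: x; t_ 1; y; t_ 2; y; y; x; x])]].

(* [enum 'I_n] is [0, ..., n-1], while subscripts range over [1, ..., n]:
   the subscript [(i+1)pi] is rendered as [(pi i).+1]. *)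

Definition J_identity n (pi : 'S_n) : identity :=
  let zpi := [seq z_ (pi i).+1 | i <- enum 'I_n] in
  let tz := flatten [seq [:: t_ i; z_ i] | i <- iota 1 n] in
  ([:: x] ++ zpi ++ [:: x] ++ tz, [:: x; x] ++ zpi ++ tz).

Definition varJ : mclass := var
  ([set` [:: ([:: x; x; y; y], [:: y; y; x; x]);
             ([:: x; y; x], [:: x; y; x; x]);
             ([:: x; y; z; x; y], [:: y; x; z; x; y]);
             ([:: x; y; x; z; t; x], [:: x; y; x; z; x; t; x])]]
   `|` [set e | exists n (pi : 'S_n), (1 <= n)%N /\ e = J_identity pi]).

Definition xz_word n (pi tau : 'S_(2 * n)) : word :=
  flatten [seq [:: x_ (pi i).+1; z_ (tau i).+1] | i <- enum 'I_(2 * n)].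

Definition J1_identity n (pi tau : 'S_(2 * n)) : identity :=
  let p := flatten [seq [:: x_ i; t_ i] | i <- iota 1 n]
           ++ [:: x] ++ [seq z_ i | i <- iota 1 (2 * n)] ++ [:: y]
           ++ flatten [seq [:: t_ i; x_ i] | i <- iota n.+1 n] in
  let q := xz_word pi tau in
  (p ++ [:: t] ++ [:: x; y] ++ q, p ++ [:: t] ++ [:: y; x] ++ q).

Definition varJ1 : mclass := var
  ([set` [:: ([:: x; y; x; z], [:: x; y; x; z; x]);
             ([:: x; y; x; t; y], [:: x; x; y; t; y])]]
   `|` [set e | exists n (pi tau : 'S_(2 * n)),
          (1 <= n)%N /\ e = J1_identity pi tau]).

Definition J2_identity n (pi tau : 'S_(2 * n)) : identity :=
  let p := flatten [seq [:: x_ i; t_ i] | i <- iota 1 (2 * n)]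
           ++ [:: x] ++ flatten [seq [:: z_ i; s_ i] | i <- iota 1 n] ++ [:: y]
           ++ [seq z_ i | i <- iota n.+1 n] in
  let q := xz_word pi tau ++ [:: t] ++ [seq s_ i | i <- iota 1 n] in
  (p ++ [:: x; y] ++ q, p ++ [:: y; x] ++ q).

Definition varJ2 : mclass := var
  ([set` [:: ([:: x; y; x; z], [:: x; y; x; z; x]);
             ([:: x; y_ 1; y; s; x; y; x_ 1; y_ 1; t; x_ 1],
              [:: x; y_ 1; y; s; y; x; x_ 1; y_ 1; t; x_ 1])]]
   `|` [set e | exists n (pi tau : 'S_(2 * n)),
          (1 <= n)%N /\ e = J2_identity pi tau]).

Definition word_xzxyty : word := [:: x; z; x; y; t; y].
Definition word_xyzxty : word := [:: x; y; z; x; t; y].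
Definition word_xzytxy : word := [:: x; z; y; t; x; y].
End Varieties.

(* Main.v *)
Require Import Defs.
From HB Require Import structures.
From mathcomp Require Import all_boot boolp classical_sets generic_quotient.
From mathcomp Require Import zify.

(** Let V be the join in question. The letters occurring once in a word, its
linear letters, cut the word into blocks, and the identities of V can be
studied block by block. Two facts hold in each of the three varieties that are
joined. A factor all of whose letters occur both before and after it matters
only through the set of its letters ([inner_content]). And if the letters of c
and d are repeated in the word p x c x d x q, then this word equals
p x c d x q: inside a block, an occurrence lying between two others of its
letter can be deleted ([deletes_inner]). The first fact follows from the short
identities in [base]; the second does not follow from finitely many identities
of V. A fully invariant congruence that has the second property and contains
[base] is called good.

The heart of the proof is [good_transfer]: if R and S are good and R contains
those of eleven fixed identities, the [items], that belong to S, then S is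
included in R. Let u and v be related by S. Their contents, their linear
letters and the order of these agree, unless S contains x = 1, x = x^2 or
xy = yx, and then the claim is easy or reduces to words that do agree. Modulo
R, letters are inserted into the blocks of u and v until corresponding blocks
have the same content ([merge_contents]), every letter is brought to exactly
two occurrences in each of its blocks ([normal_block]), and the blocks of u are
sorted into those of v by exchanging adjacent occurrences ([bubble]). A step
that is not always possible modulo R is needed only when u and v disagree on
one or two letters; restricting u and v to these and to neighbouring linear
letters then shows that S contains an item, hence so does R, and this item
permits the step.

It follows that proper subvarieties of V are finitely based
([limit_the_join]). A proper subvariety misses one of the three varieties
joined. By transfer it satisfies an item failing there, hence
x^2 y^2 = (xy)^2, or xtyxsy = xtxyxsy, or the mirror image of the latter. Each
of these three identities implies, with [base], that inner occurrences can be
deleted ([inner_of_star], [inner_of_first]). So [base] and the items of the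
subvariety already generate a good congruence, and by transfer they form a
basis.

V itself is not finitely based ([not_finitely_based]). Deletion of an inner
occurrence shows that z a_0^2 z a_1^2 ... a_n^2 z and z a_0^2 a_1^2 ... a_n^2 z
are equal in V. Yet identities of V with sides shorter than n never lead from
the second word to one where some z is preceded by no a_n and followed by no
a_0. For such a step, each of the n boundaries between a_i and a_(i+1) would
have to be the end of the image of a letter, and these letters would be
pairwise different ([never_cut]). The syntactic monoid of the property so
preserved satisfies the short identities of V, but not all identities of V.

The thirteen comparisons need one identity each. The varieties J, J_1, J_2,
their duals and the two varieties M(W) satisfy an identity that fails in A_0^1.
Each of the other five violates xtx = xxtx or xxyytx = xyxytx or the mirror
image of one of these, which are identities of V. *)

Set Implicit Arguments.
Unset Strict Implicit.
Unset Printing Implicit Defensive.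

(** * Fully invariant congruences given by patterns *)

(** Identities with letters numbered by naturals, in which words are
substituted directly: the number i stands for the i-th word of a list, and for
the empty word when the list is too short, which erases that letter. The numbers
0, 1, 2, 3 are read as x, y, t, s. *)
Definition pattern : Type := (seq nat * seq nat)%type.

Definition inst (ws : seq word) (P : seq nat) : word :=
  flatten [seq nth [::] ws i | i <- P].

Definition holds (R : word -> word -> Prop) (e : pattern) : Prop :=
  forall ws, R (inst ws e.1) (inst ws e.2).

Definition subst (f : letter -> word) (u : word) : word := flatten (map f u).

Definition flip (e : pattern) : pattern := (rev e.1, rev e.2).

Definition p_sqr : pattern := ([:: 0; 2; 0], [:: 0; 2; 0; 0]).
Definition p_dup1 : pattern := ([:: 0; 2; 1; 3; 0; 1], [:: 0; 2; 1; 3; 1; 0; 1]).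
Definition p_dup2 : pattern := ([:: 1; 2; 0; 3; 0; 1], [:: 1; 2; 0; 3; 1; 0; 1]).
Definition p_mid : pattern :=
  ([:: 0; 2; 2; 0; 3; 3; 0], [:: 0; 2; 2; 3; 3; 0]).

(** A list closed under reversal. It allows repeated letters to be doubled
and inner occurrences to be exchanged, and it holds in A_0^1 and E^1{sigma_2}. *)
Definition base : seq pattern :=
  [:: p_sqr; flip p_sqr; p_dup1; p_dup2; flip p_dup1; flip p_dup2; p_mid; flip p_mid].

Definition p_triv : pattern := ([:: 0], [::]).
Definition p_band : pattern := ([:: 0], [:: 0; 0]).
Definition p_comm : pattern := ([:: 0; 1], [:: 1; 0]).
Definition p_fill : pattern := ([:: 0; 2; 3; 0], [:: 0; 2; 0; 3; 0]).
Definition p_before : pattern := ([:: 2; 0; 3; 0], [:: 0; 2; 0; 3; 0]).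
Definition p_star : pattern := ([:: 0; 0; 1; 1], [:: 0; 1; 0; 1]).
Definition p_firsts : pattern :=
  ([:: 0; 1; 2; 0; 3; 1], [:: 1; 0; 2; 0; 3; 1]).
Definition p_first : pattern :=
  ([:: 0; 2; 1; 0; 3; 1], [:: 0; 2; 0; 1; 0; 3; 1]).

(** The possible differences between two good congruences. The first
three concern the content, the multiplicity and the order of linear letters;
[p_fill] and [p_before] the content of a block; [p_star], [p_firsts] and
[p_first] the order of two letters in a block. *)
Definition items : seq pattern :=
  [:: p_triv; p_band; p_comm; p_fill; p_before; flip p_before; p_star;
      p_firsts; flip p_firsts; p_first; flip p_first].

(** Fully invariant congruences on the free monoid. *)
Record fic (R : word -> word -> Prop) : Prop := Fic {
  fic_refl : forall u, R u u;
  fic_sym : forall u v, R u v -> R v u;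
  fic_trans : forall v u w, R u v -> R v w -> R u w;
  fic_ctx : forall p q u v, R u v -> R (p ++ u ++ q) (p ++ v ++ q);
  fic_subst : forall f u v, R u v -> R (subst f u) (subst f v) }.

(** The hypothesis on the letters of c and d keeps the three
occurrences of x within one block: no linear letter separates them. *)
Definition deletes_inner (R : word -> word -> Prop) : Prop :=
  forall p x c d q,
    {in c ++ d, forall y, 1 < count_mem y (p ++ x :: c ++ x :: d ++ x :: q)} ->
    R (p ++ x :: c ++ x :: d ++ x :: q) (p ++ x :: c ++ d ++ x :: q).

Record based (R : word -> word -> Prop) : Prop := Based {
  based_fic :> fic R;
  based_holds : forall e, e \in base -> holds R e }.

Record good (R : word -> word -> Prop) : Prop := Good {
  good_based :> based R;
  good_inner : deletes_inner R }.

Ltac list_eq :=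
  rewrite /inst /= -?cats1 ?cats0 -?catA /= -?catA /= -?catA /= ?cats0; reflexivity.

Section Fic.
Variables (R : word -> word -> Prop) (HR : fic R).

Lemma fic_step p q u v w w' :
  R u v -> w = p ++ u ++ q -> w' = p ++ v ++ q -> R w w'.
Proof. by move=> uv -> ->; apply: fic_ctx. Qed.

Lemma fic_conv u v w w' : R u v -> w = u -> w' = v -> R w w'.
Proof. by move=> uv -> ->. Qed.

Lemma fic_cat u u' v v' : R u u' -> R v v' -> R (u ++ v) (u' ++ v').
Proof.
move=> uu vv; apply: (fic_trans HR (v := u' ++ v)).
  by apply: (fic_step (p := [::]) (q := v) uu).
by apply: (fic_step (p := u') (q := [::]) vv); rewrite ?cats0.
Qed.

Lemma subst_cat f (u v : word) : subst f (u ++ v) = subst f u ++ subst f v.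
Proof. by rewrite /subst map_cat flatten_cat. Qed.

Lemma subst_cons f a (u : word) : subst f (a :: u) = f a ++ subst f u.
Proof. by []. Qed.

Lemma fic_filter (P : pred letter) u v :
  R u v -> R (filter P u) (filter P v).
Proof.
have E w : filter P w = subst (fun a => if P a then [:: a] else [::]) w.
  by elim: w => //= a w ->; rewrite /subst /=; case: (P a).
by rewrite !E; apply: fic_subst.
Qed.

(** Substituting words for the letters of one injective instance
gives all instances, so it suffices to prove an identity for distinct letters. *)
Lemma holds_letters (ls : seq letter) (e : pattern) d :
  uniq ls -> all (gtn (size ls)) (e.1 ++ e.2) ->
  R (map (nth d ls) e.1) (map (nth d ls) e.2) -> holds R e.
Proof.
move=> Uls /allP szP Re ws.
pose f a := nth [::] ws (index a ls).
have E P : all (gtn (size ls)) P -> inst ws P = subst f (map (nth d ls) P).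
  move=> /allP PP; rewrite /inst /subst -map_comp; congr flatten.
  by apply/eq_in_map => i /PP iP /=; rewrite /f index_uniq.
rewrite !E; first exact: fic_subst.
  by apply/allP => i iP; apply: szP; rewrite mem_cat iP orbT.
by apply/allP => i iP; apply: szP; rewrite mem_cat iP.
Qed.

Lemma fresh (s : seq letter) : exists a, a \notin s.
Proof.
have le_max : forall a : letter, a \in s -> a.1 <= \max_(b <- s) b.1.
  elim: s => //= b s IH a; rewrite in_cons big_cons leq_max.
  by case/orP=> [/eqP->|/IH->]; rewrite ?leqnn ?orbT.
exists (((\max_(a <- s) a.1).+1, 0) : letter).
by apply/negP => /le_max; rewrite ltnn.
Qed.
End Fic.

Section Dual.
Variable R : word -> word -> Prop.

Definition mirror (u v : word) : Prop := R (rev u) (rev v).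

Lemma rev_inst ws P : rev (inst ws P) = inst (map rev ws) (rev P).
Proof.
elim: P => //= i P IH; rewrite /inst /= rev_cat -/(inst ws P) IH rev_cons.
rewrite /inst map_rcons -cats1 flatten_cat /= cats0; congr (_ ++ _).
have [ilt|ige] := ltnP i (size ws); first by rewrite (nth_map [::]).
by rewrite !nth_default ?size_map.
Qed.

Lemma holds_flip e : holds mirror e <-> holds R (flip e).
Proof.
split=> H ws; last by rewrite /mirror !rev_inst; apply: H.
have := H (map rev ws); rewrite /mirror !rev_inst.
by rewrite -map_comp (eq_map revK) map_id.
Qed.

Lemma fic_mirror : fic R -> fic mirror.
Proof.
move=> HR; split; rewrite /mirror.
- by move=> u; apply: fic_refl.
- by move=> u v; apply: fic_sym.
- by move=> u v w; apply: fic_trans.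
- move=> p q u v uv; rewrite !rev_cat -!catA; exact: fic_ctx.
move=> f u v uv.
have E w : rev (subst f w) = subst (rev \o f) (rev w).
  elim: w => //= a w IH.
  by rewrite subst_cons rev_cat IH rev_cons -cats1 subst_cat /subst /= cats0.
by rewrite !E; apply: fic_subst.
Qed.

Lemma flipK : involutive flip.
Proof. by case=> u v; rewrite /flip /= !revK. Qed.

Lemma based_mirror : based R -> based mirror.
Proof.
move=> HR; split; first exact: fic_mirror HR.
move=> e eb; apply/holds_flip; apply: based_holds => //.
have /allP H : all (fun e' => flip e' \in base) base by [].
exact: H.
Qed.

Lemma good_mirror : good R -> good mirror.
Proof.
move=> HR; split; first exact: based_mirror HR.
move=> p x c d q cnt; rewrite /mirror.
have := @good_inner _ HR (rev q) x (rev d) (rev c) (rev p).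
rewrite !(rev_cat, rev_cons) -!cats1 -!catA /=; apply.
move=> y; rewrite mem_cat !mem_rev orbC -mem_cat => /cnt.
rewrite !(count_cat, count_rev) /= !(count_cat, count_rev) /=.
by rewrite !(count_cat, count_rev) /= !(count_cat, count_rev) /= ; lia.
Qed.
End Dual.

Section Based.
Variables (R : word -> word -> Prop) (HR : based R).

Lemma sqr_l (p q : word) x : x \in p -> R (p ++ x :: q) (p ++ x :: x :: q).
Proof.
case/path.splitPr => p1 p2.
have H := based_holds HR (e := p_sqr) isT [:: [:: x]; [::]; p2].
by apply: (fic_step HR (p := p1) (q := q) H); list_eq.
Qed.

Lemma sqr_r (p q : word) x : x \in q -> R (p ++ x :: q) (p ++ x :: x :: q).
Proof.
case/path.splitPr => p1 p2.
have H := based_holds HR (e := flip p_sqr) isT [:: [:: x]; [::]; p1].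
by apply: (fic_step HR (p := p) (q := p2) H); list_eq.
Qed.

(** The two patterns cover both orders in which x and z may have occurred
earlier. *)
Lemma dup_l (p q : word) x z : x \in p -> z \in p ->
  R (p ++ x :: z :: q) (p ++ z :: x :: z :: q).
Proof.
have [-> zp _|xz] := eqVneq x z; first exact: sqr_l.
case/path.splitPr => p1 p2; rewrite mem_cat in_cons eq_sym (negbTE xz) /=.
case/orP; case/path.splitPr => p3 p4.
  have H := based_holds HR (e := p_dup2) isT [:: [:: x]; [:: z]; p4; p2].
  by apply: (fic_step HR (p := p3) (q := q) H); list_eq.
have H := based_holds HR (e := p_dup1) isT [:: [:: x]; [:: z]; p3; p4].
by apply: (fic_step HR (p := p1) (q := q) H); list_eq.
Qed.
End Based.

Section Inner.
Variables (R : word -> word -> Prop) (HR : based R).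

Let Rt := fic_trans HR.
Let Rs := fic_sym HR.

Lemma dup_r (p q : word) x z : x \in q -> z \in q ->
  R (p ++ z :: x :: q) (p ++ z :: x :: z :: q).
Proof.
move=> xq zq.
have := @dup_l _ (based_mirror HR) (rev q) (rev p) x z.
rewrite /mirror !mem_rev => /(_ xq zq).
by rewrite !(rev_cat, rev_cons, revK) -!cats1 -!catA /=.
Qed.

(** Both sides equal p z x z q: the first z is added thanks to what
precedes, the last one thanks to what follows. *)
Lemma swap_inner (p q : word) x z :
  x \in p -> z \in p -> x \in q -> z \in q ->
  R (p ++ x :: z :: q) (p ++ z :: x :: q).
Proof.
move=> xp zp xq zq; apply: Rt (dup_l HR _ xp zp) _.
by apply: Rs; apply: dup_r.
Qed.

Lemma move_inner (p q c : word) x :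
  {subset x :: c <= p} -> {subset x :: c <= q} ->
  R (p ++ c ++ x :: q) (p ++ x :: c ++ q).
Proof.
elim: c p => [|y c IH] p sp sq; first exact: (fic_refl HR).
have sub (a : letter) : a \in x :: c -> a \in x :: y :: c.
  by rewrite !in_cons; case/orP=> ->; rewrite ?orbT.
apply: (@Rt (p ++ y :: x :: c ++ q)).
  have := IH (p ++ [:: y]); rewrite -!catA /=; apply.
    by move=> a /sub /sp; rewrite mem_cat => ->.
  by move=> a /sub /sq.
by apply: swap_inner; rewrite ?mem_cat ?sp ?sq ?orbT // !in_cons eqxx ?orbT.
Qed.

Lemma absorb_inner (p q c : word) x :
  x \in c -> {subset c <= p} -> {subset c <= q} ->
  R (p ++ c ++ q) (p ++ x :: c ++ q).
Proof.
move=> /[dup] xc; case/path.splitPr: xc => c1 c2 xc sp sq.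
have H r : {subset c2 ++ q <= r} ->
    R (p ++ c1 ++ x :: r) (p ++ x :: c1 ++ r) => [sr|].
  have sub (a : letter) : a \in x :: c1 -> a \in c1 ++ x :: c2.
    by rewrite mem_cat !in_cons; case/orP=> ->; rewrite ?orbT.
  apply: move_inner => a /sub ac; first exact: sp.
  by apply: sr; rewrite mem_cat sq ?orbT.
apply: (@Rt (p ++ c1 ++ x :: x :: c2 ++ q)).
  have xpc : x \in p ++ c1 by rewrite mem_cat sp ?mem_cat ?mem_head ?orbT.
  by apply: fic_conv (sqr_l HR (c2 ++ q) xpc) _ _; list_eq.
rewrite -catA; apply: H => a; rewrite in_cons => ->; exact: orbT.
Qed.

Lemma absorbs_inner (p q c c' : word) :
  {subset c' <= c} -> {subset c <= p} -> {subset c <= q} ->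
  R (p ++ c ++ q) (p ++ c' ++ c ++ q).
Proof.
move=> cc sp sq; elim: c' cc => [|x c' IH] cc; first exact: (fic_refl HR).
have {}IH : R (p ++ c ++ q) (p ++ c' ++ c ++ q).
  by apply: IH => a ac; apply: cc; rewrite in_cons ac orbT.
apply: Rt IH _; rewrite catA -[X in R _ X]/(p ++ x :: c' ++ c ++ q).
have := @absorb_inner p q (c' ++ c) x; rewrite -!catA; apply.
- by rewrite mem_cat cc ?mem_head ?orbT.
- by move=> a; rewrite mem_cat => /orP[ac|/sp//]; apply/sp/cc; rewrite in_cons ac orbT.
by move=> a; rewrite mem_cat => /orP[ac|/sq//]; apply/sq/cc; rewrite in_cons ac orbT.
Qed.

Lemma moves_inner (p q c c' : word) :
  {subset c ++ c' <= p} -> {subset c ++ c' <= q} ->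
  R (p ++ c ++ c' ++ q) (p ++ c' ++ c ++ q).
Proof.
elim: c' p => [|x c' IH] p sp sq; first exact: (fic_refl HR).
have sub (a : letter) : a \in c ++ c' -> a \in c ++ x :: c'.
  by rewrite !mem_cat in_cons; case/orP=> ->; rewrite ?orbT.
apply: (@Rt (p ++ x :: c ++ c' ++ q)).
  apply: move_inner => a ac.
    by apply: sp; move: ac; rewrite mem_cat !in_cons; case/orP=> ->; rewrite ?orbT.
  rewrite mem_cat sq ?orbT //.
  by move: ac; rewrite mem_cat !in_cons; case/orP=> ->; rewrite ?orbT.
have := IH (p ++ [:: x]); rewrite -!catA /=; apply.
  by move=> a /sub /sp; rewrite mem_cat => ->.
by move=> a /sub /sq.
Qed.

(** Inside c every letter is neither first nor last, so its occurrences
can be added, merged and permuted freely. *)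
Lemma inner_content (p q c c' : word) :
  c =i c' -> {subset c <= p} -> {subset c <= q} ->
  R (p ++ c ++ q) (p ++ c' ++ q).
Proof.
move=> cc sp sq.
have sp' : {subset c' <= p} by move=> a; rewrite -cc; apply: sp.
have sq' : {subset c' <= q} by move=> a; rewrite -cc; apply: sq.
apply: (@Rt (p ++ c' ++ c ++ q)).
  by apply: absorbs_inner => // a; rewrite cc.
apply: (@Rt (p ++ c ++ c' ++ q)); last first.
  by apply: Rs; apply: absorbs_inner => // a; rewrite cc.
by apply: moves_inner => a; rewrite mem_cat -cc orbb; [apply: sp|apply: sq].
Qed.
End Inner.

(** * Deleting inner occurrences *)

Section Split.
Variable T : eqType.
Implicit Types (P : pred T) (s : seq T).

Lemma split_first P s : has P s ->
  exists s1 a s2, [/\ s = s1 ++ a :: s2, P a & ~~ has P s1].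
Proof.
elim: s => //= a s IH; have [Pa _|Pa /= /IH[s1 [b [s2 [-> Pb nP]]]]] := boolP (P a).
  by exists [::], a, s.
by exists (a :: s1), b, s2; rewrite /= negb_or Pa.
Qed.

Lemma split_last P s : has P s ->
  exists s1 a s2, [/\ s = s1 ++ a :: s2, P a & ~~ has P s2].
Proof.
rewrite -has_rev => /split_first[s1 [a [s2 [E Pa nP]]]].
exists (rev s2), a, (rev s1); rewrite has_rev; split=> //.
by rewrite -(revK s) E rev_cat rev_cons -cats1 -catA.
Qed.

Lemma split_first_mem x s : x \in s ->
  exists s1 s2, s = s1 ++ x :: s2 /\ x \notin s1.
Proof.
rewrite -has_pred1 => /split_first[s1 [a [s2 [-> /eqP-> nP]]]].
by exists s1, s2; rewrite -has_pred1.
Qed.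

Lemma split_last_mem x s : x \in s ->
  exists s1 s2, s = s1 ++ x :: s2 /\ x \notin s2.
Proof.
rewrite -has_pred1 => /split_last[s1 [a [s2 [-> /eqP-> nP]]]].
by exists s1, s2; rewrite -has_pred1.
Qed.
End Split.

Definition doubled (c : word) : word := flatten [seq [:: a; a] | a <- c].

Lemma doubled_cat c d : doubled (c ++ d) = doubled c ++ doubled d.
Proof. by rewrite /doubled map_cat flatten_cat. Qed.

Lemma mem_doubled c : doubled c =i c.
Proof.
move=> a; elim: c => //= b c IH; rewrite /doubled /= !in_cons -/(doubled c) IH.
by rewrite orbA orbb.
Qed.

Lemma count_doubled c a : count_mem a (doubled c) = (count_mem a c).*2.
Proof. by elim: c => //= b c IH; rewrite /doubled /= -/(doubled c) IH; lia. Qed.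

Lemma multi_cases (c p q : word) y : 1 < count_mem y (p ++ c ++ q) ->
  [\/ y \in p, y \in q | 1 < count_mem y c].
Proof.
rewrite !count_cat; have [|/count_memPn->] := boolP (y \in p); first by constructor.
have [|/count_memPn->] := boolP (y \in q); first by constructor.
by rewrite addn0 add0n; constructor.
Qed.

Section Based.
Variables (R : word -> word -> Prop) (HR : based R).

Let Rr := fic_refl HR.
Let Rt := fic_trans HR.
Let Rs := fic_sym HR.

Lemma sqr_multi (p q : word) x :
  x \in p \/ x \in q -> R (p ++ x :: q) (p ++ x :: x :: q).
Proof. by case; [apply: sqr_l|apply: sqr_r]. Qed.

(** Every occurrence of a repeated letter can be doubled; this is how
blocks made of squares arise. *)
Lemma doubled_multi (c p q : word) :
  {in c, forall y, [\/ y \in p, y \in q | 1 < count_mem y c]} ->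
  R (p ++ c ++ q) (p ++ doubled c ++ q).
Proof.
elim: c p => [|a c IH] p H; first exact: Rr.
apply: (@Rt (p ++ a :: doubled c ++ q)).
  have := IH (p ++ [:: a]); rewrite -!catA /=; apply=> y yc.
  have /H[] : y \in a :: c by rewrite in_cons yc orbT.
  - by move=> yp; constructor 1; rewrite mem_cat yp.
  - by constructor 2.
  rewrite /=; have [->|ne] := eqVneq a y; last by constructor 3.
  by move=> _; constructor 1; rewrite mem_cat mem_head orbT.
apply: sqr_multi; have [ap|aq|cn] := H a (mem_head _ _); first by left.
  by right; rewrite mem_cat aq orbT.
right; rewrite mem_cat mem_doubled -has_pred1 has_count.
by move: cn; rewrite /= eqxx; case: (count _ c).
Qed.

Lemma pow (p q : word) x X : {subset X <= [:: x]} -> x \in p \/ x \in q ->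
  R (p ++ x :: X ++ q) (p ++ x :: q).
Proof.
elim: X => [|a X IH] sX xpq; first exact: Rr.
have := sX a (mem_head _ _); rewrite mem_seq1 => /eqP->.
apply: (@Rt (p ++ x :: X ++ q)); last first.
  by apply: IH => // b bX; apply: sX; rewrite in_cons bX orbT.
apply: Rs; apply: sqr_multi.
by case: xpq => [xp|xq]; [left|right; rewrite mem_cat xq orbT].
Qed.

Lemma pow_r (p q : word) x X : {subset X <= [:: x]} -> x \in q ->
  R (p ++ x :: X ++ q) (p ++ x :: q).
Proof. by move=> sX xq; apply: pow => //; right. Qed.

(** Let z be the last one of three occurrences in a block. By
[p_first], or by [dup_l] when the letter a on its left has occurred before, the
word a z may be replaced by z a z. So a copy of z can travel to the left through
d, which creates the middle occurrence. *)
Lemma inner_of_first : holds R p_first -> deletes_inner R.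
Proof.
move=> Rf.
have step p q a z : z \in p -> 1 < count_mem a (p ++ a :: z :: q) ->
    R (p ++ a :: z :: q) (p ++ z :: a :: z :: q).
  move=> zp ca; have [ap|ap] := boolP (a \in p); first exact: dup_l.
  have az : a != z by apply: contraNneq ap => ->.
  have: a \in q.
    move: ca; rewrite count_cat (count_memPn ap) /= eqxx eq_sym (negbTE az) add0n.
    by rewrite add1n ltnS -has_count has_pred1.
  case/path.splitPr => q1 q2; case/path.splitPr: zp => p1 p2.
  by apply: (fic_step HR (Rf [:: [:: z]; [:: a]; p2; q1]) (p := p1) (q := q2)); list_eq.
have pass d p q z : z \in p -> {in d, forall y, 1 < count_mem y (p ++ d ++ z :: q)} ->
    R (p ++ d ++ z :: q) (p ++ z :: d ++ z :: q).
  elim/last_ind: d p q => [|d a IH] p q zp H; first exact: sqr_l.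
  have ca : 1 < count_mem a (p ++ d ++ a :: z :: q).
    by rewrite -cat_rcons; apply: H; rewrite mem_rcons mem_head.
  have Hd : {in d, forall y, 1 < count_mem y (p ++ d ++ z :: a :: z :: q)}.
    move=> y yd; have := H y; rewrite mem_rcons in_cons yd orbT => /(_ isT).
    by rewrite cat_rcons !count_cat /=; lia.
  rewrite !cat_rcons; apply: (@Rt (p ++ d ++ z :: a :: z :: q)).
    have := @step (p ++ d) q a z; rewrite -!catA; apply=> //.
    by rewrite mem_cat zp.
  apply: Rt (IH _ _ zp Hd) _; apply: Rs.
  have := @step (p ++ z :: d) q a z; rewrite -!catA /=; apply=> //.
    by rewrite mem_cat zp.
  by move: ca; rewrite !count_cat /= !count_cat /=; lia.
move=> p x c d q H; apply: Rs.
have := @pass d (p ++ x :: c) q x; rewrite -!catA /=; apply.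
  by rewrite mem_cat mem_head orbT.
move=> y yd; have := H y; rewrite mem_cat yd orbT => /(_ isT).
rewrite !count_cat /= !count_cat /= !count_cat /=.
by case: eqVneq => _; lia.
Qed.

(** With [p_star], the doubling of all letters of a word and the
repetition of the word are the same, so c and d may be squared; [p_mid] then
deletes the middle x. *)
Lemma inner_of_star : holds R p_star -> deletes_inner R.
Proof.
move=> Rstar.
have dbl c : R (doubled c) (c ++ c).
  elim/last_ind: c => [|c a IH]; first exact: Rr.
  rewrite -cats1 doubled_cat; apply: (@Rt ((c ++ c) ++ [:: a; a])).
    exact: (fic_cat HR IH).
  by apply: (fic_conv (Rstar [:: c; [:: a]])); list_eq.
have sq c p q : {in c, forall y, [\/ y \in p, y \in q | 1 < count_mem y c]} ->
    R (p ++ c ++ q) (p ++ c ++ c ++ q).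
  move=> H; apply: Rt (doubled_multi H) _.
  by apply: (fic_step HR (dbl c)); rewrite ?catA.
move=> p x c d q H.
apply: (@Rt (p ++ x :: c ++ c ++ x :: d ++ d ++ x :: q)).
  apply: (@Rt (p ++ x :: c ++ c ++ x :: d ++ x :: q)).
    have := @sq c (p ++ [:: x]) (x :: d ++ x :: q); rewrite -!catA; apply.
    move=> y yc; apply: multi_cases; have := H y; rewrite mem_cat yc => /(_ isT).
    by rewrite -!catA.
  have := @sq d (p ++ x :: c ++ c ++ [:: x]) (x :: q); rewrite -!(catA, cat_cons).
  apply=> y yd; have := H y; rewrite mem_cat yd orbT => /(_ isT) cy.
  apply: multi_cases; move: cy.
  by rewrite !count_cat /= !count_cat /= !count_cat /=; lia.
apply: (@Rt (p ++ x :: c ++ c ++ d ++ d ++ x :: q)).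
  have := based_holds HR (e := p_mid) isT [:: [:: x]; [::]; c; d] => M.
  by apply: (fic_step HR M (p := p) (q := q)); list_eq.
apply: Rs; apply: (@Rt (p ++ x :: c ++ c ++ d ++ x :: q)).
  have := @sq c (p ++ [:: x]) (d ++ x :: q); rewrite -!catA; apply.
  move=> y yc; have [->|yx] := eqVneq y x.
    by constructor 1; rewrite mem_cat mem_head orbT.
  apply: multi_cases; have := H y; rewrite mem_cat yc => /(_ isT).
  by rewrite !count_cat /= !count_cat /= !count_cat /= eq_sym (negbTE yx); lia.
have := @sq d (p ++ x :: c ++ c) (x :: q); rewrite -!(catA, cat_cons); apply.
move=> y yd; have [->|yx] := eqVneq y x.
  by constructor 2; rewrite mem_head.
apply: multi_cases; have := H y; rewrite mem_cat yd orbT => /(_ isT).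
by rewrite !count_cat /= !count_cat /= !count_cat /= eq_sym (negbTE yx); lia.
Qed.
End Based.

(** * Identities forced by a disagreement between two words *)

Ltac uniq_letters := rewrite /= !inE !negb_or;
  repeat (apply/andP; split); first [done | by rewrite eq_sym].

Lemma filter_mem0 (T : eqType) (P : pred T) (s : seq T) :
  {in s, forall a, ~~ P a} -> filter P s = [::].
Proof.
move=> H; apply/eqP; rewrite -[_ == _]negbK -has_filter.
by apply/negP => /hasP[a /H/negP].
Qed.

Lemma subset1_cons (T : eqType) (a x : T) (s : seq T) :
  {subset a :: s <= [:: x]} -> a = x /\ {subset s <= [:: x]}.
Proof.
move=> H; split; first by apply/eqP; rewrite -[_ == _]mem_seq1 H ?mem_head.
by move=> b bs; apply: H; rewrite in_cons bs orbT.
Qed.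

Section Based.
Variables (R : word -> word -> Prop) (HR : based R).

Let Rt := fic_trans HR.
Let Rs := fic_sym HR.

Lemma fic_ctxs (p q : word) u v : R u v -> R (p ++ u ++ q) (p ++ v ++ q).
Proof. exact: (fic_ctx HR). Qed.

Lemma pows (p q : word) x X X' : X != [::] -> X' != [::] ->
  {subset X <= [:: x]} -> {subset X' <= [:: x]} -> x \in p \/ x \in q ->
  R (p ++ X ++ q) (p ++ X' ++ q).
Proof.
have one Y : Y != [::] -> {subset Y <= [:: x]} -> x \in p \/ x \in q ->
    R (p ++ Y ++ q) (p ++ x :: q).
  case: Y => // a Y _ /subset1_cons[-> sY].
  by move=> xpq; apply: pow.
by move=> X0 X0' sX sX' xpq; apply: Rt (one _ _ _ _) _ => //; apply: Rs; apply: one.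
Qed.

Lemma first_two (p q U : word) x y : {subset U <= [:: x; y]} -> y \in U ->
  x \in q -> y \in q -> R (p ++ x :: U ++ q) (p ++ x :: y :: q).
Proof.
move=> sU /split_first_mem[U1 [U2 [EU yU1]]] xq yq.
have sU1 : {subset U1 <= [:: x]}.
  move=> a aU; have := sU a; rewrite EU mem_cat aU => /(_ isT).
  by rewrite !inE => /orP[//|/eqP ay]; rewrite -ay aU in yU1.
have sU2 : {subset U2 <= [:: x; y]}.
  by move=> a aU; apply: sU; rewrite EU mem_cat in_cons aU !orbT.
apply: (@Rt (p ++ x :: y :: U2 ++ q)).
  rewrite EU -catA /=; apply: pow_r => //.
  by rewrite in_cons mem_cat xq !orbT.
have grow W : {subset W <= [:: x; y]} ->
    R (p ++ x :: y :: W ++ q) (p ++ x :: y :: y :: x :: W ++ q).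
  move=> sW; apply: (@Rt (p ++ x :: y :: x :: W ++ q)).
    by apply: dup_r => //; rewrite mem_cat ?xq ?yq orbT.
  have := @sqr_r _ HR (p ++ [:: x]) (x :: W ++ q) y; rewrite -!catA; apply.
  by rewrite in_cons mem_cat yq !orbT.
apply: Rt (grow _ sU2) _; apply: Rs; apply: Rt (grow [::] _) _ => //.
have := @inner_content _ HR (p ++ [:: x; y]) q [:: y; x] (y :: x :: U2).
rewrite -!catA /=; apply.
- move=> a; rewrite !inE; have := sU2 a; rewrite !inE.
  by case: (a \in U2) => [/(_ isT)|_]; rewrite ?orbF // => /orP[]->; rewrite ?orbT.
- by move=> a; rewrite !inE mem_cat !inE orbC => ->; rewrite orbT.
by move=> a; rewrite !inE => /orP[]/eqP->.
Qed.

(** The first letter among x, y is x in u and y in v. Restricting to x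
and y and appending t x s y makes all other occurrences inner ones, so that
only the order of the first two remains visible. *)
Lemma firsts_of (u u1 u2 v v1 v2 : word) x y : R u v -> x != y ->
  u = u1 ++ x :: u2 -> x \notin u1 -> y \notin u1 -> y \in u2 ->
  v = v1 ++ y :: v2 -> x \notin v1 -> y \notin v1 -> x \in v2 ->
  holds R p_firsts.
Proof.
move=> Ruv xy Eu xu1 yu1 yu2 Ev xv1 yv1 xv2.
have [t] := fresh [:: x; y]; rewrite !inE negb_or => /andP[tx ty].
have [s] := fresh [:: x; y; t]; rewrite !inE !negb_or => /and3P[sx sy st].
have := fic_filter HR (mem [:: x; y]) Ruv.
have E w a w1 w2 : w = w1 ++ a :: w2 -> x \notin w1 -> y \notin w1 ->
    a \in [:: x; y] ->
    filter (mem [:: x; y]) w = a :: filter (mem [:: x; y]) w2.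
  move=> -> xw yw ai; rewrite filter_cat /= ai filter_mem0 // => b bw.
  by rewrite !inE; apply/norP; split; apply: contraTneq bw => ->.
rewrite (E _ _ _ _ Eu) ?(E _ _ _ _ Ev) ?inE ?eqxx ?orbT //.
set U := filter _ u2; set V := filter _ v2 => RUV.
have sub w : {subset filter (mem [:: x; y]) w <= [:: x; y]}.
  by move=> a; rewrite mem_filter => /andP[].
apply: (@holds_letters _ HR [:: x; y; t; s] _ x) => //.
  by uniq_letters.
have yU : y \in U by rewrite mem_filter !inE eqxx orbT.
have xV : x \in V by rewrite mem_filter !inE eqxx.
apply: (@Rt (x :: U ++ [:: t; x; s; y])).
  apply: Rs; apply: (@first_two [::] _ U x y); rewrite ?inE ?eqxx ?orbT //.
  exact: sub.
apply: (@Rt (y :: V ++ [:: t; x; s; y])).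
  by apply: (fic_conv (@fic_ctxs [::] [:: t; x; s; y] _ _ RUV)); list_eq.
apply: (@first_two [::] _ V y x); rewrite ?inE ?eqxx ?orbT //.
by move=> a /sub; rewrite !inE orbC.
Qed.

(** A letter x present before the linear letter l and a letter y absent
there are met after l in different orders. This is [firsts_of] where x has
already occurred, so the comparison is of xly with xlxy. *)
Lemma first_of (u P B B1 B2 v P' B' B1' B2' : word) (l : letter) x y :
  R u v -> x != y -> u = P ++ l :: B -> v = P' ++ l :: B' ->
  l \notin P ++ B -> l \notin P' ++ B' ->
  x \in P -> x \in P' -> y \notin P -> y \notin P' ->
  B = B1 ++ x :: B2 -> x \notin B1 -> y \notin B1 -> y \in B2 ->
  B' = B1' ++ y :: B2' -> x \notin B1' -> y \notin B1' ->
  holds R p_first.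
Proof.
move=> Ruv xy Eu Ev lu lv xP xP' yP yP' EB xB1 yB1 yB2 EB' xB1' yB1'.
have lx : l != x by apply: contraNneq lu => ->; rewrite mem_cat xP.
have ly : l != y.
  by apply: contraNneq lu => ->; rewrite EB !mem_cat in_cons yB2 !orbT.
have [s] := fresh [:: x; y; l]; rewrite !inE !negb_or => /and3P[sx sy sl].
pose F := mem [:: x; y; l].
have := fic_filter HR F Ruv.
have sub w : l \notin w -> {subset filter F w <= [:: x; y]}.
  move=> lw a; rewrite mem_filter !inE => /andP[/or3P[->|->|/eqP->] //];
    by rewrite ?orbT // (negbTE lw).
have subx w : l \notin w -> y \notin w -> {subset filter F w <= [:: x]}.
  move=> lw yw a aF; have := sub _ lw a aF; rewrite !inE => /orP[//|/eqP ay].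
  by move: aF; rewrite mem_filter ay (negbTE yw) andbF.
have E a w1 w2 : l \notin w1 -> x \notin w1 -> y \notin w1 -> a \in [:: x; y; l] ->
    filter F (w1 ++ a :: w2) = a :: filter F w2.
  move=> lw xw yw aF; rewrite filter_cat /= aF filter_mem0 // => b bw.
  by rewrite !inE !negb_or; apply/and3P; split; apply: contraTneq bw => ->.
move: lu lv; rewrite !mem_cat !negb_or => /andP[lP lB] /andP[lP' lB'].
have El w : filter F (l :: w) = l :: filter F w by rewrite /= !inE eqxx !orbT.
rewrite Eu Ev !filter_cat !El EB EB'.
move: lB lB'; rewrite EB EB' !mem_cat !in_cons !negb_or.
move=> /and3P[lB1 _ lB2] /and3P[lB1' _ lB2'].
rewrite !E ?inE ?eqxx ?orbT //.
set X := filter F P; set X' := filter F P'; set U := filter F B2.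
set V := filter F B2' => RUV.
have X0 : X != [::] by rewrite -has_filter; apply/hasP; exists x; rewrite ?inE ?eqxx.
have X0' : X' != [::] by rewrite -has_filter; apply/hasP; exists x; rewrite ?inE ?eqxx.
have yU : y \in U by rewrite mem_filter !inE eqxx orbT.
apply: (@holds_letters _ HR [:: x; y; l; s] _ x) => //.
  by uniq_letters.
apply: Rs; rewrite /=.
have EX (W : word) Y : Y != [::] -> {subset Y <= [:: x]} -> x \in W ->
   R (Y ++ W) (x :: W).
  move=> Y0 sY xW; have := @pows [::] W x Y [:: x]; apply => //; by right.
apply: (@Rt (X ++ l :: x :: U ++ [:: x; s; y])).
  apply: Rs; apply: Rt (EX _ _ X0 (subx _ lP yP) _) _; first by rewrite !inE eqxx !orbT.
  apply: (@first_two [:: x; l] [:: x; s; y]); rewrite ?inE ?eqxx ?orbT //.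
  exact: sub.
apply: (@Rt (X' ++ l :: y :: V ++ [:: x; s; y])).
  by apply: (fic_conv (@fic_ctxs [::] [:: x; s; y] _ _ RUV)); list_eq.
apply: Rt (EX _ _ X0' (subx _ lP' yP') _) _.
  by rewrite !inE mem_cat !inE eqxx !orbT.
have sq W : R (x :: l :: y :: W ++ [:: x; s; y])
              ([:: x; l; y] ++ (y :: W ++ [:: x]) ++ [:: x; s; y]).
  apply: (@Rt (x :: l :: y :: y :: W ++ [:: x; s; y])).
    by apply: (@sqr_r _ HR [:: x; l]); rewrite mem_cat !inE eqxx !orbT.
  have := @sqr_l _ HR (x :: l :: y :: y :: W) [:: s; y] x; rewrite in_cons eqxx.
  by move=> /(_ isT) H; apply: (fic_conv H); list_eq.
apply: Rt (sq V) _; apply: Rs; apply: Rt (sq [::]) _.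
apply: inner_content => //.
- move=> a; rewrite !inE mem_cat !inE; have := sub _ lB2' a; rewrite !inE.
  by case: (a \in V) => [/(_ isT)|_]; case: (a == x); case: (a == y).
- by move=> a; rewrite !inE => /orP[]/eqP->; rewrite eqxx ?orbT.
by move=> a; rewrite !inE => /orP[]/eqP->; rewrite eqxx ?orbT.
Qed.

(** In u all occurrences of y precede those of x, in v some x precedes
some y. Restricted to x and y these words are y^i x^j and a word with an
alternation; multiplying by y on the left and x on the right gives both the
ends that [p_star] has. *)
Lemma star_of (u u1 u2 v v1 v2 : word) x y : R u v -> x != y ->
  u = u1 ++ u2 -> x \notin u1 -> y \in u1 -> y \notin u2 -> x \in u2 ->
  v = v1 ++ x :: v2 -> y \in v2 -> holds R p_star.
Proof.
move=> Ruv xy Eu xu1 yu1 yu2 xu2 Ev yv2.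
have yx : y != x by rewrite eq_sym.
pose F := mem [:: x; y].
have Fx : x \in [:: x; y] by rewrite inE eqxx.
have Fy : y \in [:: x; y] by rewrite !inE eqxx orbT.
have sub w : {subset filter F w <= [:: x; y]}.
  by move=> a; rewrite mem_filter => /andP[].
have sub1 w a b : {subset [:: x; y] <= [:: a; b]} -> b \notin w ->
    {subset filter F w <= [:: a]}.
  move=> sF bw c; rewrite mem_filter => /andP[/sF/[!inE]/orP[//|/eqP->]].
  by rewrite (negbTE bw).
have [w1 [w2 [Ew xw1 yw2]]] : exists w1 w2,
    [/\ v = w1 ++ x :: w2, x \notin w1 & y \in w2].
  have : x \in v by rewrite Ev mem_cat mem_head orbT.
  case/split_first_mem=> w1 [w2 [Ew xw1]]; exists w1, w2; split=> //.
  move: Ew; rewrite Ev => {Ruv Ev}; elim: w1 v1 xw1 => [|a w1 IH] [|b v1] /=.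
  - by move=> _ [<-].
  - by move=> _ [_ <-]; rewrite mem_cat in_cons yv2 !orbT.
  - by rewrite inE negb_or => /andP[/negbTE xa _] [/eqP]; rewrite xa.
  by rewrite inE negb_or => /andP[_ /IH{}IH] [_ /IH].
have [w3 [w4 [Ew2 yw4]]] := split_last_mem yw2.
have := fic_filter HR F Ruv; rewrite Eu Ew Ew2 !filter_cat /= Fx filter_cat /= Fy.
set Y := filter F u1; set X := filter F u2; set Y1 := filter F w1.
set W := filter F w3; set X4 := filter F w4 => RW.
have Y0 : Y != [::] by rewrite -has_filter; apply/hasP; exists y.
have X0 : X != [::] by rewrite -has_filter; apply/hasP; exists x.
have sX : {subset X <= [:: x]} by apply: (sub1 _ _ y).
have sY : {subset Y <= [:: y]} by apply: (sub1 _ _ x) => // a; rewrite !inE orbC.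
have sX4 : {subset X4 <= [:: x]} by apply: (sub1 _ _ y).
have sY1 : {subset Y1 <= [:: y]} by apply: (sub1 _ _ x) => // a; rewrite !inE orbC.
apply: (@holds_letters _ HR [:: y; x] _ x) => //=; first by rewrite inE yx.
apply: (@Rt (y :: Y ++ X ++ [:: x])).
  apply: Rs; apply: (@Rt ([:: y] ++ [:: y] ++ (X ++ [:: x]))).
    by apply: (@pows [:: y] _ y) => //; left; rewrite inE.
  have := @pows [:: y; y] [:: x] x X [:: x] X0 isT sX.
  by apply=> //; right; rewrite inE.
apply: (@Rt (y :: (Y1 ++ x :: W ++ y :: X4) ++ [:: x])).
  by apply: (fic_conv (@fic_ctxs [:: y] [:: x] _ _ RW)); list_eq.
apply: (@Rt (y :: x :: W ++ y :: X4 ++ [:: x])).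
  have H := @pow_r _ HR [::] (x :: W ++ y :: X4 ++ [:: x]) y Y1 sY1.
  apply: (fic_conv (H _)); [|list_eq|list_eq].
  by rewrite !(inE, mem_cat) eqxx !orbT.
apply: (@Rt (y :: x :: W ++ [:: y; x])).
  have := @pows (y :: x :: W ++ [:: y]) [::] x (X4 ++ [:: x]) [:: x].
  rewrite !cats0 -!(catA, cat_cons) /=; apply => //.
  - by case: (X4).
  - by move=> a; rewrite mem_cat => /orP[/sX4|].
  by left; rewrite !inE eqxx orbT.
have sq Z : R (y :: x :: Z ++ [:: y; x])
              ([:: y; x] ++ (x :: Z ++ [:: y]) ++ [:: y; x]).
  apply: (@Rt (y :: x :: x :: Z ++ [:: y; x])).
    by apply: (@sqr_r _ HR [:: y]); rewrite mem_cat !inE eqxx !orbT.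
  have := @sqr_l _ HR (y :: x :: x :: Z) [:: x] y; rewrite in_cons eqxx.
  by move=> /(_ isT) H; apply: (fic_conv H); list_eq.
apply: Rt (sq W) _; apply: Rs; apply: Rt (sq [::]) _.
apply: inner_content => //.
- move=> a; rewrite !inE mem_cat !inE; have := sub w3 a; rewrite !inE -/W.
  by case: (a \in W) => [/(_ isT)|_]; case: (a == x); case: (a == y).
- by move=> a; rewrite !inE orbC.
by move=> a; rewrite !inE orbC.
Qed.

Lemma triv_of u v x : R u v -> x \in u -> x \notin v -> holds R p_triv.
Proof.
move=> Ruv xu xv; have := fic_filter HR (pred1 x) Ruv.
rewrite [X in R _ X]filter_mem0 => [|a av]; last first.
  by rewrite /=; apply: contraNneq xv => <-.
set X := filter _ u => RX.
have sX : {subset X <= [:: x]} by move=> a; rewrite mem_filter inE => /andP[].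
have X0 : X != [::] by rewrite -has_filter has_pred1.
apply: (@holds_letters _ HR [:: x] _ x) => //=.
have RxX : R (x :: X) [:: x] by have := fic_ctxs [:: x] [::] RX; rewrite !cats0.
have RxX' : R (x :: X) [:: x; x].
  have := @pows [:: x] [::] x X [:: x] X0 isT sX; rewrite !cats0; apply=> //.
  by left; rewrite inE.
have Rxx : R [:: x] [:: x; x] by apply: Rt (Rs RxX) RxX'.
apply: Rt _ RX; case: X {RxX} X0 sX RxX' => // a X _ /subset1_cons[-> sX] _.
apply: (Rt Rxx).
have := @pows [:: x] [::] x [:: x] X isT; case: X sX => [|b X] sX.
  by move=> _; exact: (Rs Rxx).
by rewrite !cats0 /=; apply=> //; left; rewrite inE.
Qed.

Lemma band_of u v x : R u v -> count_mem x u = 1 -> 1 < count_mem x v ->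
  holds R p_band.
Proof.
move=> Ruv xu xv; have := fic_filter HR (pred1 x) Ruv.
have E w : filter (pred1 x) w = nseq (count_mem x w) x.
  by elim: w => //= a w ->; case: eqP => [->|].
rewrite !E xu; case: (count_mem x v) xv => [|[|k]] // _ H.
apply: (@holds_letters _ HR [:: x] _ x) => //=.
apply: Rt H _; rewrite -[nseq _ _]/([:: x] ++ nseq k.+1 x).
have := @pows [:: x] [::] x (nseq k.+1 x) [:: x]; rewrite !cats0; apply=> //.
  by move=> a; rewrite mem_nseq inE.
by left; rewrite inE.
Qed.

(** Restricted to z, t, s the two words are z^i t s z^j and a word with z
between t and s; multiplying by z on both ends hides all other differences. *)
Lemma fill_of (P B Q P' B' Q' : word) t s z :
  R (P ++ t :: B ++ s :: Q) (P' ++ t :: B' ++ s :: Q') -> t != s ->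
  t \notin P ++ B ++ Q -> s \notin P ++ B ++ Q ->
  t \notin P' ++ B' ++ Q' -> s \notin P' ++ B' ++ Q' ->
  z \in P -> z \in Q -> z \notin B -> z \in B' -> holds R p_fill.
Proof.
move=> H ts tu su tv sv zP zQ zB zB'.
have zt : z != t by apply: contraNneq tu => <-; rewrite !mem_cat zP.
have zs : z != s by apply: contraNneq su => <-; rewrite !mem_cat zP.
have [r] := fresh [:: z; t; s]; rewrite !inE !negb_or => /and3P[rz rt rs].
pose F := mem [:: z; t; s].
have F0 w : t \notin w -> s \notin w -> {subset filter F w <= [:: z]}.
  move=> tw sw a; rewrite mem_filter !inE => /andP[/or3P[//|/eqP->|/eqP->]].
    by rewrite (negbTE tw).
  by rewrite (negbTE sw).
have Ec a w : F a -> filter F (a :: w) = a :: filter F w by rewrite /= => ->.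
have := fic_filter HR F H.
rewrite !(filter_cat, Ec); try by rewrite /F /= !inE eqxx ?orbT.
move: tu su tv sv; rewrite !mem_cat !negb_or.
move=> /and3P[tP tB tQ] /and3P[sP sB sQ] /and3P[tP' tB' tQ'] /and3P[sP' sB' sQ'].
rewrite [filter F B]filter_mem0 /=; last first.
  move=> a aB; rewrite !inE !negb_or; apply/and3P.
  by split; apply: contraTneq aB => ->.
set Z1 := filter F P; set Z2 := filter F Q; set Y1 := filter F P'.
set Y2 := filter F B'; set Y3 := filter F Q' => RZ.
have Y20 : Y2 != [::] by rewrite -has_filter; apply/hasP; exists z; rewrite ?inE ?eqxx.
apply: (@holds_letters _ HR [:: z; r; t; s] _ z) => //=.
  by rewrite /= !inE !negb_or (eq_sym z) rz zt zs rt rs ts.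
apply: (@Rt (z :: Z1 ++ t :: s :: Z2 ++ [:: z])).
  apply: Rs; apply: (@Rt (z :: t :: s :: Z2 ++ [:: z])).
    apply: (@pow_r _ HR [::]); first exact: F0.
    by rewrite !inE mem_cat inE eqxx !orbT.
  have := @pows [:: z; t; s] [::] z (Z2 ++ [:: z]) [:: z]; rewrite !cats0; apply=> //.
  - by case: (Z2).
  - by move=> a; rewrite mem_cat => /orP[/F0->|].
  by left; rewrite inE eqxx.
apply: (@Rt (z :: Y1 ++ t :: Y2 ++ s :: Y3 ++ [:: z])).
  by apply: (fic_conv (@fic_ctxs [:: z] [:: z] _ _ RZ)); list_eq.
apply: (@Rt (z :: t :: Y2 ++ s :: Y3 ++ [:: z])).
  apply: (@pow_r _ HR [::]); first exact: F0.
  by rewrite !(mem_cat, inE) eqxx !orbT.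
apply: (@Rt (z :: t :: z :: s :: Y3 ++ [:: z])).
  apply: (@pows [:: z; t] _ z Y2 [:: z]) => //; first exact: F0.
  by left; rewrite inE eqxx.
have := @pows [:: z; t; z; s] [::] z (Y3 ++ [:: z]) [:: z]; rewrite !cats0; apply=> //.
- by case: (Y3).
- by move=> a; rewrite mem_cat => /orP[/F0->|].
by left; rewrite inE eqxx.
Qed.

(** Substituting s z for s makes z occur after s in both words, so that only
its presence before s differs. *)
Lemma before_of (P Q P' Q' : word) s z :
  R (P ++ s :: Q) (P' ++ s :: Q') ->
  s \notin P ++ Q -> s \notin P' ++ Q' ->
  z \notin P -> z \in Q -> z \in P' -> holds R p_before.
Proof.
move=> H su sv zP zQ zP'.
have zs : z != s by apply: contraNneq su => <-; rewrite !mem_cat zQ orbT.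
have [r] := fresh [:: z; s]; rewrite !inE !negb_or => /andP[rz rs].
have [k] := fresh [:: z; s; r]; rewrite !inE !negb_or => /and3P[kz ks kr].
pose F := mem [:: z; s].
have F0 w : s \notin w -> {subset filter F w <= [:: z]}.
  move=> sw a; rewrite mem_filter !inE => /andP[/orP[//|/eqP->]].
  by rewrite (negbTE sw).
pose f a := if a == s then [:: s; z] else [:: a].
have f0 w : {subset w <= [:: z]} -> subst f w = w.
  elim: w => //= a w IH sw; rewrite subst_cons IH => [|b bw]; last first.
    by apply: sw; rewrite in_cons bw orbT.
  by have [-> _] := subset1_cons sw; rewrite /f (negbTE zs).
have Ec a w : F a -> filter F (a :: w) = a :: filter F w by rewrite /= => ->.
have := fic_subst HR f (fic_filter HR F H).
rewrite !(filter_cat, Ec); try by rewrite /F /= !inE eqxx ?orbT.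
move: su sv; rewrite !mem_cat !negb_or.
move=> /andP[sP sQ] /andP[sP' sQ'].
rewrite [filter F P]filter_mem0 /=; last first.
  move=> a aP; rewrite !inE !negb_or; apply/andP.
  by split; apply: contraTneq aP => ->.
rewrite subst_cat !subst_cons !f0; try exact: F0.
rewrite /f eqxx /=.
set Z := filter F Q; set Y := filter F P'; set Y' := filter F Q' => RZ.
have Y0 : Y != [::] by rewrite -has_filter; apply/hasP; exists z; rewrite ?inE ?eqxx.
apply: (@holds_letters _ HR [:: z; k; s; r] _ z) => //=.
  by uniq_letters.
apply: (@Rt (s :: z :: Z ++ [:: r; z])).
  apply: Rs; apply: (@pow_r _ HR [:: s]); first exact: F0.
  by rewrite !inE eqxx orbT.
apply: (@Rt (Y ++ s :: z :: Y' ++ [:: r; z])).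
  by apply: (fic_conv (@fic_ctxs [::] [:: r; z] _ _ RZ)); list_eq.
apply: (@Rt (z :: s :: z :: Y' ++ [:: r; z])).
  apply: (@pows [::] _ z Y [:: z]) => //; first exact: F0.
  by right; rewrite !(mem_cat, inE) eqxx !orbT.
apply: (@pow_r _ HR [:: z; s]); first exact: F0.
by rewrite !inE eqxx orbT.
Qed.
End Based.

(** * Reordering a block *)

Ltac nat_lia :=
  try change letter with (Equality.sort Defs_letter__canonical__eqtype_Equality); lia.
Ltac count_lia :=
  rewrite /=; repeat (rewrite 1?count_rev 1!count_cat /=); nat_lia.

Ltac rev_eq := rewrite ?(rev_cat, rev_cons) -?cats1 /= ?(rev_cat, rev_cons);
  rewrite -?cats1 -?catA /= -?catA /= -?catA /= ?revK; reflexivity.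

Section Swaps.
Variables (R : word -> word -> Prop) (HR : good R).

Let Rr := fic_refl HR.
Let Rt := fic_trans HR.
Let Rs := fic_sym HR.

Lemma firsts_swap (p q : word) x y : holds R p_firsts -> x \in q -> y \in q ->
  R (p ++ x :: y :: q) (p ++ y :: x :: q).
Proof.
have [->|xy] := eqVneq x y; first by move=> *; apply: Rr.
move=> H; case/path.splitPr=> q1 q2; rewrite mem_cat in_cons eq_sym (negbTE xy) /=.
case/orP; case/path.splitPr => q3 q4.
  apply: Rs.
  by apply: (fic_step HR (H [:: [:: y]; [:: x]; q3; q4]) (p := p) (q := q2)); list_eq.
by apply: (fic_step HR (H [:: [:: x]; [:: y]; q1; q3]) (p := p) (q := q4)); list_eq.
Qed.

(** [p_first] makes a copy of x in front of y, and the old copy is then an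
inner occurrence of the block. *)
Lemma first_swap (p r q : word) x y : holds R p_first ->
  x \in p -> y \in r ++ q -> x \in r ->
  {in y :: r, forall z, 1 < count_mem z (p ++ x :: y :: r ++ q)} ->
  R (p ++ x :: y :: r ++ q) (p ++ y :: x :: r ++ q).
Proof.
move=> H xp yrq xr cnt; apply: (@Rt (p ++ x :: y :: x :: r ++ q)).
  apply: Rs; move: cnt; case/path.splitPr: xr => r1 r2 cnt.
  have := @good_inner _ HR p x [:: y] r1 (r2 ++ q); rewrite -!catA /=; apply.
  move=> z zyr; apply: leq_trans (cnt z _) _.
    by move: zyr; rewrite !inE mem_cat => /orP[]->; rewrite ?orbT.
  by count_lia.
apply: Rs; case/path.splitPr: xp => p1 p2; case/path.splitPr: yrq => q1 q2.
by apply: (fic_step HR (H [:: [:: x]; [:: y]; p2; q1]) (p := p1) (q := q2)); list_eq.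
Qed.

(** Adding inner occurrences turns a b into a b a or b a b. This is
blocked only if b does not occur before the block and a not after it, and then
[p_star] serves. *)
Lemma start_end_swap (p c r q : word) a b : a \in c -> b \in r ->
  {in c ++ r, forall z, 1 < count_mem z (p ++ c ++ b :: a :: r ++ q)} ->
  [\/ b \in p, a \in q | holds R p_star] ->
  R (p ++ c ++ b :: a :: r ++ q) (p ++ c ++ a :: b :: r ++ q).
Proof.
move=> ac br cnt H; apply: Rs.
have [c1 [c2 Ec]] : exists c1 c2, c = c1 ++ a :: c2.
  by case/path.splitPr: ac => c1 c2; exists c1, c2.
have [r1 [r2 Er]] : exists r1 r2, r = r1 ++ b :: r2.
  by case/path.splitPr: br => r1 r2; exists r1, r2.
have cnt' z w : z \in c ++ r -> (forall y, count_mem y (p ++ c ++ b :: a :: r ++ q)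
    <= count_mem y w) -> 1 < count_mem z w.
  by move=> /cnt cz wz; apply: leq_trans cz (wz z).
have Hr : R (p ++ c ++ b :: a :: b :: r ++ q) (p ++ c ++ b :: a :: r ++ q).
  have := @good_inner _ HR (p ++ c) b [:: a] r1 (r2 ++ q).
  rewrite Er -!catA /=; apply=> z zr; apply: cnt'.
    move: zr; rewrite Er in_cons !mem_cat => /orP[/eqP->|->]; last by rewrite orbT.
    by rewrite ac.
  by move=> y; rewrite Er; count_lia.
have Hc : R (p ++ c ++ a :: b :: a :: r ++ q) (p ++ c ++ b :: a :: r ++ q).
  have := @good_inner _ HR (p ++ c1) a c2 [:: b] (r ++ q).
  rewrite Ec -!catA /=; apply=> z zc; apply: cnt'.
    move: zc; rewrite Ec !mem_cat mem_seq1 in_cons => /orP[->|/eqP->].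
      by rewrite !orbT.
    by rewrite br !orbT.
  by move=> y; rewrite Ec; count_lia.
case: H => [bp|aq|Rstar].
- apply: Rt Hr; have := @dup_l _ HR (p ++ c) (r ++ q) a b.
  by rewrite -!catA; apply; rewrite mem_cat ?ac ?bp ?orbT.
- apply: Rt Hc; have := @dup_r _ HR (p ++ c) (r ++ q) b a.
  by rewrite -!catA; apply; rewrite mem_cat ?aq ?br ?orbT.
apply: (@Rt (p ++ c ++ a :: a :: b :: b :: r ++ q)).
  apply: (@Rt (p ++ c ++ a :: a :: b :: r ++ q)).
    have := @sqr_l _ HR (p ++ c) (b :: r ++ q) a.
    by rewrite -!catA; apply; rewrite mem_cat ac orbT.
  have := @sqr_r _ HR (p ++ c ++ [:: a; a]) (r ++ q) b.
  by rewrite -!catA; apply; rewrite mem_cat br.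
apply: (@Rt (p ++ c ++ a :: b :: a :: b :: r ++ q)).
  by apply: (fic_step HR (Rstar [:: [:: a]; [:: b]]) (p := p ++ c) (q := r ++ q)); list_eq.
apply: Rt Hr; have := @good_inner _ HR (p ++ c1) a c2 [:: b] (b :: r ++ q).
rewrite Ec -!catA /=; apply=> z zc; apply: cnt'.
  move: zc; rewrite Ec !mem_cat mem_seq1 in_cons => /orP[->|/eqP->].
    by rewrite !orbT.
  by rewrite br !orbT.
by move=> y; rewrite Ec; count_lia.
Qed.
End Swaps.

(** The letter t, being linear in both words, remains comparable when
they are restricted to few letters. *)
Definition bounded_left (pu Bu pv Bv : word) : Prop :=
  (pu = [::] /\ pv = [::]) \/
  exists t P P', [/\ pu = rcons P t, pv = rcons P' t,
    t \notin P ++ Bu & t \notin P' ++ Bv].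

Lemma bounded_left_eq pu Bu pv Bv Cu Cv :
  {subset Cu <= Bu} -> {subset Cv <= Bv} ->
  bounded_left pu Bu pv Bv -> bounded_left pu Cu pv Cv.
Proof.
move=> su sv [|[t [P [P' [-> -> tu tv]]]]]; first by left.
right; exists t, P, P'; split=> //.
  by apply: contra tu; rewrite !mem_cat => /orP[->//|/su->]; rewrite orbT.
by apply: contra tv; rewrite !mem_cat => /orP[->//|/sv->]; rewrite orbT.
Qed.

Section SwapStarts.
Variables (R S : word -> word -> Prop) (HR : good R) (HS : good S).
Hypothesis firstsSR : holds S p_firsts -> holds R p_firsts.
Hypothesis firstSR : holds S p_first -> holds R p_first.

(** Which of the letters a and b occurred before the block decides whether
the exchange of their first occurrences in it is free or needs [p_first] or
[p_firsts]; that u and v have them in different orders shows that S has this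
item. *)
Lemma swap_starts (pu W1 r qu pv W2 r' qv : word) a b :
  S (pu ++ W1 ++ b :: a :: r ++ qu) (pv ++ W2 ++ a :: r' ++ qv) ->
  a != b -> pu =i pv -> bounded_left pu (W1 ++ b :: a :: r ++ qu)
    pv (W2 ++ a :: r' ++ qv) ->
  a \notin W1 -> b \notin W1 -> a \notin W2 -> b \notin W2 ->
  a \in r -> b \in r -> b \in r' ->
  {in W1 ++ b :: a :: r, forall z, 1 < count_mem z (W1 ++ b :: a :: r)} ->
  forall p q, p =i pu ->
  R (p ++ W1 ++ b :: a :: r ++ q) (p ++ W1 ++ a :: b :: r ++ q).
Proof.
move=> Suv ab puv bd aW1 bW1 aW2 bW2 ar br br' cnt p q Ep.
have cnt' z : z \in W1 ++ b :: a :: r ->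
    1 < count_mem z (p ++ W1 ++ b :: a :: r ++ q).
  by move=> /cnt/leq_trans; apply; clear; count_lia.
have Rs := fic_sym HR.
have ba : b != a by rewrite eq_sym.
have Rf : (a \in p) != (b \in p) -> holds R p_first.
  case: bd => [[Epu _]|[t [P [P' [Epu Epv tu tv]]]]]; first by rewrite !Ep Epu.
  have at_ : a != t.
    by apply: contraNneq tu => <-; rewrite !(mem_cat, inE) eqxx !orbT.
  have bt : b != t.
    by apply: contraNneq tu => <-; rewrite !(mem_cat, inE) eqxx !orbT.
  rewrite Epu Epv in Suv puv Ep; rewrite !cat_rcons in Suv.
  have mP x : x != t -> (x \in P) = (x \in p).
    by move=> xt; rewrite Ep mem_rcons inE (negbTE xt).
  have mP' x : x != t -> (x \in P') = (x \in p).
    by move=> xt; rewrite Ep puv mem_rcons inE (negbTE xt).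
  move=> ne; apply: firstSR; move: ne.
  have [ap|ap] := boolP (a \in p); have [bp|bp] := boolP (b \in p) => // _.
    have Svu := fic_sym HS Suv.
    apply: (first_of HS Svu ab (erefl _) (erefl _) tv tu _ _ _ _
      (erefl _) _ _ _ (erefl _) _ _) => //; rewrite ?mP ?mP' //.
    by rewrite mem_cat br'.
  apply: (first_of HS Suv ba (erefl _) (erefl _) tu tv _ _ _ _
    (erefl _) _ _ _ (erefl _) _ _) => //; rewrite ?mP ?mP' //.
  by rewrite inE eqxx.
have [bp|bp] := boolP (b \in p); have [ap|ap] := boolP (a \in p).
- have := @swap_inner _ HR (p ++ W1) (r ++ q) b a.
  by rewrite -!catA; apply; rewrite mem_cat ?ap ?bp ?ar ?br.
- have {}Rf : holds R p_first by apply: Rf; rewrite (negbTE ap) bp.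
  have := @first_swap _ HR (p ++ W1) r q b a Rf; rewrite -!catA; apply=> //.
  + by rewrite mem_cat bp.
  + by rewrite mem_cat ar.
  by move=> z zar; apply: cnt'; rewrite mem_cat in_cons zar !orbT.
- have {}Rf : holds R p_first by apply: Rf; rewrite (negbTE bp) ap.
  apply: Rs; have := @first_swap _ HR (p ++ W1) r q a b Rf; rewrite -!catA.
  apply=> //.
  + by rewrite mem_cat ap.
  + by rewrite mem_cat br.
  move=> z zbr; have : z \in W1 ++ b :: a :: r.
    by move: zbr; rewrite mem_cat !inE => /orP[]->; rewrite !orbT.
  by move/cnt'/leq_trans; apply; clear; count_lia.
have {}Rf : holds R p_firsts.
  apply: firstsSR; rewrite catA [in X in S _ X]catA in Suv.
  apply: (firsts_of HS Suv ba (erefl _) _ _ _ (erefl _) _ _ _) => //;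
    rewrite ?mem_cat ?negb_or -?puv -?Ep ?ap ?bp ?aW1 ?bW1 ?aW2 ?bW2 ?inE ?eqxx //.
  by rewrite br'.
have := @firsts_swap _ HR (p ++ W1) (r ++ q) b a Rf; rewrite -!catA.
by apply; rewrite mem_cat ?ar ?br.
Qed.
End SwapStarts.

Definition items_sub (S R : word -> word -> Prop) : Prop :=
  forall e, e \in items -> holds S e -> holds R e.

Definition bounded_right (Bu qu Bv qv : word) : Prop :=
  bounded_left (rev qu) (rev Bu) (rev qv) (rev Bv).

Section Bubble.
Variables (R S : word -> word -> Prop) (HR : good R) (HS : good S).
Hypothesis RS : forall u v, R u v -> S u v.
Hypothesis SR : items_sub S R.

Let Rr := fic_refl HR.
Let Rt := fic_trans HR.
Let Rs := fic_sym HR.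

Variables pu qu pv qv : word.
Hypothesis puv : pu =i pv.
Hypothesis quv : qu =i qv.

(** In a block with exactly two occurrences of each letter, each
occurrence is the first or the second one. Two second ones are treated by
reversing all words, and a first one next to a second one by
[start_end_swap]. *)
Lemma swap_adjacent (w1 r w2 r' : word) a b :
  S (pu ++ w1 ++ b :: a :: r ++ qu) (pv ++ w2 ++ a :: r' ++ qv) ->
  a != b ->
  bounded_left pu (w1 ++ b :: a :: r ++ qu) pv (w2 ++ a :: r' ++ qv) ->
  bounded_right (pu ++ w1 ++ b :: a :: r) qu (pv ++ w2 ++ a :: r') qv ->
  {in w1 ++ b :: a :: r, forall z, count_mem z (w1 ++ b :: a :: r) = 2} ->
  perm_eq (w1 ++ b :: a :: r) (w2 ++ a :: r') ->
  {subset w2 <= w1} -> count_mem a w1 = count_mem a w2 -> b \in r' ->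
  forall p q, p =i pu -> q =i qu ->
  R (p ++ w1 ++ b :: a :: r ++ q) (p ++ w1 ++ a :: b :: r ++ q).
Proof.
move=> Suv ab bdl bdr cnt prm sw2 ca br' p q Ep Eq.
have ba : b != a by rewrite eq_sym.
have cnt1 z : z \in w1 ++ b :: a :: r -> 1 < count_mem z (w1 ++ b :: a :: r).
  by move=> /cnt ->.
have c2 z (w : word) : (z \in w) = (0 < count_mem z w) by rewrite -has_pred1 has_count.
have ca2 : count_mem a w1 + count_mem a r = 1.
  have := cnt a; rewrite !(mem_cat, inE) eqxx !orbT => /(_ isT).
  by rewrite count_cat /= eqxx (negbTE ba); clear; nat_lia.
have cb2 : count_mem b w1 + count_mem b r = 1.
  have := cnt b; rewrite !(mem_cat, inE) eqxx !orbT => /(_ isT).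
  by rewrite count_cat /= eqxx (negbTE ab); clear; nat_lia.
have ca3 : count_mem a w2 + count_mem a r' = 1.
  have : count_mem a (w1 ++ b :: a :: r) = count_mem a (w2 ++ a :: r').
    by apply/permP.
  by rewrite !count_cat /= eqxx (negbTE ba); move: ca2 ca; clear; nat_lia.
have multi z : z \in w1 ++ r -> 1 < count_mem z (p ++ w1 ++ b :: a :: r ++ q).
  move=> zwr; have /cnt : z \in w1 ++ b :: a :: r.
    by move: zwr; rewrite !mem_cat !inE => /orP[]->; rewrite ?orbT.
  move=> cz; apply: (@leq_trans (count_mem z (w1 ++ b :: a :: r))); rewrite ?cz //.
  by rewrite -[X in X <= _]cz; clear; count_lia.
have [aw1|aw1] := boolP (a \in w1); have [bw1|bw1] := boolP (b \in w1).
- have [r1 [r2 [Er br2]]] := split_last_mem br'.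
  have ar : a \notin r by move: aw1 ca2; rewrite !c2; clear; nat_lia.
  have br : b \notin r by move: bw1 cb2; rewrite !c2; clear; nat_lia.
  have aw2 : a \in w2 by move: aw1 ca; rewrite !c2; clear; nat_lia.
  have ar' : a \notin r' by move: aw2 ca3; rewrite !c2; clear; nat_lia.
  have ar2 : a \notin r2.
    by apply: contra ar'; rewrite Er mem_cat in_cons => ->; rewrite !orbT.
  have E1 (w z u s : word) c d : rev (w ++ z ++ c :: d :: u ++ s)
      = rev s ++ rev u ++ d :: c :: rev z ++ rev w.
    by rev_eq.
  have E2 : rev (pv ++ w2 ++ a :: r' ++ qv) =
      rev qv ++ rev r2 ++ b :: (rev (w2 ++ a :: r1)) ++ rev pv.
    by rewrite Er; rev_eq.
  suff G : mirror R (rev q ++ rev r ++ a :: b :: rev w1 ++ rev p)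
                    (rev q ++ rev r ++ b :: a :: rev w1 ++ rev p).
    by rewrite /mirror in G; apply: (fic_conv G); rev_eq.
  apply: (@swap_starts (mirror R) (mirror S) (good_mirror HR) (good_mirror HS)
    _ _ (rev qu) (rev r) (rev w1) (rev pu) (rev qv) (rev r2)
    (rev (w2 ++ a :: r1)) (rev pv) b a).
  + by move/holds_flip/SR => H; apply/holds_flip/H.
  + by move/holds_flip/SR => H; apply/holds_flip/H.
  + by rewrite /mirror -E1 -E2 !revK.
  + by [].
  + by move=> x; rewrite !mem_rev.
  + have := bdr; rewrite /bounded_right.
    have -> : rev (pu ++ w1 ++ b :: a :: r) = rev r ++ a :: b :: rev w1 ++ rev pu.
      by rev_eq.
    have -> // : rev (pv ++ w2 ++ a :: r') = rev r2 ++ b :: rev (w2 ++ a :: r1) ++ rev pv.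
    by rewrite Er; rev_eq.
  + by rewrite mem_rev.
  + by rewrite mem_rev.
  + by rewrite mem_rev.
  + by rewrite mem_rev.
  + by rewrite mem_rev.
  + by rewrite mem_rev.
  + by rewrite mem_rev mem_cat aw2.
  + move=> z; have := cnt1 z; rewrite !(mem_cat, inE, mem_rev, count_cat, count_rev) /=.
    rewrite !count_rev => H zr; have {}H := H _.
    have {}H : 1 < count_mem z w1 + ((b == z) + ((a == z) + count_mem z r)).
      by apply: H; move: zr; case: (z \in r); case: (z == a); case: (z == b) => //=;
        rewrite ?orbT ?orbF.
    by move: H; clear; nat_lia.
  by move=> x; rewrite !mem_rev.
- have ar : a \notin r by move: aw1 ca2; rewrite !c2; clear; nat_lia.
  have br : b \in r by move: bw1 cb2; rewrite !c2; clear; nat_lia.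
  have aw2 : a \in w2 by move: aw1 ca; rewrite !c2; clear; nat_lia.
  have ar' : a \notin r' by move: aw2 ca3; rewrite !c2; clear; nat_lia.
  have bw2 : b \notin w2 by apply: contra bw1; apply: sw2.
  apply: start_end_swap => //.
  have [bp|bp] := boolP (b \in p); first by constructor.
  have [aq|aq] := boolP (a \in q); first by constructor.
  constructor 3; apply: SR => //; have Svu := fic_sym HS Suv.
  apply: (@star_of _ HS _ (pv ++ w2 ++ [:: a]) (r' ++ qv) _ (pu ++ w1) (a :: r ++ qu)
    b a Svu) => //; rewrite ?catA -?catA //.
  + by rewrite !mem_cat !negb_or -puv -Ep bp bw2 /= ba.
  + by rewrite !mem_cat inE eqxx !orbT.
  + by rewrite mem_cat negb_or ar' -quv -Eq.
  + by rewrite mem_cat br'.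
  by rewrite inE eqxx.
- have ar : a \in r by move: aw1 ca2; rewrite !c2; clear; nat_lia.
  have br : b \notin r by move: bw1 cb2; rewrite !c2; clear; nat_lia.
  have aw2 : a \notin w2 by move: aw1 ca; rewrite !c2; clear; nat_lia.
  apply: Rs; apply: start_end_swap => //.
    by move=> z /multi/leq_trans; apply; clear; count_lia.
  have [ap|ap] := boolP (a \in p); first by constructor.
  have [bq|bq] := boolP (b \in q); first by constructor.
  constructor 3; apply: SR => //.
  apply: (@star_of _ HS _ (pu ++ w1 ++ [:: b]) (a :: r ++ qu) _ (pv ++ w2) (r' ++ qv)
    a b Suv) => //; rewrite -?catA //.
  + by rewrite !mem_cat !negb_or -Ep ap aw1 /= ab.
  + by rewrite !mem_cat inE eqxx !orbT.
  + by rewrite inE mem_cat !negb_or ba br -Eq.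
  + by rewrite inE eqxx.
  by rewrite mem_cat br'.
have ar : a \in r by move: aw1 ca2; rewrite !c2; clear; nat_lia.
have br : b \in r by move: bw1 cb2; rewrite !c2; clear; nat_lia.
have aw2 : a \notin w2 by move: aw1 ca; rewrite !c2; clear; nat_lia.
have bw2 : b \notin w2 by apply: contra bw1; apply: sw2.
apply: (@swap_starts _ _ HR HS _ _ _ _ _ _ _ _ _ _ _ _ Suv) => //.
- exact: SR.
- exact: SR.
Qed.

Variables B B' : word.
Hypothesis cntB : {in B, forall z, count_mem z B = 2}.
Hypothesis prmB : perm_eq B B'.
Hypothesis bdl : bounded_left pu (B ++ qu) pv (B' ++ qv).
Hypothesis bdr : bounded_right (pu ++ B) qu (pv ++ B') qv.

(** Selection sort: the letter that v requires next is moved to the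
left, one exchange at a time. The contexts p and q vary since the step is also
needed for pu and qu, to keep the relation to v known. *)
Lemma move_front (c w w2 w' : word) a :
  S (pu ++ c ++ w ++ a :: w2 ++ qu) (pv ++ c ++ a :: w' ++ qv) ->
  perm_eq (c ++ w ++ a :: w2) B -> perm_eq (c ++ a :: w') B' -> a \notin w ->
  forall p q, p =i pu -> q =i qu ->
  R (p ++ c ++ w ++ a :: w2 ++ q) (p ++ c ++ a :: w ++ w2 ++ q).
Proof.
elim/last_ind: w w2 => [|w b IH] w2 Suv prm prm' aw p q Ep Eq; first exact: Rr.
move: aw; rewrite mem_rcons inE negb_or => /andP[ab aw].
have prmw : perm_eq (rcons w b ++ a :: w2) (a :: w').
  rewrite -(perm_cat2l c); apply: perm_trans prm _; apply: perm_trans prmB _.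
  by rewrite perm_sym.
have bw' : b \in w'.
  have : b \in a :: w' by rewrite -(perm_mem prmw) mem_cat mem_rcons mem_head.
  by rewrite in_cons eq_sym (negbTE ab).
have prm1 : perm_eq ((c ++ w) ++ b :: a :: w2) B.
  by move: prm; rewrite cat_rcons -catA.
have swap p' q' : p' =i pu -> q' =i qu ->
    R (p' ++ c ++ rcons w b ++ a :: w2 ++ q') (p' ++ c ++ w ++ a :: b :: w2 ++ q').
  move=> Ep' Eq'; rewrite cat_rcons !(catA c).
  apply: (@swap_adjacent (c ++ w) w2 c w' a b) => //.
  - by rewrite -catA; move: Suv; rewrite cat_rcons.
  - apply: bounded_left_eq bdl => z.
      by rewrite -!cat_cons catA mem_cat (perm_mem prm1) mem_cat.
    by rewrite -cat_cons catA mem_cat (perm_mem prm') mem_cat.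
  - apply: bounded_left_eq bdr => z; rewrite !mem_rev.
      by rewrite mem_cat (perm_mem prm1) -mem_cat.
    by rewrite mem_cat (perm_mem prm') -mem_cat.
  - move=> z; rewrite (perm_mem prm1) => zB.
    by rewrite (permP prm1) cntB.
  - apply: perm_trans prm1 _; apply: perm_trans prmB _.
    by rewrite perm_sym.
  - by move=> z zc; rewrite mem_cat zc.
  by rewrite count_cat [count_mem a w](count_memPn aw) addn0.
apply: Rt (swap p q Ep Eq) _; rewrite cat_rcons; apply: (IH (b :: w2)) => //.
  apply: (fic_trans HS (v := pu ++ c ++ rcons w b ++ a :: w2 ++ qu)) => //.
  by apply: RS; apply: Rs; apply: swap.
apply: perm_trans prm; rewrite perm_cat2l cat_rcons perm_cat2l.
by apply/seq.permP => P /=; rewrite addnCA.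
Qed.

Lemma bubble (c w w' : word) :
  S (pu ++ c ++ w ++ qu) (pv ++ c ++ w' ++ qv) ->
  perm_eq (c ++ w) B -> perm_eq (c ++ w') B' ->
  forall p q, p =i pu -> q =i qu -> R (p ++ c ++ w ++ q) (p ++ c ++ w' ++ q).
Proof.
elim: w' c w => [|a w' IH] c w Suv prm prm' p q Ep Eq.
  have : perm_eq w [::].
    rewrite -(perm_cat2l c); apply: perm_trans prm _; apply: perm_trans prmB _.
    by rewrite perm_sym.
  by move=> /perm_nilP->; apply: Rr.
have prmw : perm_eq w (a :: w').
  rewrite -(perm_cat2l c); apply: perm_trans prm _; apply: perm_trans prmB _.
  by rewrite perm_sym.
have : a \in w by rewrite (perm_mem prmw) mem_head.
case/split_first_mem=> w1 [w2 [Ew aw1]].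
have front p' q' : p' =i pu -> q' =i qu ->
    R (p' ++ c ++ w ++ q') (p' ++ c ++ a :: w1 ++ w2 ++ q').
  move=> Ep' Eq'; rewrite Ew -catA; apply: (@move_front c w1 w2 w') => //.
    by move: Suv; rewrite Ew -catA.
  by rewrite -Ew.
apply: Rt (front p q Ep Eq) _.
apply: (fic_conv (@IH (rcons c a) (w1 ++ w2) _ _ _ p q Ep Eq));
  rewrite ?cat_rcons -?catA //.
  apply: (fic_trans HS (v := pu ++ c ++ w ++ qu)) => //.
  by apply: RS; apply: Rs; apply: front.
apply: perm_trans prm; rewrite perm_cat2l Ew perm_sym.
by rewrite -[a :: w2]/([:: a] ++ w2) perm_catCA.
Qed.
End Bubble.

Section Blocks.
Variables (R : word -> word -> Prop) (HR : good R).

Let Rr := fic_refl HR.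
Let Rt := fic_trans HR.

Lemma split_three (y : letter) (B : word) : 2 < count_mem y B ->
  exists c0 c1 c2 c3, B = c0 ++ y :: c1 ++ y :: c2 ++ y :: c3.
Proof.
have one (C : word) : 0 < count_mem y C ->
    exists c0 c1, C = c0 ++ y :: c1 /\ count_mem y C = (count_mem y c1).+1.
  rewrite -has_count has_pred1 => /split_first_mem[c0 [c1 [-> yc]]].
  by exists c0, c1; rewrite count_cat (count_memPn yc) /= eqxx.
move=> cy; have [|c0 [C [EB E]]] := one B; first exact: leq_trans cy.
rewrite E ltnS in cy; have [|c1 [C1 [EC E1]]] := one C; first exact: leq_trans cy.
rewrite E1 ltnS in cy; have [|c2 [c3 [EC1 _]]] := one C1; first exact: leq_trans cy.
rewrite EB EC EC1.
by exists c0, c1, c2, c3.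
Qed.

Lemma reduce_block (B : word) : {in B, forall z, 1 < count_mem z B} ->
  exists B1 : word, [/\ B1 =i B, {in B1, forall z, count_mem z B1 = 2}
    & forall p q, R (p ++ B ++ q) (p ++ B1 ++ q)].
Proof.
have [n] := ubnP (size B); elim: n B => // n IH B szB cntB.
have [/hasP[y yB cy]|small] := boolP (has (fun z => 2 < count_mem z B) B); last first.
  exists B; split=> // z zB; apply/eqP; rewrite eqn_leq cntB // andbT leqNgt.
  by apply: contra small => cz; apply/hasP; exists z.
have [c0 [c1 [c2 [c3 EB]]]] := split_three cy.
pose B' := c0 ++ y :: c1 ++ c2 ++ y :: c3.
have EB' : B' =i B.
  move=> z; rewrite EB !(mem_cat, inE).
  by case: (z == y); case: (z \in c0); case: (z \in c1); case: (z \in c2).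
have [||B1 [E1 cnt1 R1]] := IH B'.
- rewrite ltnS in szB; apply: leq_trans szB; rewrite EB /B' !size_cat /= !size_cat /= !size_cat /=.
  by clear; lia.
- move=> z; rewrite EB' => zB; have [->|zy] := eqVneq z y.
    by rewrite /B'; repeat rewrite count_cat /=; rewrite eqxx; clear; lia.
  apply: leq_trans (cntB z zB) _; rewrite EB /B'.
  repeat rewrite count_cat /=; rewrite eq_sym (negbTE zy); clear; lia.
exists B1; split=> //; first by move=> z; rewrite E1.
move=> p q; apply: Rt _ (R1 p q); rewrite EB /B'.
have := @good_inner _ HR (p ++ c0) y c1 c2 (c3 ++ q); rewrite -!(catA, cat_cons).
apply=> z zc; have zB : z \in B.
  by rewrite EB !(mem_cat, inE); move: zc; rewrite mem_cat => /orP[]->; rewrite ?orbT.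
apply: leq_trans (cntB z zB) _; rewrite EB; clear; count_lia.
Qed.

(** Doubling guarantees at least two occurrences within the block; then
inner occurrences are deleted until there are exactly two. The normal form does
not depend on the context, as the blocks of u and v must receive theirs in
different contexts. *)
Lemma normal_block (B : word) :
  exists B1 : word, [/\ B1 =i B, {in B1, forall z, count_mem z B1 = 2}
    & forall p q, {in B, forall z, [\/ z \in p, z \in q | 1 < count_mem z B]} ->
      R (p ++ B ++ q) (p ++ B1 ++ q)].
Proof.
have [|B1 [E1 cnt1 R1]] := @reduce_block (doubled B).
  move=> z; rewrite mem_doubled count_doubled -has_pred1 has_count.
  by case: (count _ B) => // k _; rewrite doubleS.
exists B1; split=> //; first by move=> z; rewrite E1 mem_doubled.
by move=> p q H; apply: Rt _ (R1 p q); apply: (doubled_multi HR).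
Qed.
End Blocks.

Section BlockStep.
Variables (R S : word -> word -> Prop) (HR : good R) (HS : good S).
Hypothesis RS : forall u v, R u v -> S u v.
Hypothesis SR : items_sub S R.

Let Rt := fic_trans HR.
Let Rs := fic_sym HR.

(** The block B is replaced by B' inside the context made of the left
part of v, already treated, and the right part of u. *)
Lemma block_step (pu B qu pv B' qv : word) :
  S (pu ++ B ++ qu) (pv ++ B' ++ qv) ->
  pu =i pv -> qu =i qv -> B =i B' ->
  bounded_left pu (B ++ qu) pv (B' ++ qv) ->
  bounded_right (pu ++ B) qu (pv ++ B') qv ->
  {in B, forall z, [\/ z \in pu, z \in qu | 1 < count_mem z B]} ->
  {in B', forall z, [\/ z \in pv, z \in qv | 1 < count_mem z B']} ->
  R (pv ++ B ++ qu) (pv ++ B' ++ qu).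
Proof.
move=> Suv puv quv BB bdl bdr mB mB'.
have [B1 [E1 cnt1 R1]] := normal_block HR B.
have [B1' [E1' cnt1' R1']] := normal_block HR B'.
have mBv : {in B, forall z, [\/ z \in pv, z \in qu | 1 < count_mem z B]}.
  by move=> z /mB; rewrite puv.
have mBv' : {in B', forall z, [\/ z \in pv, z \in qu | 1 < count_mem z B']}.
  by move=> z /mB'; rewrite quv.
apply: Rt (R1 _ _ mBv) _; apply: Rs; apply: Rt (R1' _ _ mBv') _; apply: Rs.
apply: (@bubble R S HR HS RS SR pu qu pv qv puv quv B1 B1' _ _ _ _ [::]) => //.
- apply/allP => z; rewrite mem_cat E1 E1' BB orbb => zB.
  by apply/eqP; rewrite cnt1 ?cnt1' // ?E1 ?E1' ?BB.
- by apply: bounded_left_eq bdl => z; rewrite !mem_cat ?E1 ?E1'.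
- apply: bounded_left_eq bdr => z; rewrite !mem_rev !mem_cat ?E1 ?E1' //.
apply: (fic_trans HS (v := pu ++ B ++ qu)); first exact/RS/Rs/R1.
by apply: (fic_trans HS Suv); apply: RS; apply: R1'.
Qed.
End BlockStep.

(** * Words cut at their linear letters *)

Fixpoint assemble (B : word) (l : seq (letter * word)) : word :=
  if l is (t, C) :: l' then B ++ t :: assemble C l' else B.

Lemma assemble_exists (P : pred letter) (u : word) : exists B l,
  [/\ u = assemble B l, all (predC P) B, all (all (predC P)) (map snd l)
    & map fst l = filter P u].
Proof.
elim: u => [|a u [B [l [Eu aB al El]]]]; first by exists [::], [::].
have [Pa|Pa] := boolP (P a).
  by exists [::], ((a, B) :: l); rewrite /= Pa aB al El Eu.
exists (a :: B), l; rewrite /= Pa (negbTE Pa) aB; split=> //.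
by rewrite Eu; case: (l) => // -[].
Qed.

Definition tail_of (l : seq (letter * word)) : word :=
  if l is (t, C) :: l' then t :: assemble C l' else [::].

Lemma assemble_tail B l : assemble B l = B ++ tail_of l.
Proof. by case: l => [|[t C] l]; rewrite /= ?cats0. Qed.

Fixpoint same_blocks (l l' : seq (letter * word)) : Prop :=
  match l, l' with
  | [::], [::] => True
  | (t, C) :: l, (t', C') :: l' => [/\ t = t', C =i C' & same_blocks l l']
  | _, _ => False
  end.

Fixpoint union_blocks (l l' k : seq (letter * word)) : Prop :=
  match l, l', k with
  | [::], [::], [::] => True
  | (t, C) :: l, (t', C') :: l', (s, D) :: k =>
      [/\ t = t', t = s, D =i C ++ C' & union_blocks l l' k]
  | _, _, _ => False
  end.

(** Merging v with the merger of u and v reaches the same contents from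
both sides. *)
Lemma union_union l l' k k' : union_blocks l l' k -> union_blocks l' k k' ->
  same_blocks k' k.
Proof.
elim: l l' k k' => [|[t C] l IH] [|[t' C'] l'] [|[s D] k] [|[s' D'] k'] //=.
case=> <- <- ED U [_ <- ED' U']; split=> //; last exact: IH U U'.
by move=> z; rewrite ED' mem_cat ED mem_cat; case: (_ \in C'); rewrite ?orbT ?orbF.
Qed.

Lemma union_fst l l' k : union_blocks l l' k -> map fst k = map fst l.
Proof.
elim: l l' k => [|[t C] l IH] [|[t' C'] l'] [|[s D] k] //=.
by case=> _ <- _ /IH ->.
Qed.

Lemma same_blocks_tail l l' : same_blocks l l' -> tail_of l =i tail_of l'.
Proof.
elim: l l' => [|[t C] l IH] [|[t' C'] l'] //= [<- EC /IH E] z.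
by rewrite !inE !assemble_tail !mem_cat EC E.
Qed.

Section Insert.
Variables (R S : word -> word -> Prop) (HR : good R) (HS : good S).
Hypothesis RS : forall u v, R u v -> S u v.
Hypothesis SR : items_sub S R.

Let Rr := fic_refl HR.
Let Rt := fic_trans HR.
Let Rs := fic_sym HR.

Lemma split_two (y : letter) (w : word) : 1 < count_mem y w ->
  exists w1 w2 w3, w = w1 ++ y :: w2 ++ y :: w3.
Proof.
move=> cy; have: y \in w.
  by rewrite -has_pred1 has_count; apply: leq_trans cy.
case/split_first_mem=> w1 [w4 [Ew yw]]; move: cy.
rewrite Ew count_cat (count_memPn yw) /= eqxx add1n ltnS -has_count has_pred1.
by case/split_first_mem=> w2 [w3 [-> _]]; exists w1, w2, w3.
Qed.

(** Depending on where z occurs outside the block, the insertion is an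
instance of [p_before], of [p_fill] or of the mirror image of [p_before]; the
word v, in whose block z does occur, shows that S has this item. *)
Lemma insert_letter (pu B qu pv B' qv : word) z :
  S (pu ++ B ++ qu) (pv ++ B' ++ qv) ->
  bounded_left pu (B ++ qu) pv (B' ++ qv) ->
  bounded_right (pu ++ B) qu (pv ++ B') qv ->
  z \in B' -> z \notin B -> 1 < count_mem z (pu ++ B ++ qu) ->
  R (pu ++ B ++ qu) (pu ++ z :: B ++ qu).
Proof.
move=> Suv bdl bdr zB' zB cz.
have [zp|zp] := boolP (z \in pu); last first.
  have cq : 1 < count_mem z qu.
    by move: cz; rewrite !count_cat (count_memPn zp) (count_memPn zB).
  have zq : z \in qu by rewrite -has_pred1 has_count; apply: leq_trans cq.
  case: bdr => [[Eq _]|[s [P [P' [Eq Eqv su sv]]]]].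
    by move: zq; rewrite -mem_rev Eq.
  have Eq' : qu = s :: rev P by rewrite -[qu]revK Eq rev_rcons.
  have Eqv' : qv = s :: rev P' by rewrite -[qv]revK Eqv rev_rcons.
  have Rb : holds R p_before.
    apply: SR => //; rewrite Eq' Eqv' !catA in Suv.
    apply: (@before_of _ HS (pu ++ B) (rev P) (pv ++ B') (rev P') s z Suv).
    - by move: su; rewrite !(mem_cat, mem_rev) orbC.
    - by move: sv; rewrite !(mem_cat, mem_rev) orbC.
    - by rewrite mem_cat negb_or zp zB.
    - move: zq; rewrite Eq' inE => /orP[/eqP zs|//]; move: sv; rewrite -zs.
      by rewrite mem_cat mem_rev !mem_cat zB' !orbT.
    by rewrite mem_cat zB' orbT.
  have [q1 [q2 [q3 Eq3]]] := split_two cq.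
  have := Rb [:: [:: z]; [::]; B ++ q1; q2] => H.
  by apply: (fic_step HR H (p := pu) (q := q3)); rewrite Eq3; list_eq.
have [zq|zq] := boolP (z \in qu).
  case: bdr => [[Eq _]|[s [Q [Q' [Eq Eqv su sv]]]]].
    by move: zq; rewrite -mem_rev Eq.
  case: bdl => [[Ep _]|[t [P [P' [Ep Epv tu tv]]]]].
    by move: zp; rewrite Ep.
  have Eq' : qu = s :: rev Q by rewrite -[qu]revK Eq rev_rcons.
  have Eqv' : qv = s :: rev Q' by rewrite -[qv]revK Eqv rev_rcons.
  have Rf : holds R p_fill.
    apply: SR => //; rewrite Eq' Eqv' Ep Epv !cat_rcons in Suv.
    rewrite Eq' !(mem_cat, inE) !negb_or in tu.
    rewrite Eqv' !(mem_cat, inE) !negb_or in tv.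
    rewrite Ep !(mem_cat, mem_rev, mem_rcons, inE) !negb_or in su.
    rewrite Epv !(mem_cat, mem_rev, mem_rcons, inE) !negb_or in sv.
    case/and4P: tu => tP tB ts tQ; case/and4P: tv => tP' tB' _ tQ'.
    case/andP: su => sQ /andP[/andP[_ sP] sB].
    case/andP: sv => sQ' /andP[/andP[_ sP'] sB'].
    apply: (@fill_of _ HS P B (rev Q) P' B' (rev Q') t s z Suv ts).
    - by rewrite !mem_cat !negb_or tP tB.
    - by rewrite !mem_cat !negb_or sP sB mem_rev.
    - by rewrite !mem_cat !negb_or tP' tB'.
    - by rewrite !mem_cat !negb_or sP' sB' mem_rev.
    - move: zp; rewrite Ep mem_rcons inE => /orP[/eqP zt|//].
      by rewrite -zt zB' in tB'.
    - move: zq; rewrite Eq' inE => /orP[/eqP zs|//].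
      by rewrite -zs zB' in sB'.
    - by [].
    by [].
  case/path.splitPr: zp => p1 p2; case/path.splitPr: zq => q1 q2.
  have := Rf [:: [:: z]; [::]; p2; B ++ q1] => H.
  by apply: (fic_step HR H (p := p1) (q := q2)); list_eq.
have cp : 1 < count_mem z pu.
  by move: cz; rewrite !count_cat (count_memPn zq) (count_memPn zB) !addn0.
case: bdl => [[Ep _]|[t [P [P' [Ep Epv tu tv]]]]].
  by move: zp; rewrite Ep.
have Rb : holds R (flip p_before).
  apply: SR => //; apply/holds_flip.
  have Suv' : mirror S (rev (B ++ qu) ++ t :: rev P) (rev (B' ++ qv) ++ t :: rev P').
    rewrite /mirror; have E (A C : word) : rev (rev A ++ t :: rev C) = rcons C t ++ A.
      by rewrite rev_cat rev_cons !revK.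
    by rewrite !E -Ep -Epv.
  apply: (@before_of _ (good_mirror HS) _ _ _ _ t z Suv').
  - by move: tu; rewrite !mem_cat !mem_rev mem_cat orbC.
  - by move: tv; rewrite !mem_cat !mem_rev mem_cat orbC.
  - by rewrite mem_rev mem_cat negb_or zB.
  - move: zp; rewrite Ep mem_rcons inE mem_rev => /orP[/eqP zt|//].
    by move: tv; rewrite -zt !mem_cat zB' orbT.
  by rewrite mem_rev mem_cat zB'.
have [p1 [p2 [p3 Ep3]]] := split_two cp.
have := Rb [:: [:: z]; [::]; p3; p2] => H.
by apply: (fic_step HR H (p := p1) (q := B ++ qu)); rewrite Ep3; list_eq.
Qed.

Lemma merge_block (pu B qu pv B' qv : word) :
  S (pu ++ B ++ qu) (pv ++ B' ++ qv) ->
  bounded_left pu (B' ++ B ++ qu) pv (B' ++ qv) ->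
  bounded_right (pu ++ B' ++ B) qu (pv ++ B') qv ->
  {in B', forall z, 1 < count_mem z (pu ++ B ++ qu)} ->
  exists D : word, [/\ {subset D <= B'}, {subset B' <= D ++ B}
    & R (pu ++ B ++ qu) (pu ++ D ++ B ++ qu)].
Proof.
move=> Suv bdl bdr cnt.
suff: forall c : word, {subset c <= B'} -> exists D : word, [/\ {subset D <= B'},
    {subset c <= D ++ B} & R (pu ++ B ++ qu) (pu ++ D ++ B ++ qu)].
  by apply.
elim=> [|z c IH] sc; first by exists [::]; split=> //; apply: Rr.
have zB' : z \in B' by apply: sc; rewrite mem_head.
have [a ac|D [sD sc' RD]] := IH; first by apply: sc; rewrite in_cons ac orbT.
have [zD|zD] := boolP (z \in D ++ B).
  by exists D; split=> // a; rewrite inE => /orP[/eqP->|/sc'].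
exists (z :: D); split.
- by move=> a; rewrite inE => /orP[/eqP->|/sD].
- by move=> a; rewrite cat_cons !in_cons => /orP[->//|/sc' ->]; rewrite orbT.
apply: (Rt RD).
have := @insert_letter pu (D ++ B) qu pv B' qv z.
rewrite -!catA; apply=> //.
- by apply: (fic_trans HS _ Suv); apply: RS; apply: Rs.
- apply: bounded_left_eq bdl => // a; rewrite !mem_cat.
  by case/or3P=> [/sD->|->|->]; rewrite ?orbT.
- apply: bounded_left_eq bdr => // a; rewrite !mem_rev !mem_cat.
  by case/or3P=> [->|/sD->|->]; rewrite ?orbT.
apply: leq_trans (cnt z zB') _; clear; count_lia.
Qed.

Variable lin : pred letter.

Definition counted (u : word) : Prop :=
  forall x, x \in u -> if lin x then count_mem x u = 1 else 1 < count_mem x u.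

Definition aligned (pu pv : word) : Prop :=
  (pu = [::] /\ pv = [::]) \/
  exists t P P', [/\ pu = rcons P t, pv = rcons P' t & lin t].

Lemma counted_unique (P Q : word) t : counted (P ++ t :: Q) -> lin t ->
  t \notin P ++ Q.
Proof.
move=> /(_ t) H lt; move: H; rewrite lt mem_cat mem_head orbT => /(_ isT) /eqP.
rewrite count_cat /= eqxx addnCA add1n eqSS -count_cat => /eqP/count_memPn.
by rewrite mem_cat.
Qed.

Lemma aligned_left (pu B pv B' : word) : aligned pu pv ->
  counted (pu ++ B) -> counted (pv ++ B') -> bounded_left pu B pv B'.
Proof.
case=> [|[t [P [P' [-> -> lt]]]]] cu cv; first by left.
right; exists t, P, P'; rewrite !cat_rcons in cu cv.
by split=> //; apply: counted_unique.
Qed.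

Lemma counted_perm u v : perm_eq u v -> counted u -> counted v.
Proof.
by move=> uv cu x; rewrite -(perm_mem uv) -(permP uv) => /cu.
Qed.

Lemma counted_rev u : counted u -> counted (rev u).
Proof. by move=> cu; apply: counted_perm cu; rewrite perm_sym perm_rev. Qed.

Lemma aligned_tails (A A' : word) l l' :
  map fst l = map fst l' -> all lin (map fst l) ->
  counted (A ++ tail_of l) -> counted (A' ++ tail_of l') ->
  bounded_right A (tail_of l) A' (tail_of l').
Proof.
move=> E al cu cv; apply: aligned_left; last first.
- by rewrite -rev_cat; apply: counted_rev.
- by rewrite -rev_cat; apply: counted_rev.
case: l l' E al {cu cv} => [|[t C] l] [|[t' C'] l'] //=; first by left.
case=> <- _ /andP[lt _]; right; exists t, (rev (assemble C l)), (rev (assemble C' l')).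
by rewrite !rev_cons.
Qed.

Lemma merge_step l l' (pu B pv B' : word) :
  S (pu ++ B ++ tail_of l) (pv ++ B' ++ tail_of l') ->
  map fst l = map fst l' -> all lin (map fst l) -> all (predC lin) B' ->
  aligned pu pv -> counted (pu ++ B ++ tail_of l) ->
  counted (pv ++ B' ++ tail_of l') ->
  pu ++ B ++ tail_of l =i pv ++ B' ++ tail_of l' ->
  exists D : word, [/\ D ++ B =i B ++ B', all (predC lin) D,
    R (pu ++ B ++ tail_of l) (pu ++ D ++ B ++ tail_of l),
    counted (pu ++ D ++ B ++ tail_of l)
    & pu ++ D ++ B ++ tail_of l =i pu ++ B ++ tail_of l].
Proof.
set qu := tail_of l; set qv := tail_of l'.
move=> Suv El lL nB' alg cu cv cont.
have mB' : {in B', forall z, 1 < count_mem z (pu ++ B ++ qu)}.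
  move=> z zB'; have zu : z \in pu ++ B ++ qu by rewrite cont !mem_cat zB' !orbT.
  by have := cu z zu; rewrite (negbTE (allP nB' z zB')).
have cnt (D : word) : {subset D <= B'} -> counted (pu ++ D ++ B ++ qu).
  move=> sD z; have [lz|lz] := boolP (lin z).
    have zD : z \notin D by apply: contraL lz => /sD/(allP nB').
    have := cu z; rewrite lz !(mem_cat, count_cat) (count_memPn zD) (negbTE zD).
    by [].
  move=> zu; have : z \in pu ++ B ++ qu.
    move: zu; rewrite !mem_cat; case/or4P=> [->|/sD zB'|->|->]; rewrite ?orbT //.
    by have := cont z; rewrite !mem_cat zB' !orbT => ->.
  move/cu; rewrite (negbTE lz) => /leq_trans; apply; clear; count_lia.
have [|||D [sD sD' RD]] := @merge_block pu B qu pv B' qv Suv.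
- by apply: aligned_left => //; apply: cnt.
- by apply: aligned_tails; rewrite -?catA //; apply: cnt.
- exact: mB'.
exists D; split=> //.
- move=> z; rewrite !mem_cat; have := sD z; have := sD' z; rewrite mem_cat.
  case: (z \in B') => [/(_ isT)|_]; first by rewrite orbT.
  by case: (z \in D) => [/(_ isT)//|_]; rewrite orbF.
- by apply/allP => z /sD/(allP nB').
- exact: cnt.
move=> z; rewrite !mem_cat; have := sD z; have := cont z; rewrite !mem_cat.
case: (z \in D) => //= + /(_ isT) => /[swap] ->; rewrite !orbT => ->.
by [].
Qed.

Lemma merge_contents l l' B B' pu pv :
  S (pu ++ assemble B l) (pv ++ assemble B' l') ->
  map fst l = map fst l' -> all lin (map fst l) ->
  all (predC lin) B -> all (predC lin) B' ->
  all (all (predC lin)) (map snd l) -> all (all (predC lin)) (map snd l') ->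
  aligned pu pv -> counted (pu ++ assemble B l) -> counted (pv ++ assemble B' l') ->
  pu ++ assemble B l =i pv ++ assemble B' l' ->
  exists B1 k, [/\ B1 =i B ++ B', union_blocks l l' k,
    R (pu ++ assemble B l) (pu ++ assemble B1 k), counted (pu ++ assemble B1 k)
    & all (predC lin) B1 /\ all (all (predC lin)) (map snd k)].
Proof.
elim: l l' B B' pu pv => [|[t C] l IH] l' B B' pu pv;
  rewrite !assemble_tail => Suv El lL nB nB' nl nl' alg cu cv cont;
  have [D [ED nD RD cD contD]] := merge_step Suv El lL nB' alg cu cv cont.
  case: l' El Suv cv cont nl' {lL} => // _ _ _ _ _.
  move: RD cD; rewrite /= !cats0 => RD cD.
  by exists (D ++ B), [::]; rewrite /= all_cat nD nB.
case: l' El Suv cv cont nl' => // -[t' C'] l' [<- El] /= Suv cv cont /andP[nC' nl'].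
case/andP: lL => lt lL; case/andP: nl => nC nl.
have E (A F : word) x : A ++ x ++ t :: F = (A ++ rcons x t) ++ F.
  by rewrite -catA cat_rcons.
have E2 (A F : word) : A ++ D ++ B ++ t :: F = (A ++ rcons (D ++ B) t) ++ F.
  by rewrite -catA cat_rcons -catA.
have [|||||C1 [k [EC1 U Rk ck [nC1 nk]]]] :=
  IH l' C C' (pu ++ rcons (D ++ B) t) (pv ++ rcons B' t) _ El lL nC nC' nl nl'.
- rewrite -E2 -E; by apply: (fic_trans HS _ Suv); apply: RS; apply: Rs.
- right; exists t, (pu ++ D ++ B), (pv ++ B').
  by rewrite -!rcons_cat.
- by rewrite -E2.
- by rewrite -E.
- by move=> z; rewrite -E2 -E -cont contD.
exists (D ++ B), ((t, C1) :: k); split.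
- exact: ED.
- by [].
- by apply: (Rt RD); apply: (fic_conv Rk); rewrite /= -?[(D ++ B) ++ _]catA E2.
- by rewrite /= -[(D ++ B) ++ _]catA E2.
by rewrite /= all_cat nD nB nC1 nk.
Qed.

(** The blocks are replaced from left to right. In the words related
by R the part already replaced is that of v, while S still relates u itself to v;
hence the two left parts pu and pv. *)
Lemma same_blocks_equiv l l' B B' pu pv :
  S (pu ++ assemble B l) (pv ++ assemble B' l') ->
  same_blocks l l' -> B =i B' -> pu =i pv -> all lin (map fst l) ->
  all (predC lin) B -> all (predC lin) B' ->
  all (all (predC lin)) (map snd l) -> all (all (predC lin)) (map snd l') ->
  aligned pu pv -> counted (pu ++ assemble B l) -> counted (pv ++ assemble B' l') ->
  R (pv ++ assemble B l) (pv ++ assemble B' l').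
Proof.
have fstE k k' : same_blocks k k' -> map fst k = map fst k'.
  elim: k k' => [|[t C] k IH] [|[t' C'] k'] //= [-> _ /IH ->] //.
have step k k' (p A q A' : word) : S (p ++ A ++ tail_of k) (q ++ A' ++ tail_of k') ->
    same_blocks k k' -> A =i A' -> p =i q -> all lin (map fst k) ->
    all (predC lin) A -> all (predC lin) A' -> aligned p q ->
    counted (p ++ A ++ tail_of k) -> counted (q ++ A' ++ tail_of k') ->
    R (q ++ A ++ tail_of k) (q ++ A' ++ tail_of k).
  move=> Suv sb EA Ep lk nA nA' al cu cv.
  apply: (block_step HR HS RS SR Suv) => //.
  - exact: same_blocks_tail.
  - exact: aligned_left.
  - by apply: aligned_tails; rewrite -?catA //; apply: fstE.
  - by move=> z zA; apply: multi_cases; have := cu z;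
      rewrite !mem_cat zA !orbT (negbTE (allP nA z zA)); apply.
  by move=> z zA; apply: multi_cases; have := cv z;
      rewrite !mem_cat zA !orbT (negbTE (allP nA' z zA)); apply.
elim: l l' B B' pu pv => [|[t C] l IH] l' B B' pu pv;
  rewrite !assemble_tail => Suv sb EB Ep lL nB nB' nl nl' alg cu cv;
  have RB := step _ _ _ _ _ _ Suv sb EB Ep lL nB nB' alg cu cv.
  by case: l' sb Suv {cv nl'} => //= _ _; move: RB; rewrite !cats0.
apply: Rt RB _; case: l' sb Suv cv nl' => // -[t' C'] l' [<- EC sb] /= Suv cv /andP[nC' nl'].
case/andP: lL => lt lL; case/andP: nl => nC nl.
have E (A F x : word) : A ++ x ++ t :: F = (A ++ rcons x t) ++ F.
  by rewrite -catA cat_rcons.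
rewrite !E in Suv cu cv *.
apply: (IH l' C C' _ _ Suv) => //.
  by move=> z; rewrite !mem_cat !mem_rcons !inE Ep EB.
by right; exists t, (pu ++ B), (pv ++ B'); rewrite -!rcons_cat.
Qed.
End Insert.

(** * Transfer of identities *)

Lemma perm_first_difference (T : eqType) (A B : seq T) : perm_eq A B ->
  A = B \/ exists c a A' b B', [/\ A = c ++ a :: A', B = c ++ b :: B' & a != b].
Proof.
elim: A B => [|a A IH] B prm.
  by left; apply/esym/perm_nilP; rewrite perm_sym.
case: B prm => [|b B] prm; first by have /perm_nilP := prm.
have [ab|ab] := eqVneq a b; last by right; exists [::], a, A, b, B.
move: prm; rewrite ab perm_cons => /IH[->|]; first by left.
by case=> c [a' [A' [b' [B' [-> -> ne]]]]]; right; exists (b :: c), a', A', b', B'.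
Qed.

Lemma union_tail l l' k : union_blocks l l' k ->
  tail_of k =i tail_of l ++ tail_of l'.
Proof.
elim: l l' k => [|[t C] l IH] [|[t' C'] l'] [|[s D] k] //=.
case=> <- <- ED /IH E z; rewrite !assemble_tail !(mem_cat, inE) ED E !mem_cat.
case: (z == t) => //=; case: (z \in C) => //=; case: (z \in C') => //=;
  by rewrite ?orbT.
Qed.

Lemma perm_comm (R : word -> word -> Prop) (HR : fic R) (w w' : word) :
  holds R p_comm -> perm_eq w w' -> R w w'.
Proof.
move=> H; elim: w' w => [|a w' IH] w prm.
  by rewrite (perm_nilP prm); apply: (fic_refl HR).
have : a \in w by rewrite (perm_mem prm) mem_head.
case/split_first_mem=> w1 [w2 [Ew _]]; rewrite Ew in prm *.
have {}prm : perm_eq (w1 ++ w2) w'.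
  by rewrite -(perm_cons a) (perm_trans _ prm) // -[a :: _ ++ _]/([:: a] ++ _) perm_catCA.
apply: (fic_trans HR (v := a :: w1 ++ w2)).
  by apply: (fic_step HR (H [:: w1; [:: a]]) (p := [::]) (q := w2)); list_eq.
by apply: (fic_step HR (IH _ prm) (p := [:: a]) (q := [::])); rewrite !cats0.
Qed.

Lemma all_trivial (R : word -> word -> Prop) (HR : fic R) (u v : word) :
  holds R p_triv -> R u v.
Proof.
move=> H; have E w : R w [::].
  by apply: (fic_conv (H [:: w])); list_eq.
by apply: (fic_trans HR (E u)); apply: (fic_sym HR).
Qed.

Lemma band_doubled (R : word -> word -> Prop) (HR : fic R) (u : word) :
  holds R p_band -> R u (doubled u).
Proof.
move=> H; elim: u => [|a u IH]; first exact: fic_refl.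
by apply: (fic_cat HR (H [:: [:: a]]) IH).
Qed.

Lemma filter_pair (T : eqType) (a b : T) (c A : seq T) :
  uniq (c ++ a :: A) -> b \notin c -> b \in A ->
  filter (mem [:: a; b]) (c ++ a :: A) = [:: a; b].
Proof.
rewrite cat_uniq /= negb_or => /and3P[_ /andP[ac _] /andP[aA UA]] bc bA.
have N (s : seq T) : a \notin s -> filter (mem [:: a; b]) s = filter (pred1 b) s.
  move=> as_; apply: eq_in_filter => x xs; rewrite /= !inE.
  by have [xa|//] := eqVneq x a; rewrite -xa xs in as_.
rewrite filter_cat /= inE eqxx N // filter_mem0 ?N //=; last first.
  by move=> x xc; apply: contraNneq bc => <-.
by rewrite filter_pred1_uniq.
Qed.

Section Transfer.
Variables (R S : word -> word -> Prop) (HR : good R) (HS : good S).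
Hypothesis RS : forall u v, R u v -> S u v.
Hypothesis SR : items_sub S R.

Let Rt := fic_trans HR.
Let Rs := fic_sym HR.

(** Merging u with v and v with the result gives words whose
corresponding blocks have equal contents, to which [same_blocks_equiv] applies. *)
Lemma transfer_same_linear u v : S u v -> u =i v ->
  (forall x, (count_mem x u == 1) = (count_mem x v == 1)) ->
  filter (fun x => count_mem x u == 1) u = filter (fun x => count_mem x u == 1) v ->
  R u v.
Proof.
set lin := fun x => count_mem x u == 1; move=> Suv uv Elin Eord.
have pos w (x : letter) : x \in w -> 0 < count_mem x w.
  by rewrite -has_count has_pred1.
have cu : counted lin u.
  move=> x xu; have := pos u x xu; rewrite /lin.
  by case: eqP => // /eqP; case: (count_mem x u) => [|[|]].
have cv : counted lin v.
  move=> x xv; have := pos v x xv; rewrite /lin Elin.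
  by case: eqP => // /eqP; case: (count_mem x v) => [|[|]].
have [B [l [Eu nB nl El]]] := assemble_exists lin u.
have [B' [l' [Ev nB' nl' El']]] := assemble_exists lin v.
have lL : all lin (map fst l) by rewrite El filter_all.
have lL' : all lin (map fst l') by rewrite El' filter_all.
have alg0 : aligned lin [::] [::] by left.
have Suv' : S ([::] ++ assemble B l) ([::] ++ assemble B' l') by rewrite /= -Eu -Ev.
have cu' : counted lin ([::] ++ assemble B l) by rewrite /= -Eu.
have cv' : counted lin ([::] ++ assemble B' l') by rewrite /= -Ev.
have Ell' : map fst l = map fst l' by rewrite El El' Eord.
have Emem : [::] ++ assemble B l =i [::] ++ assemble B' l' by rewrite /= -Eu -Ev.
have [B1 [k [EB1 Uk Rk ck [nB1 nk]]]] :=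
  merge_contents HR HS RS SR Suv' Ell' lL nB nB' nl nl' alg0 cu' cv' Emem.
have Svk : S ([::] ++ assemble B' l') ([::] ++ assemble B1 k).
  by apply: (fic_trans HS (fic_sym HS Suv')); apply: RS.
have Ekl : map fst l' = map fst k by rewrite (union_fst Uk) Ell'.
have Emem' : [::] ++ assemble B' l' =i [::] ++ assemble B1 k.
  move=> z; have := Emem z; rewrite /= !assemble_tail !mem_cat EB1 (union_tail Uk) !mem_cat.
  by case: (z \in B); case: (z \in B'); case: (z \in tail_of l);
    case: (z \in tail_of l').
have [B2 [k2 [EB2 Uk2 Rk2 ck2 [nB2 nk2]]]] :=
  merge_contents HR HS RS SR Svk Ekl lL' nB' nB1 nl' nk alg0 cv' ck Emem'.
have Sk2 : S ([::] ++ assemble B2 k2) ([::] ++ assemble B1 k).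
  by apply: (fic_trans HS (fic_sym HS (RS Rk2))).
have EB : B2 =i B1.
  by move=> z; rewrite EB2 mem_cat EB1 mem_cat; case: (z \in B'); rewrite ?orbT ?orbF.
have lk2 : all lin (map fst k2) by rewrite (union_fst Uk2).
have R21 := same_blocks_equiv HR HS RS SR Sk2 (union_union Uk Uk2) EB
  (fun=> erefl) lk2 nB2 nB1 nk2 nk alg0 ck2 ck.
rewrite Eu Ev; apply: (Rt Rk); apply: Rs; apply: (Rt Rk2); exact: R21.
Qed.

(** If the linear letters come in different orders, S contains
xy = yx, hence so does R, and they may be sorted. *)
Lemma transfer_same_set u v : S u v -> u =i v ->
  (forall x, (count_mem x u == 1) = (count_mem x v == 1)) -> R u v.
Proof.
set lin := fun x => count_mem x u == 1; move=> Suv uv Elin.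
have Elin' : lin =1 (fun x => count_mem x v == 1) by move=> x; apply: Elin.
have cnt w (P : pred letter) x : P x -> count_mem x (filter P w) = count_mem x w.
  move=> Px; rewrite count_filter; apply: eq_count => y /=.
  by case: eqP => // ->.
have Uf w : (forall x, lin x -> count_mem x w = 1) -> uniq (filter lin w).
  move=> H; apply: count_mem_uniq => x; rewrite mem_filter.
  have [lx|lx] /= := boolP (lin x); first by rewrite cnt // H // -has_pred1 has_count H.
  by apply/count_memPn; rewrite mem_filter (negbTE lx).
have Uu : uniq (filter lin u) by apply: Uf => x lx; apply/eqP/lx.
have Uv : uniq (filter lin v) by apply: Uf => x lx; apply/eqP; rewrite -[_ == _]Elin'.
have prm : perm_eq (filter lin u) (filter lin v).
  by apply: uniq_perm => // x; rewrite !mem_filter uv.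
have [E|[c [a [A' [b [B' [EA EB ab]]]]]]] := perm_first_difference prm.
  exact: transfer_same_linear.
have Rc : holds R p_comm.
  apply: SR => //; have Sf := fic_filter HS lin Suv; rewrite EA EB in Sf.
  rewrite EA in Uu prm; rewrite EB in Uv prm.
  have [bc bA] : b \notin c /\ b \in A'.
    move: Uv; rewrite cat_uniq /= negb_or => /and3P[_ /andP[bc _] _]; split=> //.
    have := perm_mem prm b; rewrite !mem_cat (negbTE bc) !inE eqxx eq_sym.
    by rewrite (negbTE ab).
  have [ac aB] : a \notin c /\ a \in B'.
    move: Uu; rewrite cat_uniq /= negb_or => /and3P[_ /andP[ac _] _]; split=> //.
    by have := perm_mem prm a; rewrite !mem_cat (negbTE ac) !inE eqxx (negbTE ab).
  have := fic_filter HS (mem [:: a; b]) Sf.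
  rewrite filter_pair // (@eq_filter _ _ (mem [:: b; a])) ?filter_pair // => [H|x].
    by apply: (@holds_letters _ HS [:: a; b] _ a) => //=; rewrite inE ab.
  by rewrite /= !inE orbC.
(* Both words are sorted, linear letters in the order of u first. *)
pose nonlin := predC lin.
have sortR w : R w (filter lin w ++ filter nonlin w).
  by apply: (perm_comm HR Rc); rewrite perm_sym perm_filterC.
have Rv : R v (filter lin u ++ filter nonlin v).
  by apply: (Rt (sortR v)); apply: (perm_comm HR Rc); rewrite perm_cat2r perm_sym.
apply: (Rt (sortR u)); apply: Rs; apply: (Rt Rv); apply: Rs.
have pu : perm_eq (filter lin u ++ filter nonlin u) u by apply/permPl/perm_filterC.
have pv : perm_eq (filter lin u ++ filter nonlin v) v.
  by apply: perm_trans (_ : perm_eq (filter lin v ++ filter nonlin v) v);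
    [rewrite perm_cat2r|apply/permPl/perm_filterC].
have cu x : count_mem x (filter lin u ++ filter nonlin u) = count_mem x u.
  by apply/seq.permP.
have cv x : count_mem x (filter lin u ++ filter nonlin v) = count_mem x v.
  by apply/seq.permP.
have El w : filter lin (filter lin u ++ filter nonlin w) = filter lin u.
  rewrite filter_cat filter_id (filter_mem0 (s := filter _ w)) ?cats0 // => a0.
  by rewrite mem_filter => /andP[].
apply: transfer_same_linear.
- apply: (fic_trans HS (v := u)); first by apply: RS; apply: Rs.
  by apply: (fic_trans HS Suv); apply: RS.
- by move=> x; rewrite (perm_mem pu) (perm_mem pv).
- by move=> x; rewrite cu cv; apply: Elin.
have E : (fun x => count_mem x (filter lin u ++ filter nonlin u) == 1) =1 lin.
  by move=> x; rewrite cu.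
by rewrite !(eq_filter E) !El.
Qed.

(** If S contains x = x^2, all letters are doubled and no linear letter
is left; otherwise u and v have the same linear letters. *)
Lemma transfer u v : S u v -> R u v.
Proof.
move=> Suv.
have [triv|ntriv] := pselect (holds S p_triv).
  by apply: (all_trivial HR); apply: SR.
have uv : u =i v.
  move=> x; apply/idP/idP => xw; apply: contra_notT ntriv => xw'.
    exact: (triv_of HS Suv xw xw').
  exact: (triv_of HS (fic_sym HS Suv) xw xw').
have [band|nband] := pselect (holds S p_band).
  have Rb := SR (e := p_band) isT band.
  have D w := band_doubled HR w Rb.
  apply: (Rt (D u)); apply: Rs; apply: (Rt (D v)); apply: Rs.
  apply: transfer_same_set.
  - apply: (fic_trans HS (v := u)); first by apply: RS; apply: Rs.
    by apply: (fic_trans HS Suv); apply: RS.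
  - by move=> x; rewrite !mem_doubled.
  move=> x; rewrite !count_doubled.
  by case: (count_mem x u) => [|?]; case: (count_mem x v) => [|?]; rewrite ?doubleS.
apply: transfer_same_set => // x.
have one w w' : S w w' -> w =i w' -> count_mem x w = 1 -> count_mem x w' = 1.
  move=> Sww ww cx; have xw' : x \in w' by rewrite -ww -has_pred1 has_count cx.
  have : 0 < count_mem x w' by rewrite -has_count has_pred1.
  case E : (count_mem x w') => [|[|k]] // _; case: nband.
  by apply: (band_of HS Sww cx); rewrite E.
apply/eqP/eqP; first exact: one Suv uv.
by apply: one (fic_sym HS Suv) _ => y; rewrite uv.
Qed.
End Transfer.

Lemma good_meet R S : good R -> good S -> good (fun u v => R u v /\ S u v).
Proof.
move=> HR HS; split; first split; first split.
- by move=> u; split; apply: fic_refl; [exact: HR|exact: HS].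
- by move=> u v [Ruv Suv]; split; apply: fic_sym => //; [exact: HR|exact: HS].
- move=> v u w [Ruv Suv] [Rvw Svw].
  by split; [exact: (fic_trans HR Ruv Rvw)|exact: (fic_trans HS Suv Svw)].
- by move=> p q u v [Ruv Suv]; split; [apply: (fic_ctx HR)|apply: (fic_ctx HS)].
- by move=> f u v [Ruv Suv]; split; [apply: (fic_subst HR)|apply: (fic_subst HS)].
- by move=> e eb ws; split; apply: based_holds => //; [exact: HR|exact: HS].
by move=> p x c d q H; split; apply: good_inner.
Qed.

(** Replacing R by its intersection with S, one may assume that R is
included in S. *)
Theorem good_transfer R S : good R -> good S -> items_sub S R ->
  forall u v, S u v -> R u v.
Proof.
move=> HR HS SR u v Suv.
have [] // : (fun u v => R u v /\ S u v) u v.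
apply: (transfer (good_meet HR HS) HS _ _ Suv); first by move=> ? ? [].
by move=> e ei eS ws; split; [apply: SR|apply: eS].
Qed.

(** * Derivations from the axioms of E^1{sigma_2} *)

Section Derivations.
Variables (R : word -> word -> Prop) (HR : fic R).
(** Rewriting a factor; the two equations leave the bracketing of words to
syntactic normalisation. *)
Lemma rewrite_at (e : pattern) (ws : seq word) (p q w w' : word) :
  holds R e -> w = p ++ inst ws e.1 ++ q -> w' = p ++ inst ws e.2 ++ q -> R w w'.
Proof. by move=> H -> ->; apply: fic_ctx => //; apply: H. Qed.

Lemma rewrite_back (e : pattern) (ws : seq word) (p q w w' : word) :
  holds R e -> w = p ++ inst ws e.2 ++ q -> w' = p ++ inst ws e.1 ++ q -> R w w'.
Proof. by move=> H Ew Ew'; apply: (fic_sym HR (rewrite_at H Ew' Ew)). Qed.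
End Derivations.

Ltac name_words X Y T U :=
  let ws := fresh "ws" in intros ws;
  set (X := nth [::] ws 0); set (Y := nth [::] ws 1);
  set (T := nth [::] ws 2); set (U := nth [::] ws 3).

Definition p_E2 : pattern := ([:: 0; 2; 0; 0], [:: 0; 0; 2; 0]).
Definition p_E3 : pattern := ([:: 0; 1; 1; 0], [:: 0; 0; 1; 1]).
Definition p_E4 : pattern :=
  ([:: 0; 2; 1; 3; 0; 0; 1; 1], [:: 0; 2; 1; 3; 1; 1; 0; 0]).

Section TheoryE.
Variables (R : word -> word -> Prop) (HR : fic R).
Hypothesis E1 : holds R p_sqr.
Hypothesis E2 : holds R p_E2.
Hypothesis E3 : holds R p_E3.
Hypothesis E4 : holds R p_E4.

Let Rt := fic_trans HR.
Let Rs := fic_sym HR.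

Lemma E_sqr' : holds R (flip p_sqr).
Proof.
move=> ws; set X := nth [::] ws 0; set T := nth [::] ws 2.
apply: (@Rt (X ++ T ++ X ++ X)).
  by apply: (rewrite_at HR (ws := [:: X; [::]; T]) (p := [::]) (q := [::]) E1); list_eq.
by apply: (rewrite_at HR (ws := [:: X; [::]; T]) (p := [::]) (q := [::]) E2); list_eq.
Qed.

Lemma E_dbl_r (p X T q : word) : R (p ++ X ++ T ++ X ++ q) (p ++ X ++ T ++ X ++ X ++ q).
Proof. by apply: (rewrite_at HR (ws := [:: X; [::]; T]) (p := p) (q := q) E1); list_eq. Qed.

Lemma E_dbl_l (p X T q : word) : R (p ++ X ++ T ++ X ++ q) (p ++ X ++ X ++ T ++ X ++ q).
Proof.
by apply: (rewrite_at HR (ws := [:: X; [::]; T]) (p := p) (q := q) E_sqr'); list_eq.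
Qed.

Lemma E_wrap (p X Y q : word) : R (p ++ X ++ Y ++ Y ++ X ++ q) (p ++ X ++ X ++ Y ++ Y ++ q).
Proof. by apply: (rewrite_at HR (ws := [:: X; Y]) (p := p) (q := q) E3); list_eq. Qed.

Lemma E_swap (p X T Y U q : word) :
  R (p ++ X ++ T ++ Y ++ U ++ X ++ X ++ Y ++ Y ++ q)
    (p ++ X ++ T ++ Y ++ U ++ Y ++ Y ++ X ++ X ++ q).
Proof. by apply: (rewrite_at HR (ws := [:: X; Y; T; U]) (p := p) (q := q) E4); list_eq. Qed.

(** (xy)^2 = x y^2 x y = x^2 y^2 y. *)
Lemma E_blocks (p X Y q : word) : R (p ++ X ++ X ++ Y ++ Y ++ q) (p ++ X ++ Y ++ X ++ Y ++ q).
Proof.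
apply: Rs; apply: (@Rt (p ++ X ++ Y ++ Y ++ X ++ Y ++ q)).
  by apply: (fic_conv (E_dbl_l (p ++ X) Y X q)); list_eq.
apply: (@Rt (p ++ X ++ X ++ Y ++ Y ++ Y ++ q)).
  exact: (E_wrap p X Y (Y ++ q)).
by apply: Rs; apply: (fic_conv (E_dbl_r (p ++ X ++ X) Y [::] q)); list_eq.
Qed.

Lemma E_star : holds R p_star.
Proof.
move=> ws; apply: (fic_conv (E_blocks [::] (nth [::] ws 0) (nth [::] ws 1) [::])); list_eq.
Qed.

Lemma E_dup1 : holds R p_dup1.
Proof.
name_words X Z T U.
apply: (@Rt (X ++ T ++ Z ++ U ++ Z ++ Z ++ X ++ X)).
  apply: (@Rt (X ++ T ++ Z ++ U ++ X ++ X ++ Z)).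
    by apply: (fic_conv (E_dbl_r [::] X (T ++ Z ++ U) Z)); list_eq.
  apply: (@Rt (X ++ T ++ Z ++ U ++ X ++ X ++ Z ++ Z)).
    by apply: (fic_conv (E_dbl_r (X ++ T) Z (U ++ X ++ X) [::])); list_eq.
  by apply: (fic_conv (E_swap [::] X T Z U [::])); list_eq.
apply: Rs; apply: (@Rt (X ++ T ++ Z ++ U ++ Z ++ X ++ X ++ Z)).
  by apply: (fic_conv (E_dbl_r [::] X (T ++ Z ++ U ++ Z) Z)); list_eq.
by apply: (fic_conv (E_wrap (X ++ T ++ Z ++ U) Z X [::])); list_eq.
Qed.

Lemma E_dup2 : holds R p_dup2.
Proof.
name_words X Z T U.
apply: (@Rt (Z ++ T ++ X ++ U ++ Z ++ Z ++ X ++ X)).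
  apply: (@Rt (Z ++ T ++ X ++ U ++ X ++ X ++ Z)).
    by apply: (fic_conv (E_dbl_r (Z ++ T) X U Z)); list_eq.
  apply: (@Rt (Z ++ T ++ X ++ U ++ X ++ X ++ Z ++ Z)).
    by apply: (fic_conv (E_dbl_r [::] Z (T ++ X ++ U ++ X ++ X) [::])); list_eq.
  by apply: Rs; apply: (fic_conv (E_swap [::] Z T X U [::])); list_eq.
apply: Rs; apply: (@Rt (Z ++ T ++ X ++ U ++ Z ++ X ++ X ++ Z)).
  by apply: (fic_conv (E_dbl_r (Z ++ T) X (U ++ Z) Z)); list_eq.
by apply: (fic_conv (E_wrap (Z ++ T ++ X ++ U) Z X [::])); list_eq.
Qed.

Lemma E_dup1' : holds R (flip p_dup1).
Proof.
name_words X Z T U.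
apply: (@Rt (Z ++ Z ++ X ++ X ++ U ++ Z ++ T ++ X)).
  apply: (@Rt (Z ++ Z ++ X ++ U ++ Z ++ T ++ X)).
    by apply: (fic_conv (E_dbl_l [::] Z (X ++ U) (T ++ X))); list_eq.
  by apply: (fic_conv (E_dbl_l (Z ++ Z) X (U ++ Z ++ T) [::])); list_eq.
apply: Rs; apply: (@Rt (Z ++ X ++ X ++ Z ++ U ++ Z ++ T ++ X)).
  by apply: (fic_conv (E_dbl_l Z X (Z ++ U ++ Z ++ T) [::])); list_eq.
by apply: (fic_conv (E_wrap [::] Z X (U ++ Z ++ T ++ X))); list_eq.
Qed.

Lemma E_dup2' : holds R (flip p_dup2).
Proof.
name_words X Z T U.
apply: (@Rt (Z ++ Z ++ X ++ X ++ U ++ X ++ T ++ Z)).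
  apply: (@Rt (Z ++ Z ++ X ++ U ++ X ++ T ++ Z)).
    by apply: (fic_conv (E_dbl_l [::] Z (X ++ U ++ X ++ T) [::])); list_eq.
  by apply: (fic_conv (E_dbl_l (Z ++ Z) X U (T ++ Z))); list_eq.
apply: Rs; apply: (@Rt (Z ++ X ++ X ++ Z ++ U ++ X ++ T ++ Z)).
  by apply: (fic_conv (E_dbl_l Z X (Z ++ U) (T ++ Z))); list_eq.
by apply: (fic_conv (E_wrap [::] Z X (U ++ X ++ T ++ Z))); list_eq.
Qed.

Lemma E_inner (X T U : word) :
  R (X ++ T ++ T ++ X ++ U ++ U ++ X) (X ++ T ++ T ++ U ++ U ++ X).
Proof.
have H : R (X ++ T ++ T ++ U ++ U ++ X) (X ++ X ++ T ++ T ++ U ++ U).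
  apply: (@Rt (X ++ T ++ U ++ T ++ U ++ X)).
    by apply: (fic_conv (E_blocks X T U X)); list_eq.
  apply: (@Rt (X ++ X ++ T ++ U ++ T ++ U)).
    by apply: (fic_conv (E_wrap [::] X (T ++ U) [::])); list_eq.
  by apply: Rs; apply: (fic_conv (E_blocks (X ++ X) T U [::])); list_eq.
apply: Rt _ (Rs H); apply: (@Rt (X ++ X ++ T ++ T ++ U ++ U ++ X)).
  exact: (E_wrap [::] X T (U ++ U ++ X)).
apply: (@Rt (X ++ X ++ X ++ T ++ T ++ U ++ U)).
  by apply: (fic_step HR H (p := X) (q := [::])); list_eq.
by apply: Rs; apply: (fic_conv (E_dbl_r [::] X [::] (T ++ T ++ U ++ U))); list_eq.
Qed.

Lemma E_mid : holds R p_mid.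
Proof. by move=> ws; apply: (fic_conv (E_inner _ _ _)); list_eq. Qed.

Lemma E_mid' : holds R (flip p_mid).
Proof. by move=> ws; apply: (fic_conv (E_inner _ _ _)); list_eq. Qed.

Lemma E_firsts' : holds R (flip p_firsts).
Proof.
name_words X Y T U.
apply: (@Rt (Y ++ U ++ X ++ T ++ Y ++ Y ++ X ++ X)).
  apply: (@Rt (Y ++ U ++ X ++ T ++ Y ++ Y ++ X)).
    by apply: (fic_conv (E_dbl_r [::] Y (U ++ X ++ T) X)); list_eq.
  by apply: (fic_conv (E_dbl_r (Y ++ U) X (T ++ Y ++ Y) [::])); list_eq.
apply: (@Rt (Y ++ U ++ X ++ T ++ X ++ X ++ Y ++ Y)).
  by apply: (fic_conv (E_swap [::] Y U X T [::])); list_eq.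
apply: Rs; apply: (@Rt (Y ++ U ++ X ++ T ++ X ++ X ++ Y)).
  by apply: (fic_conv (E_dbl_r (Y ++ U) X T Y)); list_eq.
by apply: (fic_conv (E_dbl_r [::] Y (U ++ X ++ T ++ X ++ X) [::])); list_eq.
Qed.

Lemma E_first' : holds R (flip p_first).
Proof.
name_words X Y T U.
apply: (@Rt (Y ++ U ++ X ++ X ++ Y ++ Y ++ T ++ X)).
  apply: (@Rt (Y ++ U ++ X ++ Y ++ Y ++ T ++ X)).
    by apply: (fic_conv (E_dbl_r [::] Y (U ++ X) (T ++ X))); list_eq.
  by apply: (fic_conv (E_dbl_l (Y ++ U) X (Y ++ Y ++ T) [::])); list_eq.
apply: Rs; apply: (@Rt (Y ++ U ++ X ++ Y ++ Y ++ X ++ T ++ X)).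
  by apply: (fic_conv (E_dbl_r [::] Y (U ++ X) (X ++ T ++ X))); list_eq.
by apply: (fic_conv (E_wrap (Y ++ U) X Y (T ++ X))); list_eq.
Qed.

Lemma E_based : based R.
Proof.
split=> // e; rewrite /base !inE.
repeat (case/orP); move/eqP=> ->; [exact: E1|exact: E_sqr'|exact: E_dup1|exact: E_dup2
 |exact: E_dup1'|exact: E_dup2'|exact: E_mid|exact: E_mid'].
Qed.

Lemma E_good : good R.
Proof. by split; [exact: E_based|apply: (inner_of_star E_based E_star)]. Qed.
End TheoryE.

Section ItemConsequences.
Variables (S : word -> word -> Prop) (HS : based S).
Let Rt := fic_trans HS.
Let Rs := fic_sym HS.

Lemma dbl_r (p X T q : word) : S (p ++ X ++ T ++ X ++ q) (p ++ X ++ T ++ X ++ X ++ q).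
Proof.
have H := based_holds HS (e := p_sqr) isT.
by apply: (rewrite_at HS (ws := [:: X; [::]; T]) (p := p) (q := q) H); list_eq.
Qed.

Lemma dbl_l (p X T q : word) : S (p ++ X ++ T ++ X ++ q) (p ++ X ++ X ++ T ++ X ++ q).
Proof.
have H := based_holds HS (e := flip p_sqr) isT.
by apply: (rewrite_at HS (ws := [:: X; [::]; T]) (p := p) (q := q) H); list_eq.
Qed.

(** Each of these identities lets a copy of x be inserted in front of
y, given the occurrences of x on both sides; for [p_comm] and [p_firsts] the
first of two copies of x is moved over y. *)
Lemma first_of_items e :
  e \in [:: p_triv; p_band; p_comm; p_fill; p_before; flip p_before; p_firsts; p_first] ->
  holds S e -> holds S p_first.
Proof.
rewrite !inE => /or4P[/eqP->|/eqP->|/eqP->|]; last move/or4P=> [/eqP->|/eqP->|/eqP->|];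
  last case/orP=> /eqP->; move=> H ws;
  set X := nth [::] ws 0; set Y := nth [::] ws 1;
  set T := nth [::] ws 2; set U := nth [::] ws 3.
- exact: (all_trivial HS).
- have B (p A q : word) : S (p ++ A ++ q) (p ++ A ++ A ++ q).
    by apply: (rewrite_at HS (ws := [:: A]) (p := p) (q := q) H); list_eq.
  apply: (@Rt (X ++ T ++ T ++ Y ++ Y ++ X ++ U ++ Y)).
    apply: (@Rt (X ++ T ++ T ++ Y ++ X ++ U ++ Y)).
      by apply: (fic_conv (B X T (Y ++ X ++ U ++ Y))); list_eq.
    by apply: (fic_conv (B (X ++ T ++ T) Y (X ++ U ++ Y))); list_eq.
  apply: (@Rt (X ++ T ++ T ++ X ++ Y ++ Y ++ X ++ U ++ Y)).
    have M := based_holds HS (e := p_mid) isT.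
    by apply: (rewrite_back HS (ws := [:: X; [::]; T; Y]) (p := [::]) (q := U ++ Y) M); list_eq.
  apply: Rs; apply: (@Rt (X ++ T ++ T ++ X ++ Y ++ X ++ U ++ Y)).
    by apply: (fic_conv (B X T (X ++ Y ++ X ++ U ++ Y))); list_eq.
  by apply: (fic_conv (B (X ++ T ++ T ++ X) Y (X ++ U ++ Y))); list_eq.
- apply: (@Rt (X ++ T ++ Y ++ X ++ X ++ U ++ Y)).
    by apply: (fic_conv (dbl_r [::] X (T ++ Y) (U ++ Y))); list_eq.
  by apply: (rewrite_at HS (ws := [:: Y; X]) (p := X ++ T) (q := X ++ U ++ Y) H); list_eq.
- by apply: (rewrite_at HS (ws := [:: X; [::]; T; Y]) (p := [::]) (q := U ++ Y) H); list_eq.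
- apply: (@Rt (X ++ T ++ Y ++ X ++ X ++ U ++ Y)).
    by apply: (fic_conv (dbl_r [::] X (T ++ Y) (U ++ Y))); list_eq.
  apply: (@Rt (X ++ T ++ X ++ Y ++ X ++ X ++ U ++ Y)).
    by apply: (rewrite_at HS (ws := [:: X; [::]; Y; [::]]) (p := X ++ T) (q := U ++ Y) H); list_eq.
  by apply: Rs; apply: (fic_conv (dbl_r [::] X (T ++ X ++ Y) (U ++ Y))); list_eq.
- apply: (@Rt (X ++ X ++ T ++ Y ++ X ++ U ++ Y)).
    by apply: (fic_conv (dbl_l [::] X (T ++ Y) (U ++ Y))); list_eq.
  apply: (@Rt (X ++ X ++ T ++ X ++ Y ++ X ++ U ++ Y)).
    by apply: (rewrite_at HS (ws := [:: X; [::]; T; [::]]) (p := [::])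
      (q := Y ++ X ++ U ++ Y) H); list_eq.
  by apply: Rs; apply: (fic_conv (dbl_l [::] X T (Y ++ X ++ U ++ Y))); list_eq.
- apply: (@Rt (X ++ T ++ Y ++ X ++ X ++ U ++ Y)).
    by apply: (fic_conv (dbl_r [::] X (T ++ Y) (U ++ Y))); list_eq.
  by apply: (rewrite_back HS (ws := [:: X; Y; [::]; U]) (p := X ++ T) (q := [::]) H); list_eq.
exact: H.
Qed.

Lemma star_of_items e :
  e \in [:: p_triv; p_band; p_comm; p_before; flip p_before; p_star] ->
  holds S e -> holds S p_star.
Proof.
rewrite !inE => /or4P[/eqP->|/eqP->|/eqP->|]; last case/or3P=> /eqP->; move=> H ws;
  set X := nth [::] ws 0; set Y := nth [::] ws 1.
- exact: (all_trivial HS).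
- have B (p A q : word) : S (p ++ A ++ A ++ q) (p ++ A ++ q).
    by apply: (rewrite_back HS (ws := [:: A]) (p := p) (q := q) H); list_eq.
  apply: (@Rt (X ++ Y ++ Y)); first by apply: (fic_conv (B [::] X (Y ++ Y))); list_eq.
  apply: (@Rt (X ++ Y)); first by apply: (fic_conv (B X Y [::])); list_eq.
  by apply: Rs; apply: (fic_conv (B [::] (X ++ Y) [::])); list_eq.
- by apply: (rewrite_at HS (ws := [:: X; Y]) (p := X) (q := Y) H); list_eq.
- apply: (@Rt (X ++ X ++ X ++ Y ++ Y)).
    by apply: (fic_conv (dbl_r [::] X [::] (Y ++ Y))); list_eq.
  apply: (@Rt (X ++ Y ++ X ++ X ++ Y ++ Y)).
    by apply: (rewrite_at HS (ws := [:: Y; [::]; X ++ X; [::]]) (p := X) (q := [::]) H); list_eq.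
  apply: (@Rt (X ++ Y ++ X ++ Y ++ Y)).
    by apply: Rs; apply: (fic_conv (dbl_r [::] X Y (Y ++ Y))); list_eq.
  by apply: Rs; apply: (fic_conv (dbl_r X Y X [::])); list_eq.
- apply: (@Rt (X ++ X ++ Y ++ Y ++ Y)).
    by apply: (fic_conv (dbl_r (X ++ X) Y [::] [::])); list_eq.
  apply: (@Rt (X ++ X ++ Y ++ Y ++ X ++ Y)).
    by apply: (rewrite_at HS (ws := [:: X; [::]; Y ++ Y; [::]]) (p := [::]) (q := Y) H); list_eq.
  apply: (@Rt (X ++ Y ++ Y ++ X ++ Y)).
    by apply: Rs; apply: (fic_conv (dbl_l [::] X (Y ++ Y) Y)); list_eq.
  by apply: Rs; apply: (fic_conv (dbl_l X Y X [::])); list_eq.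
exact: H.
Qed.
End ItemConsequences.

(** * Identities of classes of monoids *)

Local Open Scope group_scope.

Lemma eval_cat (M : monoidType) (f : letter -> M) u v :
  eval f (u ++ v) = eval f u * eval f v.
Proof. by rewrite /eval big_cat. Qed.

Lemma eval_cons (M : monoidType) (f : letter -> M) a u :
  eval f (a :: u) = f a * eval f u.
Proof. by rewrite /eval big_cons. Qed.

Lemma eval_nil (M : monoidType) (f : letter -> M) : eval f [::] = 1.
Proof. by rewrite /eval big_nil. Qed.

Lemma eval_subst (M : monoidType) (f : letter -> M) g u :
  eval f (subst g u) = eval (fun a => eval f (g a)) u.
Proof.
by elim: u => [|a u IH]; rewrite ?eval_nil // subst_cons eval_cat IH eval_cons.
Qed.

Lemma eval_hom (M N : monoidType) (h : M -> N) (f : letter -> M) u :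
  monoid_morphism h -> h (eval f u) = eval (h \o f) u.
Proof.
by case=> h1 hM; elim: u => [|a u IH]; rewrite ?eval_nil // !eval_cons hM IH.
Qed.

Definition Id (K : mclass) (u v : word) : Prop :=
  forall M, K M -> satisfies M (u, v).

Lemma fic_Id K : fic (Id K).
Proof.
split.
- by [].
- by move=> u v uv M KM f; rewrite -(uv M KM f).
- by move=> v u w uv vw M KM f; rewrite (uv M KM f) (vw M KM f).
- by move=> p q u v uv M KM f; rewrite /= !eval_cat (uv M KM f).
by move=> g u v uv M KM f; rewrite /= !eval_subst; apply: uv.
Qed.

Lemma eval_inst (M : monoidType) (f : letter -> M) ws P :
  eval f (inst ws P) = \big[mul/1]_(i <- P) eval f (nth [::] ws i).
Proof.
elim: P => [|i P IH]; first by rewrite eval_nil big_nil.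
by rewrite big_cons -IH -eval_cat.
Qed.

Definition identity_of (e : pattern) : identity :=
  (map (pair 0) e.1 : word, map (pair 0) e.2 : word).

Lemma holds_identity (R : word -> word -> Prop) e : fic R ->
  R (identity_of e).1 (identity_of e).2 -> holds R e.
Proof.
move=> HR H ws; pose f (a : letter) := nth [::] ws a.2.
have E P : inst ws P = subst f (map (pair 0) P : word).
  by rewrite /inst /subst -map_comp.
by rewrite !E; apply: fic_subst.
Qed.

Lemma identity_holds (R : word -> word -> Prop) e :
  holds R e -> R (identity_of e).1 (identity_of e).2.
Proof.
move=> H; have := H [seq [:: (0, i)] | i <- iota 0 (\max_(i <- e.1 ++ e.2) i).+1].
have E P : {subset P <= e.1 ++ e.2} ->
    inst [seq [:: (0, i)] | i <- iota 0 (\max_(i <- e.1 ++ e.2) i).+1] P =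
    (map (pair 0) P : word).
  move=> sP; rewrite /inst -[RHS]flatten_seq1 -map_comp; congr flatten.
  apply/eq_in_map => i /sP iP; have ilt : (i < (\max_(i <- e.1 ++ e.2) i).+1)%N.
    by rewrite ltnS; apply: leq_bigmax_seq.
  by rewrite (nth_map 0) ?size_iota // nth_iota.
by rewrite !E // => i ie; rewrite mem_cat ie ?orbT.
Qed.

Lemma variety_satisfies (e : identity) : variety (satisfies^~ e).
Proof.
case: e => u v; split.
- move=> M N h hh hs Mu f; have /choice[g gE] : forall a, exists b, h b = f a.
    by move=> a; apply: hs.
  have -> : f = h \o g by apply: functional_extensionality_dep => a; rewrite /= gE.
  by rewrite /= -!eval_hom //; congr h; apply: Mu.
- move=> M N h hh hi Nu f; apply: hi; rewrite /= !eval_hom //; exact: Nu.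
move=> I M Mu f; apply: functional_extensionality_dep => i.
have pm : monoid_morphism (fun p : product M => p i) by [].
by rewrite /= (eval_hom f u pm) (eval_hom f v pm); apply: Mu.
Qed.

Lemma variety_smallest K : variety (smallest_variety K).
Proof.
split.
- move=> M N h hh hs KM V VV KV; have [H _ _] := VV; apply: (H M N h hh hs).
  exact: KM.
- move=> M N h hh hi KN V VV KV; have [_ H _] := VV; apply: (H M N h hh hi).
  exact: KN.
by move=> I M KM V VV KV; have [_ _ H] := VV; apply: H => i; apply: KM.
Qed.

Lemma join_l V W : subclass V (join V W).
Proof. by move=> M VM U _; apply; left. Qed.

Lemma join_r V W : subclass W (join V W).
Proof. by move=> M WM U _; apply; right. Qed.

Lemma join_sub V W U : variety U -> subclass V U -> subclass W U ->
  subclass (join V W) U.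
Proof. by move=> vU VU WU M JM; apply: (JM U vU) => N [/VU|/WU]. Qed.

Lemma Id_join V W u v : Id V u v -> Id W u v -> Id (join V W) u v.
Proof.
move=> Vuv Wuv M JM.
by apply: (JM _ (variety_satisfies (u, v))) => N [/Vuv|/Wuv].
Qed.

Lemma Id_sub V W u v : subclass V W -> Id W u v -> Id V u v.
Proof. by move=> VW Wuv M /VW; apply: Wuv. Qed.

Lemma generated_self M : generated M M. Proof. by []. Qed.

Lemma Id_generated M u v : satisfies M (u, v) -> Id (generated M) u v.
Proof. by move=> Muv N GN; apply: (GN _ (variety_satisfies (u, v)) Muv). Qed.

Section Birkhoff.
Variables (W : mclass) (VW : variety W) (M : monoidType).
Hypothesis MId : forall u v, Id W u v -> satisfies M (u, v).

Let prodM (u : seq M) : M := \big[mul/1]_(a <- u) a.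

Let separated (p : seq M * seq M) : Prop :=
  exists (N : monoidType) (g : M -> N), W N /\
    \big[mul/1]_(a <- p.1) g a <> \big[mul/1]_(a <- p.2) g a.

Lemma separate (p : seq M * seq M) : prodM p.1 <> prodM p.2 -> separated p.
Proof.
case: p => u v /= ne; pose code (a : M) : letter := (0, index a (u ++ v)).
apply: contrapT => nsep; apply: ne.
pose f (a : letter) := nth 1 (u ++ v) a.2.
have E w : {subset w <= u ++ v} -> prodM w = eval f (map code w).
  move=> sw; rewrite /prodM /eval big_map; apply: eq_big_seq => a /sw aw.
  by rewrite /f /code /= nth_index.
rewrite !E; try by move=> a aw; rewrite mem_cat aw ?orbT.
apply: (MId (u := map code u) (v := map code v)) => N WN g.
apply: contrapT => ne; apply: nsep; exists N, (g \o code); split=> //.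
by move: ne; rewrite /eval /= !big_map.
Qed.

Let I : Type := {p : seq M * seq M | prodM p.1 <> prodM p.2}.
Let sep (i : I) := cid (separate (svalP i)).
Let N (i : I) : monoidType := projT1 (sep i).
Let g (i : I) : M -> N i := projT1 (cid (projT2 (sep i))).
Let gP (i : I) : W (N i) /\ \big[mul/1]_(a <- (sval i).1) g i a
    <> \big[mul/1]_(a <- (sval i).2) g i a := projT2 (cid (projT2 (sep i))).

Let profile (u : seq M) : product N := fun i => \big[mul/1]_(a <- u) g i a.

Lemma profile_cat u v : profile (u ++ v) = profile u * profile v.
Proof. by apply: functional_extensionality_dep => i; rewrite /profile big_cat. Qed.

Lemma profile_nil : profile [::] = 1.
Proof. by apply: functional_extensionality_dep => i; rewrite /profile big_nil. Qed.

Let image_pred (x : product N) : bool := `[< exists u, profile u = x >].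
Definition image : Type := {x : product N | image_pred x}.
HB.instance Definition _ := Choice.on image.

Lemma image_word (x : image) : exists u, profile u = val x.
Proof. by have /asboolP := valP x. Qed.

Fact image_mulP (x y : image) : image_pred (val x * val y).
Proof.
have [u Hu] := image_word x; have [v Hv] := image_word y.
by apply/asboolP; exists (u ++ v); rewrite profile_cat Hu Hv.
Qed.

Fact image_oneP : image_pred 1.
Proof. by apply/asboolP; exists [::]; rewrite profile_nil. Qed.

Definition image_mul (x y : image) : image := Sub (val x * val y) (image_mulP x y).
Definition image_one : image := Sub 1 image_oneP.

Fact image_mulA : associative image_mul.
Proof. by move=> x y z; apply: val_inj; rewrite /= mulgA. Qed.
Fact image_mul1 : left_id image_one image_mul.
Proof. by move=> x; apply: val_inj; rewrite /= mul1g. Qed.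
Fact image_1mul : right_id image_one image_mul.
Proof. by move=> x; apply: val_inj; rewrite /= mulg1. Qed.

HB.instance Definition _ := isMonoid.Build image image_mulA image_mul1 image_1mul.

Lemma image_in : W image.
Proof.
have [_ sub prd] := VW; apply: (sub image (product N) val); first by split.
  exact: val_inj.
by apply: prd => i; have [] := gP i.
Qed.

Let back (x : image) : M := prodM (sval (cid (image_word x))).

Lemma profile_inj u v : profile u = profile v -> prodM u = prodM v.
Proof.
move=> Huv; apply: contrapT => ne.
have [_ /=] := gP (exist _ (u, v) ne); apply.
exact: (congr1 (fun x : product N => x (exist _ (u, v) ne)) Huv).
Qed.

Lemma backE u (x : image) : profile u = val x -> back x = prodM u.
Proof.
by move=> Hu; apply: profile_inj; rewrite Hu; case: (cid (image_word x)).
Qed.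

(** Birkhoff's theorem. Words over M whose products in M differ are
separated by an assignment in some member of W. The product of these members,
one for each such pair of words, contains the words as families of values, and
sending a family back to the product in M is well defined and onto. *)
Lemma variety_complete : W M.
Proof.
have [quo _ _] := VW; apply: (quo image M back _ _ image_in).
  split; first by rewrite (@backE [::]) ?profile_nil // /prodM big_nil.
  move=> x y; have [u Hu] := image_word x; have [v Hv] := image_word y.
  rewrite (backE Hu) (backE Hv) (@backE (u ++ v)) ?profile_cat ?Hu ?Hv //.
  by rewrite /prodM big_cat.
move=> a; have Ha : image_pred (profile [:: a]) by apply/asboolP; exists [:: a].
exists (Sub (profile [:: a]) Ha); rewrite (@backE [:: a]) // /prodM.
by rewrite big_cons big_nil mulg1.
Qed.
End Birkhoff.

Theorem birkhoff W : variety W -> eqclass W (var [set e | Id W e.1 e.2]).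
Proof.
move=> VW M; split=> [WM [u v] uv|H]; first exact: uv.
by apply: variety_complete => // u v uv; apply: (H (u, v)).
Qed.

Definition opposite (M : monoidType) : Type := M.
Section Opposite.
Variable M : monoidType.
HB.instance Definition _ := Choice.on (opposite M).
Definition opposite_mul (a b : opposite M) : opposite M := ((b : M) * (a : M)).
Definition opposite_one : opposite M := (1 : M).
Fact opposite_mulA : associative opposite_mul.
Proof. by move=> a b c; rewrite /opposite_mul mulgA. Qed.
Fact opposite_mul1 : left_id opposite_one opposite_mul.
Proof. by move=> a; rewrite /opposite_mul mulg1. Qed.
Fact opposite_1mul : right_id opposite_one opposite_mul.
Proof. by move=> a; rewrite /opposite_mul mul1g. Qed.
HB.instance Definition _ :=
  isMonoid.Build (opposite M) opposite_mulA opposite_mul1 opposite_1mul.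
End Opposite.

Lemma dual_opposite V M : V M -> dual V (opposite M).
Proof. by move=> VM; exists M, id; split=> //; exists id. Qed.

Lemma eval_anti (M N : monoidType) (h : M -> N) (f : letter -> M) u :
  h 1 = 1 -> (forall a b, h (a * b) = h b * h a) ->
  h (eval f u) = eval (h \o f) (rev u).
Proof.
move=> h1 hM; elim: u => [|a u IH]; first by rewrite !eval_nil.
by rewrite rev_cons -cats1 eval_cat !eval_cons eval_nil mulg1 hM IH.
Qed.

(** The opposite monoid is anti-isomorphic by the identity map. *)
Lemma Id_dual V u v : Id (dual V) u v <-> Id V (rev u) (rev v).
Proof.
split=> Huv M.
  move=> VM f; have := Huv _ (dual_opposite VM) f => /=.
  have E w : eval (f : letter -> opposite M) w = eval f (rev w).
    have := @eval_anti M (opposite M) id f (rev w) erefl (fun _ _ => erefl).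
    by rewrite revK => /esym.
  by rewrite !E.
case=> N [h [VN /bij_inj hI h1 hM]] f; apply: hI.
by rewrite /= !(eval_anti f _ h1 hM); apply: Huv.
Qed.

Local Close Scope group_scope.

(** * Two separating monoids and morphisms from presented semigroups *)

Local Open Scope group_scope.

Section VarietyE.
Import Letters.

Lemma Id_E1sigma2 e : e \in
  [:: ([:: x; t; x], [:: x; t; x; x]);
      ([:: x; t; x; x], [:: x; x; t; x]);
      ([:: x; y; y; x], [:: x; x; y; y]);
      ([:: x; t_ 1; y; t_ 2; x; x; y; y],
       [:: x; t_ 1; y; t_ 2; y; y; x; x])] -> Id varE1sigma2 e.1 e.2.
Proof. by case: e => u v ei M; apply. Qed.

(** The axioms are given for particular letters; [holds_letters] makes
them patterns. *)
Lemma E1sigma2_axiom (ls : seq letter) (e : pattern) :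
  uniq ls -> all (gtn (size ls)) (e.1 ++ e.2) ->
  (map (nth x ls) e.1 : word, map (nth x ls) e.2 : word) \in
  [:: ([:: x; t; x], [:: x; t; x; x]);
      ([:: x; t; x; x], [:: x; x; t; x]);
      ([:: x; y; y; x], [:: x; x; y; y]);
      ([:: x; t_ 1; y; t_ 2; x; x; y; y],
       [:: x; t_ 1; y; t_ 2; y; y; x; x])] ->
  holds (Id varE1sigma2) e.
Proof.
by move=> Uls sz /Id_E1sigma2 /=; apply: (holds_letters (fic_Id _) (d := x) Uls sz).
Qed.

Let E1 : holds (Id varE1sigma2) p_sqr.
Proof. exact: (@E1sigma2_axiom [:: x; y; t; s]). Qed.
Let E2 : holds (Id varE1sigma2) p_E2.
Proof. exact: (@E1sigma2_axiom [:: x; y; t; s]). Qed.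
Let E3 : holds (Id varE1sigma2) p_E3.
Proof. exact: (@E1sigma2_axiom [:: x; y; t; s]). Qed.
Let E4 : holds (Id varE1sigma2) p_E4.
Proof. exact: (@E1sigma2_axiom [:: x; y; t_ 1; t_ 2]). Qed.

Lemma good_E1sigma2 : good (Id varE1sigma2).
Proof. exact: (E_good (fic_Id _) E1 E2 E3 E4). Qed.

Lemma E1sigma2_items e : e \in [:: p_star; flip p_firsts; flip p_first] ->
  holds (Id varE1sigma2) e.
Proof.
rewrite !inE => /or3P[]/eqP->.
- exact: (E_star (fic_Id _) E1 E2 E3).
- exact: (E_firsts' (fic_Id _) E1 E4).
exact: (E_first' (fic_Id _) E1 E2 E3).
Qed.
End VarietyE.

(** A monoid in E^1{sigma_2} reading a word over the letters x, y, t from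
left to right: X_ and Y_ tell which of x and y came first, XY_ that it was x and
that y followed. The marker T_ must occur once, with no y before it; after it, an
x coming first leads to TX_ and a y coming first to the zero O_. *)
Inductive reader : Type := I_ | X_ | Y_ | XY_ | T_ | TX_ | O_.
HB.instance Definition _ := gen_eqMixin reader.
HB.instance Definition _ := gen_choiceMixin reader.

Definition reader_mul (a b : reader) : reader :=
  match a, b with
  | I_, _ => b
  | _, I_ => a
  | X_, X_ => X_ | X_, (Y_ | XY_) => XY_ | X_, T_ => T_ | X_, TX_ => TX_
  | Y_, (X_ | Y_ | XY_) => Y_
  | XY_, (X_ | Y_ | XY_) => XY_
  | T_, (X_ | XY_) => TX_
  | TX_, (X_ | Y_ | XY_) => TX_
  | _, _ => O_
  end.

Fact reader_mulA : associative reader_mul.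
Proof. by case; case; case. Qed.
Fact reader_mul1 : left_id I_ reader_mul.
Proof. by case. Qed.
Fact reader_1mul : right_id I_ reader_mul.
Proof. by case. Qed.
HB.instance Definition _ := isMonoid.Build reader reader_mulA reader_mul1 reader_1mul.

Lemma E1sigma2_reader : varE1sigma2 reader.
Proof.
move=> e; rewrite /= !inE => /or4P[]/eqP-> f; rewrite /= !eval_cons !eval_nil.
- by case: (f Letters.x); case: (f Letters.t).
- by case: (f Letters.x); case: (f Letters.t).
- by case: (f Letters.x); case: (f Letters.y).
case: (f Letters.x); case: (f Letters.y); case: (f (Letters.t_ 1));
  by case: (f (Letters.t_ 2)).
Qed.

Lemma Id_reader (p q : word) (f : letter -> reader) :
  Id varE1sigma2 p q -> eval f p = eval f q.
Proof. by move=> /(_ _ E1sigma2_reader f). Qed.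

(** The monoid A_0^1 by normal forms: a nonzero element is a product of
at most one b and at most one a, in this order, recorded by the presence of b and
of a. *)
Definition A01_model : Type := option (bool * bool).
HB.instance Definition _ := Choice.on A01_model.
Definition A01_model_one : A01_model := Some (false, false).
Definition A01_model_mul (p q : A01_model) : A01_model :=
  match p, q with
  | Some (b1, a1), Some (b2, a2) =>
      if a1 && b2 then None else Some (b1 || b2, a1 || a2)
  | _, _ => None
  end.
Fact A01_model_mulA : associative A01_model_mul.
Proof. by move=> [[[] []]|] [[[] []]|] [[[] []]|]. Qed.
Fact A01_model_mul1 : left_id A01_model_one A01_model_mul.
Proof. by move=> [[[] []]|]. Qed.
Fact A01_model_1mul : right_id A01_model_one A01_model_mul.
Proof. by move=> [[[] []]|]. Qed.
HB.instance Definition _ := isMonoid.Build A01_model A01_model_mulA A01_model_mul1 A01_model_1mul.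

Section Lift.
Variables (X : choiceType) (rels : seq (free0 X * free0 X)).
Variables (T : monoidType) (h : X -> T) (o : T).
Hypothesis oh : forall a, o * h a = o.
Hypothesis ho : forall a, h a * o = o.
Hypothesis oo : o * o = o.

Definition free_lift (w : free0 X) : T :=
  if w is Some (a, u) then h a * \big[mul/1]_(b <- u) h b else o.

Lemma free_lift_mul v w : free_lift (v * w) = free_lift v * free_lift w.
Proof.
have ol u : o * \big[mul/1]_(b <- u) h b = o.
  by elim: u => [|b u IH]; rewrite ?big_nil ?mulg1 // big_cons mulgA oh.
have lo u : (\big[mul/1]_(b <- u) h b) * o = o.
  by elim: u => [|b u IH]; rewrite ?big_nil ?mul1g // big_cons -mulgA IH ho.
case: v w => [[a u]|] [[b v]|] /=; rewrite ?big_cat ?big_cons ?mulgA //=.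
  by rewrite -mulgA lo ho.
by rewrite oh ol.
Qed.

Hypothesis hrels : forall r, r \in rels -> free_lift r.1 = free_lift r.2.

Lemma free_lift_congruence v w : congruence rels v w -> free_lift v = free_lift w.
Proof.
elim=> {v w} [v w /hrels //|//|v w _ -> //|v u w _ -> _ -> //|v v' w w' _ Ev _ Ew].
by rewrite !free_lift_mul Ev Ew.
Qed.

Local Open Scope quotient_scope.

Definition presented_lift (q : presented rels) : T := free_lift (repr q).

Lemma congruence_repr w : congruence rels (repr (\pi_(presented rels) w)) w.
Proof.
have : repr (\pi_(presented rels) w) = w %[mod presented rels] by rewrite reprK.
by move=> /eqmodP /asboolP.
Qed.

Lemma presented_lift_pi w : presented_lift (\pi_(presented rels) w) = free_lift w.
Proof. exact/free_lift_congruence/congruence_repr. Qed.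

Lemma presented_lift_mul (q r : presented rels) :
  presented_lift (q * r) = presented_lift q * presented_lift r.
Proof.
rewrite -[presented_lift (q * r)]/(presented_lift (presented_mul q r)).
by rewrite /presented_mul presented_lift_pi free_lift_mul.
Qed.

Definition adjoin1_lift (q : adjoin1 (presented rels)) : T :=
  if q is Some q' then presented_lift q' else 1.

Lemma adjoin1_lift_morphism : monoid_morphism adjoin1_lift.
Proof.
split=> // -[q|] [r|]; rewrite /adjoin1_lift /= ?mul1g ?mulg1 //; exact: presented_lift_mul.
Qed.
End Lift.

Local Close Scope group_scope.

(** * Identities of A_0^1 *)

Local Open Scope group_scope.

Section A0.
Local Notation a := (gen (@Ordinal 2 0 isT)).
Local Notation b := (gen (@Ordinal 2 1 isT)).
Local Notation rels :=
  [:: (a * a, a); (b * b, b); (a * b, Defs.zero)].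

Definition A01_model_gen (i : 'I_2) : A01_model :=
  if i == 0 :> nat then Some (false, true) else Some (true, false).

Definition to_A01_model : adjoin1 sgA0 -> A01_model :=
  @adjoin1_lift _ rels A01_model A01_model_gen None.

Lemma A01_model_gen_rels r : r \in rels ->
  free_lift A01_model_gen None r.1 = free_lift A01_model_gen None r.2.
Proof.
by rewrite !inE => /or3P[]/eqP->; rewrite /= !big_cons !big_nil.
Qed.

Lemma A01_model_gen0 i : A01_model_gen i * None = None.
Proof. by rewrite /A01_model_gen; case: ifP. Qed.

Lemma to_A01_model_morphism : monoid_morphism to_A01_model.
Proof. by apply: (adjoin1_lift_morphism _ A01_model_gen0 _ A01_model_gen_rels). Qed.

(** Appending a generator to one of these four elements gives one of them
again. *)
Lemma A0_normal (w : free0 'I_2) :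
  exists2 r, r \in [:: a; b; b * a; Defs.zero] & congruence rels w r.
Proof.
have red u v : (u, v) \in rels -> congruence rels u v by apply: congruence_rel.
have aa : congruence rels (a * a) a by apply: red; rewrite !inE eqxx.
have bb : congruence rels (b * b) b by apply: red; rewrite !inE eqxx ?orbT.
have ab : congruence rels (a * b) Defs.zero by apply: red; rewrite !inE eqxx ?orbT.
have step r c : r \in [:: a; b; b * a; Defs.zero] -> c \in [:: a; b] ->
    exists2 r', r' \in [:: a; b; b * a; Defs.zero] & congruence rels (r * c) r'.
  rewrite !inE => /or4P[]/eqP-> /orP[]/eqP->.
  - by exists a; rewrite ?inE ?eqxx.
  - by exists Defs.zero; rewrite ?inE ?eqxx ?orbT.
  - by exists (b * a); rewrite ?inE ?eqxx ?orbT //; apply: congruence_refl.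
  - by exists b; rewrite ?inE ?eqxx ?orbT.
  - exists (b * a); rewrite ?inE ?eqxx ?orbT // -mulgA.
    by apply: congruence_mul => //; apply: congruence_refl.
  - exists Defs.zero; rewrite ?inE ?eqxx ?orbT // -mulgA.
    by apply: (congruence_mul (congruence_refl rels b) ab).
  - by exists Defs.zero; rewrite ?inE ?eqxx ?orbT //; apply: congruence_refl.
  by exists Defs.zero; rewrite ?inE ?eqxx ?orbT //; apply: congruence_refl.
have gens (i : 'I_2) : gen i \in [:: a; b].
  case: i => -[|[|//]] lt; rewrite !inE; apply/orP; [left|right];
    by apply/eqP; congr (Some (_, _)); apply: val_inj.
case: w => [[i u]|]; last by exists Defs.zero; rewrite ?inE ?eqxx ?orbT //; apply: congruence_refl.
elim/last_ind: u => [|u j [r ri Hr]].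
  exists (gen i); last exact: congruence_refl.
  by have := gens i; rewrite !inE => /orP[]->; rewrite ?orbT.
have [r' ri' Hr'] := step r (gen j) ri (gens j).
exists r' => //; apply: (congruence_trans _ Hr').
have -> : Some (i, rcons u j) = (Some (i, u) : free0 'I_2) * gen j.
  by rewrite -cats1.
by apply: congruence_mul => //; apply: congruence_refl.
Qed.

Local Open Scope quotient_scope.

Lemma to_A01_model_inj : injective to_A01_model.
Proof.
have nf (q : sgA0) : exists2 r, r \in [:: a; b; b * a; Defs.zero] &
    q = \pi_(presented rels) r.
  elim/quotW: q => w; have [r ri wr] := A0_normal w; exists r => //.
  exact/eqmodP/asboolP.
have val q r : q = \pi_(presented rels) r -> to_A01_model (Some q) = free_lift A01_model_gen None r.
  by move=> ->; rewrite /to_A01_model /= (presented_lift_pi _ A01_model_gen0 _ A01_model_gen_rels).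
move=> [q|] [q'|] //.
- have [r + Eq] := nf q; have [r' + Eq'] := nf q'; rewrite !inE.
  rewrite (val _ _ Eq) (val _ _ Eq') Eq Eq'.
  by move=> /or4P[]/eqP-> /or4P[]/eqP->; rewrite /= ?big_cons ?big_nil.
- have [r + Eq] := nf q; rewrite (val _ _ Eq) !inE.
  by move=> /or4P[]/eqP->; rewrite /= ?big_cons ?big_nil.
have [r + Eq] := nf q'; rewrite (val _ _ Eq) !inE.
by move=> /or4P[]/eqP->; rewrite /= ?big_cons ?big_nil.
Qed.

Lemma to_A01_model_surj x : exists q, to_A01_model q = x.
Proof.
have val r : to_A01_model (Some (\pi_(presented rels) r)) = free_lift A01_model_gen None r.
  by rewrite /to_A01_model /= (presented_lift_pi _ A01_model_gen0 _ A01_model_gen_rels).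
case: x => [[[] []]|].
- by exists (Some (\pi_(presented rels) (b * a))); rewrite val /= big_cons big_nil.
- by exists (Some (\pi_(presented rels) b)); rewrite val /= big_nil.
- by exists (Some (\pi_(presented rels) a)); rewrite val /= big_nil.
- by exists None.
by exists (Some (\pi_(presented rels) Defs.zero)); rewrite val.
Qed.
End A0.

(** The map onto the concrete monoid is an isomorphism, which makes the
identities of A_0^1 decidable by inspection of five elements. *)
Lemma Id_A01 u v : Id varA01 u v <-> satisfies A01_model (u, v).
Proof.
have [quo sub _] := variety_satisfies (u, v); split=> [H|H].
  by apply: (quo _ _ _ to_A01_model_morphism to_A01_model_surj); apply: H.
by apply: Id_generated; apply: (sub _ _ _ to_A01_model_morphism to_A01_model_inj).
Qed.

Lemma holds_A01 e : (forall g : nat -> A01_model,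
    \big[mul/1]_(i <- e.1) g i = \big[mul/1]_(i <- e.2) g i) -> holds (Id varA01) e.
Proof. by move=> H ws; apply/Id_A01 => f; rewrite /= !eval_inst. Qed.

Definition A01_model_prod (vs : seq A01_model) (P : seq nat) : A01_model :=
  foldr (fun i => A01_model_mul (nth None vs i)) A01_model_one P.

Definition A01_model_elements : seq A01_model :=
  [:: None; Some (false, false); Some (false, true); Some (true, false);
      Some (true, true)].

Definition A01_model_agree (e : pattern) : bool :=
  all (fun a => all (fun b => all (fun c => all (fun d =>
    A01_model_prod [:: a; b; c; d] e.1 == A01_model_prod [:: a; b; c; d] e.2)
  A01_model_elements) A01_model_elements) A01_model_elements) A01_model_elements.

Lemma A01_model_check e : all (gtn 4) (e.1 ++ e.2) -> A01_model_agree e ->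
  holds (Id varA01) e.
Proof.
move=> /allP le4 H; apply: holds_A01 => g.
pose vs := [:: g 0%N; g 1%N; g 2%N; g 3%N].
have E P : {subset P <= e.1 ++ e.2} ->
    \big[mul/1]_(i <- P) g i = A01_model_prod vs P.
  elim: P => [|i P IH] sP; first by rewrite big_nil.
  rewrite big_cons IH => [|k kP]; last by apply: sP; rewrite inE kP orbT.
  have := le4 _ (sP i (mem_head _ _)); rewrite /= /A01_model_prod /=.
  by case: i {sP} => [|[|[|[|//]]]].
rewrite !E; try by move=> i ie; rewrite mem_cat ie ?orbT.
have mem5 (x : A01_model) : x \in A01_model_elements by case: x => [[[] []]|].
by have /allP/(_ _ (mem5 (g 0%N)))/allP/(_ _ (mem5 (g 1%N)))/allP/(_ _ (mem5 (g 2%N)))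
  /allP/(_ _ (mem5 (g 3%N)))/eqP := H.
Qed.

Lemma A01_patterns e :
  e \in base ++ [:: p_fill; p_firsts; flip p_firsts; p_first; flip p_first] ->
  holds (Id varA01) e.
Proof.
have H : all (fun e => all (gtn 4) (e.1 ++ e.2) && A01_model_agree e)
    (base ++ [:: p_fill; p_firsts; flip p_firsts; p_first; flip p_first]).
  by vm_compute.
by move=> /(allP H)/andP[]; apply: A01_model_check.
Qed.

Lemma based_A01 : based (Id varA01).
Proof.
split; first exact: fic_Id.
by move=> e eb; apply: A01_patterns; rewrite mem_cat eb.
Qed.

Lemma good_A01 : good (Id varA01).
Proof.
split; first exact: based_A01.
apply: inner_of_first; first exact: based_A01.
by apply: A01_patterns; rewrite mem_cat !inE !eqxx ?orbT.
Qed.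

Lemma Id_A01_eval (f : letter -> A01_model) u v : Id varA01 u v -> eval f u = eval f v.
Proof. by move=> /Id_A01/(_ f). Qed.

Lemma A01_model_one_mul (x : A01_model) : A01_model_one * x = x.
Proof. exact: mul1g. Qed.

Lemma A01_mem u v : Id varA01 u v -> u =i v.
Proof.
move=> uv c; pose f d : A01_model := if d == c then Some (false, true) else A01_model_one.
have fE d : f d = if d == c then Some (false, true) else A01_model_one by [].
have E (w : word) : (c \in w) = (eval f w != A01_model_one).
  elim: w => [|d w IH]; first by rewrite eval_nil.
  rewrite eval_cons inE IH eq_sym fE; case: eqP => _; last by rewrite orFb A01_model_one_mul.
  by case: (eval _ w) => [[[] []]|].
by rewrite !E (Id_A01_eval _ uv).
Qed.

(** A_0^1 detects that c occurs before d: send c to a and d to b, or c to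
ba when c = d, and look for zero. *)
Lemma A01_subseq u v c d : Id varA01 u v ->
  subseq [:: c; d] u = subseq [:: c; d] v.
Proof.
move=> uv; have [<-|cd] := eqVneq c d.
  pose f e : A01_model := if e == c then Some (true, true) else A01_model_one.
  have fE e : f e = if e == c then Some (true, true) else A01_model_one by [].
  have E (w : word) : eval f w = if c \in w then
      (if subseq [:: c; c] w then None else Some (true, true)) else A01_model_one.
    elim: w => [|e w IH]; first by rewrite eval_nil.
    rewrite eval_cons inE IH /= [c == e]eq_sym fE; case: eqP => _.
      by rewrite sub1seq; case: (c \in w) => //; case: (subseq _ w).
    by rewrite A01_model_one_mul.
  have {}E (w : word) : subseq [:: c; c] w = (eval f w == None).
    rewrite E; case: ifP => [|/negbT cw]; first by case: (subseq _ w).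
    by apply/negP => /mem_subseq/(_ c (mem_head _ _)); rewrite (negbTE cw).
  by rewrite !E (Id_A01_eval _ uv).
pose f e : A01_model :=
  if e == c then Some (false, true) else if e == d then Some (true, false) else A01_model_one.
have fE e : f e = if e == c then Some (false, true)
  else if e == d then Some (true, false) else A01_model_one by [].
have E (w : word) : eval f w =
    if subseq [:: c; d] w then None else Some (d \in w, c \in w).
  elim: w => [|e w IH]; first by rewrite eval_nil.
  rewrite eval_cons !inE IH /= [c == e]eq_sym [d == e]eq_sym fE.
  have [->|ec] := eqVneq e c.
    rewrite (negbTE cd) sub1seq /=; case dw: (d \in w) => //=.
      by case: (subseq _ w).
    case: ifP => // /mem_subseq/(_ d).
    by rewrite !inE eqxx orbT dw => /(_ isT).
  have [_|ed] := eqVneq e d; last by rewrite A01_model_one_mul.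
  by case: (subseq _ w).
have {}E (w : word) : subseq [:: c; d] w = (eval f w == None).
  by rewrite E; case: (subseq _ w).
by rewrite !E (Id_A01_eval _ uv).
Qed.

Local Close Scope group_scope.

(** * Syntactic monoids *)

Section Syntactic.
Variable L : word -> Prop.

Definition interchangeable (u v : word) : Prop :=
  forall p q, L (p ++ u ++ q) <-> L (p ++ v ++ q).
Definition interchangeableb : rel word := fun u v => `[< interchangeable u v >].

Fact interchangeableb_refl : reflexive interchangeableb.
Proof. by move=> u; apply/asboolP. Qed.
Fact interchangeableb_sym : symmetric interchangeableb.
Proof. by move=> u v; apply/asboolP/asboolP => H p q; rewrite H. Qed.
Fact interchangeableb_trans : transitive interchangeableb.
Proof.
by move=> v u w /asboolP uv /asboolP vw; apply/asboolP => p q; rewrite uv vw.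
Qed.

Canonical interchangeable_equiv := EquivRel interchangeableb
  interchangeableb_refl interchangeableb_sym interchangeableb_trans.

Local Open Scope quotient_scope.

(** The quotient by the largest congruence saturating L: its identities are
the pairs of words that may be exchanged under every substitution without
affecting membership in L. *)
Definition syntactic : Type := {eq_quot interchangeableb}.
HB.instance Definition _ := EqQuotient.on syntactic.
HB.instance Definition _ := Choice.on syntactic.

Lemma syntactic_eq u v : \pi_syntactic u = \pi_syntactic v <-> interchangeable u v.
Proof. by split=> [/eqmodP/asboolP|uv]; last apply/eqmodP/asboolP. Qed.

Definition syntactic_mul (x y : syntactic) : syntactic :=
  \pi_syntactic (repr x ++ repr y).
Definition syntactic_one : syntactic := \pi_syntactic [::].

Lemma syntactic_piM u v :
  syntactic_mul (\pi_syntactic u) (\pi_syntactic v) = \pi_syntactic (u ++ v).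
Proof.
have reprP w : interchangeable (repr (\pi_syntactic w)) w.
  by apply/syntactic_eq; rewrite reprK.
by apply/syntactic_eq => p q; rewrite -!catA reprP catA reprP -catA.
Qed.

Fact syntactic_mulA : associative syntactic_mul.
Proof.
elim/quotW=> u; elim/quotW=> v; elim/quotW=> w.
rewrite (syntactic_piM v w) (syntactic_piM u v).
by rewrite (syntactic_piM u (v ++ w)) (syntactic_piM (u ++ v) w) catA.
Qed.
Fact syntactic_mul1 : left_id syntactic_one syntactic_mul.
Proof. by elim/quotW=> u; apply: (syntactic_piM [::] u). Qed.
Fact syntactic_1mul : right_id syntactic_one syntactic_mul.
Proof. by elim/quotW=> u; rewrite (syntactic_piM u [::]) cats0. Qed.

HB.instance Definition _ :=
  isMonoid.Build syntactic syntactic_mulA syntactic_mul1 syntactic_1mul.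

Lemma eval_syntactic (f : letter -> word) u :
  eval (fun a => \pi_syntactic (f a)) u = \pi_syntactic (subst f u).
Proof.
elim: u => [|a u IH]; first by rewrite eval_nil.
by rewrite eval_cons IH subst_cons -syntactic_piM.
Qed.

Lemma syntactic_satisfies u v :
  (forall f, interchangeable (subst f u) (subst f v)) -> satisfies syntactic (u, v).
Proof.
move=> H f; have -> : f = fun a => \pi_syntactic (repr (f a)).
  by apply: functional_extensionality_dep => a; rewrite reprK.
by rewrite /= !eval_syntactic; apply/syntactic_eq.
Qed.

Lemma satisfies_syntactic u v : satisfies syntactic (u, v) -> interchangeable u v.
Proof.
move=> /(_ (fun a => \pi_syntactic [:: a])); rewrite /= !eval_syntactic.
have E w : subst (fun a => [:: a]) w = w by elim: w => //= a w {2}<-.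
by rewrite !E => /syntactic_eq.
Qed.
End Syntactic.

Definition first2 (c z : letter) (w : word) : option letter :=
  ohead (filter (mem [:: c; z]) w).

Lemma first2_cat c z u v : first2 c z (u ++ v) =
  if first2 c z u is Some e then Some e else first2 c z v.
Proof. by rewrite /first2 filter_cat; case: (filter _ u). Qed.

Lemma first2_mem c z w e : first2 c z w = Some e ->
  (e = c \/ e = z) /\ exists w1 w2, [/\ w = w1 ++ e :: w2, c \notin w1 & z \notin w1].
Proof.
elim: w => // a w IH; rewrite /first2 /= !inE.
have [->|ac] := eqVneq a c.
  by move=> [<-]; split; [left|exists [::], w].
have [->|az] := eqVneq a z.
  by move=> [<-]; split; [right|exists [::], w].
case/IH=> ez [w1 [w2 [-> cw1 zw1]]]; split=> //; exists (a :: w1), w2.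
by rewrite !inE !negb_or (eq_sym c) ac (eq_sym z) az.
Qed.

Lemma first2_z c z w1 w2 : c \notin w1 -> first2 c z (w1 ++ z :: w2) = Some z.
Proof.
move=> cw1; rewrite first2_cat; case E : (first2 c z w1) => [e|]; last first.
  by rewrite /first2 /= !inE eqxx orbT.
have [[ec|-> //] [u1 [u2 [Ew _ _]]]] := first2_mem E.
by move: cw1; rewrite Ew ec mem_cat mem_head orbT.
Qed.

Section FirstTransfer.
Variables (phi : letter -> word) (c z : letter).

Let kind (w : word) : reader :=
  match first2 c z w with
  | Some e => if e == z then X_ else Y_
  | None => I_
  end.

Lemma eval_kind (f : letter -> reader) w : {in w, forall v, f v = kind (phi v)} ->
  match first2 c z (subst phi w) with
  | Some e => if e == z then eval f w = X_ \/ eval f w = XY_ else eval f w = Y_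
  | None => eval f w = I_
  end.
Proof.
elim: w => [|v w IH] Hf; first by rewrite /= eval_nil.
rewrite subst_cons first2_cat eval_cons Hf ?mem_head // /kind.
have {IH} := IH (fun u uw => Hf u (mem_behead (uw : u \in behead (v :: w)))).
case: (first2 c z (phi v)) => [e|]; case: (first2 c z (subst phi w)) => [e'|].
- by case: (e' == z); case: (e == z);
    [case=> ->; [left|right]|case=> ->|move=> ->; right|move=> ->].
- by case: (e == z) => ->; [left|].
- by case: (e' == z); [case=> ->; [left|right]|move=> ->].
by move=> ->.
Qed.

(** Substitutions are composed with an evaluation in [reader] that sends
z to x and c to y; identities of E^1{sigma_2} therefore preserve whether z comes
before every c. *)
Lemma first2_transfer p q : Id varE1sigma2 p q ->
  first2 c z (subst phi p) != Some z -> first2 c z (subst phi q) != Some z.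
Proof.
move=> pq; have E := Id_reader (kind \o phi) pq.
have := @eval_kind (kind \o phi) p (fun _ _ => erefl).
have := @eval_kind (kind \o phi) q (fun _ _ => erefl).
rewrite E; case: (first2 c z (subst phi q)) => // e; case: eqP => [->|ne] H; last first.
  by move=> _ _; apply/eqP => -[].
by case: (first2 c z _) => [e'|]; [case: eqP => [->|ne] //|]; case: H => ->.
Qed.

(** The same for the part after a linear letter tau of the
identity, provided that c is absent from the part before tau: the marker T_
restarts the reading. *)
Lemma first2_transfer_after p1 p2 q1 q2 tau :
  Id varE1sigma2 (p1 ++ tau :: p2) (q1 ++ tau :: q2) ->
  tau \notin p1 ++ p2 -> tau \notin q1 ++ q2 ->
  c \notin subst phi p1 -> c \notin subst phi q1 ->
  first2 c z (subst phi p2) != Some z -> first2 c z (subst phi q2) != Some z.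
Proof.
rewrite !mem_cat !negb_or => pq /andP[tp1 tp2] /andP[tq1 tq2] cp1 cq1.
pose f v := if v == tau then T_ else kind (phi v).
have fk (w : word) : tau \notin w -> {in w, forall v, f v = kind (phi v)}.
  by move=> tw v vw; rewrite /f; case: eqP => // vt; rewrite -vt vw in tw.
have ev1 (w : word) : c \notin subst phi w -> tau \notin w -> eval f w = I_ \/ eval f w = X_.
  move=> cw tw; elim: w cw tw => [|v w IH]; first by left; rewrite eval_nil.
  rewrite subst_cons mem_cat inE !negb_or eval_cons => /andP[cv cw] /andP[tv tw].
  have -> : f v = kind (phi v) by rewrite /f eq_sym (negbTE tv).
  have Hv : kind (phi v) = I_ \/ kind (phi v) = X_.
    rewrite /kind; case E : (first2 c z _) => [e|]; last by left.
    right; have [[ec|->] [w1 [w2 [Ew _ _]]]] := first2_mem E; last by rewrite eqxx.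
    by move: cv; rewrite Ew ec mem_cat mem_head orbT.
  by case: (IH cw tw) => ->; case: Hv => ->; [left|right|right|right].
have := Id_reader f pq; rewrite !eval_cat !eval_cons.
have -> : f tau = T_ by rewrite /f eqxx.
have := eval_kind (fk _ tp2); have := eval_kind (fk _ tq2).
case: (first2 c z (subst phi q2)) => // e; case: eqP => [->|ne]; last first.
  by move=> *; apply/eqP => -[].
move=> Hq2; case: (first2 c z (subst phi p2)) => [e'|];
  [case: eqP => [->//|_]|]; move=> Hp2;
  case: (ev1 _ cp1 tp1) => ->; case: (ev1 _ cq1 tq1) => ->;
  by rewrite Hp2; case: Hq2 => ->.
Qed.
End FirstTransfer.

Lemma subst_rev (phi : letter -> word) u :
  subst (rev \o phi) (rev u) = rev (subst phi u).
Proof.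
elim: u => // a u IH.
by rewrite rev_cons -cats1 subst_cat IH subst_cons rev_cat /subst /= cats0.
Qed.

Lemma mem_subst (phi : letter -> word) u x :
  reflect (exists2 v, v \in u & x \in phi v) (x \in subst phi u).
Proof.
apply: (iffP flattenP) => [[w /mapP[v vu ->] xw]|[v vu xv]]; first by exists v.
by exists (phi v) => //; apply: map_f.
Qed.

Lemma mem_subst_eq (phi : letter -> word) u v : u =i v -> subst phi u =i subst phi v.
Proof.
by move=> uv x; apply/mem_subst/mem_subst => -[y yu xy]; exists y; rewrite // ?uv // -uv.
Qed.

Lemma cat_split (T : Type) (s1 s2 w1 w2 : seq T) x : s1 ++ s2 = w1 ++ x :: w2 ->
  (exists t, s1 = w1 ++ x :: t /\ w2 = t ++ s2) \/
  (exists t, s2 = t ++ x :: w2 /\ w1 = s1 ++ t).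
Proof.
elim: s1 w1 => [|a s1 IH] [|b w1] /=.
- by move=> ->; right; exists [::].
- by move=> ->; right; exists (b :: w1).
- by move=> [-> <-]; left; exists s1.
case=> -> /IH[[t [-> ->]]|[t [-> ->]]]; first by left; exists t.
by right; exists t.
Qed.

Lemma subst_split (phi : letter -> word) p l r : subst phi p = l ++ r ->
  (exists p1 p2, [/\ p = p1 ++ p2, l = subst phi p1 & r = subst phi p2]) \/
  (exists p1 tau p2 f g, [/\ p = p1 ++ tau :: p2, phi tau = f ++ g,
    f != [::], g != [::] & l = subst phi p1 ++ f /\ r = g ++ subst phi p2]).
Proof.
elim: p l => [|v p IH] l.
  case: l => [|//]; case: r => [|//] _; left; exists [::], [::]; by [].
rewrite subst_cons => E.
have [le|lt] := leqP (size (phi v)) (size l).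
  have El : l = phi v ++ drop (size (phi v)) l.
    have := congr1 (take (size (phi v))) E; rewrite take_size_cat // takel_cat //.
    by move=> {1}->; rewrite cat_take_drop.
  have Er : subst phi p = drop (size (phi v)) l ++ r.
    have : phi v ++ subst phi p == phi v ++ (drop (size (phi v)) l ++ r).
      by rewrite E catA -El.
    by rewrite eqseq_cat // eqxx => /eqP.
  have [[p1 [p2 [-> El' ->]]]|[p1 [tau [p2 [f [g [-> Et f0 g0 [El' ->]]]]]]]] := IH _ Er.
    by left; exists (v :: p1), p2; rewrite subst_cons -El' -El.
  by right; exists (v :: p1), tau, p2, f, g; rewrite subst_cons -catA -El' -El.
have Ev : phi v = l ++ drop (size l) (phi v).
  have := congr1 (take (size l)) E; rewrite takel_cat ?(ltnW lt) // take_size_cat //.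
  by move=> {1}<-; rewrite cat_take_drop.
have Er : r = drop (size l) (phi v) ++ subst phi p.
  by have := congr1 (drop (size l)) E; rewrite drop_cat lt drop_size_cat //.
have [l0|l0] := eqVneq l [::].
  by left; exists [::], (v :: p); rewrite subst_cons Er Ev l0 drop0.
right; exists [::], v, p, l, (drop (size l) (phi v)); split=> //.
by rewrite -size_eq0 size_drop subn_eq0 -ltnNge.
Qed.

(** * Absence of a finite basis *)

Definition zed : letter := (0, 0).
Definition alpha (i : nat) : letter := (1, i).

Definition squares (s : seq nat) : word := flatten [seq [:: alpha i; alpha i] | i <- s].

Definition clean_word n : word := zed :: squares (iota 0 n.+1) ++ [:: zed].

Definition cut_word n : word :=
  zed :: alpha 0 :: alpha 0 :: zed :: squares (iota 1 n) ++ [:: zed].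

(** The property that a short identity cannot destroy. Write z for [zed] and
a_i for [alpha i]. The first three clauses say that the word is a shuffle of
occurrences of z with nonempty powers of a_0, ..., a_n in this order; by the last
one each z is followed by some a_0 or preceded by some a_n. *)
Definition uncut n (w : word) : Prop :=
  [/\ {in w, forall x, x = zed \/ exists2 i, i <= n & x = alpha i},
      forall i, i <= n -> alpha i \in w,
      forall i j, i < j <= n -> ~~ subseq [:: alpha j; alpha i] w
    & forall w1 w2, w = w1 ++ zed :: w2 -> alpha 0 \in w2 \/ alpha n \in w1].

Lemma subseq_pair (T : eqType) (a b : T) (s1 s2 : seq T) :
  a \in s1 -> b \in s2 -> subseq [:: a; b] (s1 ++ s2).
Proof.
by move=> as1 bs2; rewrite -[[:: a; b]]/([:: a] ++ [:: b]) cat_subseq // sub1seq.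
Qed.

Lemma alpha_inj : injective alpha. Proof. by move=> i j []. Qed.

Section Preserved.
Variables (n : nat) (A B : word) (phi : letter -> word) (p q : word).
Hypothesis Qw : uncut n (A ++ subst phi p ++ B).
Hypothesis pqA : Id varA01 p q.
Hypothesis pqE : Id varE1sigma2 p q.
Hypothesis pqE' : Id varE1sigma2 (rev p) (rev q).
Hypothesis small : size p < n.

Let w := A ++ subst phi p ++ B.

Let no_back i j (s1 s2 : word) : i < j <= n -> w = s1 ++ s2 ->
  alpha j \in s1 -> alpha i \in s2 -> False.
Proof.
move=> ij Ew js is_; have [_ _ /(_ _ _ ij)/negP Q _] := Qw.
by apply: Q; rewrite -/w Ew subseq_pair.
Qed.

Let barrier (s1 s2 : word) : w = s1 ++ zed :: s2 ->
  alpha 0 \in s2 \/ alpha n \in s1.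
Proof. by have [_ _ _] := Qw; apply. Qed.

(** Suppose that the image of q has a z followed by no a_0 and preceded by no
a_n. *)
Variables x y : word.
Hypothesis Eq : subst phi q = x ++ zed :: y.
Hypothesis y0 : alpha 0 \notin y ++ B.
Hypothesis xn : alpha n \notin A ++ x.

Let An : alpha n \notin A.
Proof. by apply: contra xn; rewrite mem_cat => ->. Qed.
Let B0 : alpha 0 \notin B.
Proof. by apply: contra y0; rewrite mem_cat => ->; rewrite orbT. Qed.

Let first_q : first2 (alpha n) zed (subst phi q) = Some zed.
Proof. by rewrite Eq first2_z //; apply: contra xn; rewrite mem_cat => ->; rewrite orbT. Qed.

Let last_q : first2 (alpha 0) zed (rev (subst phi q)) = Some zed.
Proof.
rewrite Eq rev_cat rev_cons -cats1 -catA first2_z // mem_rev.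
by apply: contra y0; rewrite mem_cat => ->.
Qed.

(** Otherwise a_0 lies in A only and each z in the image of p comes after
some a_n of this image. The identity preserves this, since it preserves which of
a_n and z comes first; but in the image of q a z comes first. *)
Let a0_in : alpha 0 \in subst phi p ++ B.
Proof.
apply/negPn/negP; rewrite mem_cat negb_or => /andP[p0 _].
have : first2 (alpha n) zed (subst phi q) != Some zed.
  apply: (first2_transfer pqE); apply/eqP => E.
  have [_ [w1 [w2 [Ep nw1 _]]]] := first2_mem E.
  have [||] := @barrier (A ++ w1) (w2 ++ B); first by rewrite /w Ep -!catA.
    rewrite mem_cat (negbTE B0) orbF => w20.
    by move: p0; rewrite Ep mem_cat inE w20 !orbT.
  by rewrite mem_cat (negbTE An) (negbTE nw1).
by rewrite first_q eqxx.
Qed.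

Let an_in : alpha n \in A ++ subst phi p.
Proof.
apply/negPn/negP; rewrite mem_cat negb_or => /andP[_ pn].
have : first2 (alpha 0) zed (subst (rev \o phi) (rev q)) != Some zed.
  apply: (first2_transfer pqE'); rewrite subst_rev; apply/eqP => E.
  have [_ [w1 [w2 [Ep nw1 _]]]] := first2_mem E.
  have {}Ep : subst phi p = rev w2 ++ zed :: rev w1.
    by rewrite -[LHS]revK Ep rev_cat rev_cons -cats1 -catA.
  have [||] := @barrier (A ++ rev w2) (rev w1 ++ B); first by rewrite /w Ep -!catA.
    by rewrite mem_cat (negbTE B0) mem_rev (negbTE nw1).
  rewrite mem_cat (negbTE An) /= => w2n.
  by move: pn; rewrite Ep mem_cat w2n.
by rewrite subst_rev last_q eqxx.
Qed.

(** The letter just before the first a_(i+1) can only be a_i: a z there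
would have no a_0 after it and no a_n before it. As a_0 occurs in the image of p
or to its right, and a_n in it or to its left, the boundary lies inside this
image. *)
Let boundary i : i < n -> exists l r,
  subst phi p = rcons l (alpha i) ++ alpha i.+1 :: r /\
  alpha i.+1 \notin A ++ rcons l (alpha i).
Proof.
move=> lt_in; have [Qc Qa _ _] := Qw.
have ai1 : alpha i.+1 \in w by apply: Qa.
have [l1 [r1 [Ew nl1]]] := split_first_mem ai1.
have step j : j <= n -> j != i.+1 -> alpha j \in l1 -> j <= i.
  move=> jn ji jl; rewrite leqNgt; apply/negP => ij.
  apply: (@no_back i.+1 j l1 (alpha i.+1 :: r1)) => //; last by rewrite mem_head.
  by rewrite jn andbT ltn_neqAle eq_sym ji.
have ai : alpha i \in l1.
  have : alpha i \in w by apply: Qa; apply: ltnW.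
  rewrite Ew mem_cat => /orP[//|ir].
  case: (@no_back i i.+1 (rcons l1 (alpha i.+1)) r1); rewrite ?ltnSn ?cat_rcons //.
    by rewrite mem_rcons mem_head.
  by move: ir; rewrite inE => /orP[/eqP/alpha_inj/eqP|//]; rewrite -[_ == _]/(i == i.+1) ltn_eqF.
have [l0 El1] : exists l0, l1 = rcons l0 (alpha i).
  case/lastP: l1 ai nl1 step Ew => // l0 c ai nl1 step Ew.
  have cw : c \in w by rewrite Ew mem_cat mem_rcons mem_head.
  have [cz|[j jn cj]] := Qc c cw.
    have := @barrier l0 (alpha i.+1 :: r1); rewrite Ew cat_rcons cz => /(_ erefl) [].
      rewrite inE => /orP[/eqP/alpha_inj//|r10].
      by case: (@no_back 0 i.+1 (rcons (rcons l0 c) (alpha i.+1)) r1);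
        rewrite ?cat_rcons ?Ew ?cat_rcons // mem_rcons mem_head.
    move=> l0n; have nl : alpha n \in rcons l0 c by rewrite mem_rcons inE l0n orbT.
    have [ni|ni] := eqVneq n i.+1; first by rewrite -ni nl in nl1.
    by have := step n (leqnn _) ni nl; rewrite leqNgt lt_in.
  exists l0; congr rcons; rewrite cj; congr alpha; apply/eqP.
  have jl : alpha j \in rcons l0 c by rewrite cj mem_rcons mem_head.
  have ji1 : j != i.+1 by apply: contraNneq nl1 => <-.
  have := step j jn ji1 jl; rewrite leq_eqVlt => /orP[//|ji].
  move: ai; rewrite mem_rcons inE => /orP[/eqP ac|il0].
    by rewrite cj in ac; rewrite (alpha_inj ac).
  case: (@no_back j i l0 (c :: alpha i.+1 :: r1)) => //.
  - by rewrite ji ltnW.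
  - by rewrite Ew cat_rcons.
  by rewrite cj mem_head.
have EA := Ew; rewrite /w El1 cat_rcons in EA.
have [[t [Et Er]]|[t [Et El]]] := cat_split EA.
  have : alpha 0 \in t ++ subst phi p ++ B by rewrite mem_cat a0_in orbT.
  rewrite -Er inE => /orP[/eqP/alpha_inj//|r10].
  by case: (@no_back 0 i.+1 (rcons l1 (alpha i.+1)) r1);
    rewrite ?cat_rcons ?Ew // mem_rcons mem_head.
have nan : alpha n \notin l1.
  apply/negP => nl; have [ni|ni] := eqVneq n i.+1; first by rewrite -ni nl in nl1.
  by have := step n (leqnn _) ni nl; rewrite leqNgt lt_in.
have [[t' [Et' Er]]|[t' [Et' El']]] := cat_split Et.
  case: t' Et' Er => [|c t'] Et' Er.
    by move: nan; rewrite El1 El -cats1 -catA -Et' an_in.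
  case: Er => Ec Er; exists t, t'; split; first by rewrite Et' Ec cat_rcons.
  by move: nl1; rewrite El1 El -rcons_cat.
move: nan; rewrite El1 El El' mem_rcons inE negb_or catA mem_cat an_in /=.
by rewrite andbF.
Qed.

(** A letter occurring once in p occurs once in q, and the same letters
stand on each side of it, since A_0^1 sees the order of pairs. *)
Let same_sides tau : tau \in p -> ~~ subseq [:: tau; tau] p ->
  exists p1 p2 q1 q2, [/\ p = p1 ++ tau :: p2, q = q1 ++ tau :: q2,
    tau \notin p1 ++ p2, tau \notin q1 ++ q2 & p1 =i q1 /\ p2 =i q2].
Proof.
have uniq2 r : tau \in r -> ~~ subseq [:: tau; tau] r ->
    exists r1 r2, [/\ r = r1 ++ tau :: r2, tau \notin r1 & tau \notin r2].
  case/split_first_mem=> r1 [r2 [-> tr1]] H; exists r1, r2; split=> //.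
  apply: contra H => tr2; rewrite -cat_rcons subseq_pair //.
  by rewrite mem_rcons mem_head.
move=> tp up; have [p1 [p2 [Ep tp1 tp2]]] := uniq2 p tp up.
have tq : tau \in q by rewrite -(A01_mem pqA).
have uq : ~~ subseq [:: tau; tau] q by rewrite -(A01_subseq _ _ pqA).
have [q1 [q2 [Eq' tq1 tq2]]] := uniq2 q tq uq.
have left_ r r1 r2 v : r = r1 ++ tau :: r2 -> tau \notin r1 -> tau \notin r2 ->
    v != tau -> (v \in r1) = subseq [:: v; tau] r.
  move=> -> t1 t2 vt; apply/idP/idP => [v1|]; first by rewrite subseq_pair ?mem_head.
  apply: contraTT; elim: r1 t1 => [|a r1 IH] /=; rewrite ?inE ?negb_or.
    by rewrite (negbTE vt) => _ _; apply: contra t2 => /mem_subseq; apply; rewrite !inE eqxx orbT.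
  case/andP=> ta t1 /andP[va vr1]; rewrite (negbTE va); exact: IH.
have right_ r r1 r2 v : r = r1 ++ tau :: r2 -> tau \notin r1 -> tau \notin r2 ->
    v != tau -> (v \in r2) = subseq [:: tau; v] r.
  move=> -> t1 t2 vt; apply/idP/idP => [v1|].
    by rewrite -cat_rcons subseq_pair // mem_rcons mem_head.
  elim: r1 t1 => [|a r1 IH] /=; first by rewrite eqxx sub1seq.
  by rewrite inE negb_or => /andP[/negbTE-> t1]; apply: IH.
exists p1, p2, q1, q2; rewrite !mem_cat !negb_or tp1 tp2 tq1 tq2; split=> //.
split=> v; have [->|vt] := eqVneq v tau;
  try by rewrite ?(negbTE tp1) ?(negbTE tq1) ?(negbTE tp2) ?(negbTE tq2).
  by rewrite (left_ p p1 p2) // (left_ q q1 q2) // (A01_subseq _ _ pqA).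
by rewrite (right_ p p1 p2) // (right_ q q1 q2) // (A01_subseq _ _ pqA).
Qed.

(** A boundary strictly inside the image of tau forces tau to be linear
in p, as repeating its image would put a_(i+1) before a_i. Then all of a_n lies
to the right of what precedes tau and all of a_0 to the left of what follows, in
q as in p, and the separating z has no place before, inside or after the image
of tau. *)
Let inside_linear i p1 tau p2 f g l r : i < n -> p = p1 ++ tau :: p2 ->
  phi tau = f ++ g -> f != [::] -> g != [::] ->
  rcons l (alpha i) = subst phi p1 ++ f -> alpha i.+1 :: r = g ++ subst phi p2 ->
  alpha i.+1 \notin A ++ rcons l (alpha i) -> False.
Proof.
move=> lt_in Ep Et f0 g0 El Er nl.
have [f' Ef] : exists f', f = rcons f' (alpha i).
  case/lastP: f f0 El {Et} => // f' c _; rewrite -rcons_cat => /rcons_inj[_ ->].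
  by exists f'.
have [g' Eg] : exists g', g = alpha i.+1 :: g'.
  by case: g g0 Er {Et} => // c g' _ [-> _]; exists g'.
have fi : alpha i \in f by rewrite Ef mem_rcons mem_head.
have gi : alpha i.+1 \in g by rewrite Eg mem_head.
have tau_p : tau \in p by rewrite Ep mem_cat mem_head orbT.
have ii : i < i.+1 <= n by rewrite ltnSn lt_in.
have once : ~~ subseq [:: tau; tau] p.
  apply/negP => tt; have [s1 [s2 [Es t1 t2]]] : exists s1 s2,
      [/\ p = s1 ++ s2, tau \in s1 & tau \in s2].
    have /split_first_mem[s1 [s2 [Es ts1]]] := tau_p; exists (rcons s1 tau), s2.
    rewrite cat_rcons mem_rcons mem_head; split=> //; move: tt; rewrite Es.
    elim: s1 ts1 {Es} => [|a s1 IH] /=; first by rewrite eqxx sub1seq.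
    by rewrite inE negb_or => /andP[/negbTE-> t1]; apply: IH.
  apply: (@no_back i i.+1 (A ++ subst phi s1) (subst phi s2 ++ B)) => //.
  - by rewrite /w Es subst_cat -!catA.
  - rewrite mem_cat; apply/orP; right; apply/mem_subst; exists tau => //.
    by rewrite Et mem_cat gi orbT.
  rewrite mem_cat; apply/orP; left; apply/mem_subst; exists tau => //.
  by rewrite Et mem_cat fi.
have [p1' [p2' [q1 [q2 [Ep' Eq' tp tq [E1 E2]]]]]] := same_sides tau_p once.
have [Ep1 Ep2] : p1 = p1' /\ p2 = p2'.
  move: Ep; rewrite Ep' => {Ep'} E; move: tp; rewrite mem_cat negb_or => /andP[t1 t2].
  elim: p1' p1 t1 E {E1 El} => [|a s1 IH] [|b r1] /=.
  - by move=> _ [<-].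
  - by move=> _ [_ E]; move: t2; rewrite E mem_cat mem_head orbT.
  - by rewrite inE negb_or => /andP[/eqP ta _] [/esym].
  by rewrite inE negb_or => /andP[_ t1] [<- /(IH _ t1)[-> ->]].
have C1 := mem_subst_eq phi E1; have C2 := mem_subst_eq phi E2.
rewrite -Ep1 -Ep2 in tp C1 C2.
have Eqs : subst phi q = subst phi q1 ++ phi tau ++ subst phi q2.
  by rewrite Eq' subst_cat subst_cons.
have Ews : w = A ++ subst phi p1 ++ phi tau ++ subst phi p2 ++ B.
  by rewrite /w Ep subst_cat subst_cons -!catA.
have an_left : alpha n \notin A ++ subst phi p1.
  apply/negP => H; apply: (@no_back i n (A ++ subst phi p1) (phi tau ++ subst phi p2 ++ B)).
  - by rewrite lt_in leqnn.
  - by rewrite Ews -!catA.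
  - exact: H.
  by rewrite mem_cat Et mem_cat fi.
have a0_right : alpha 0 \notin subst phi p2 ++ B.
  apply/negP => H; apply: (@no_back 0 i.+1 (A ++ subst phi p1 ++ phi tau) (subst phi p2 ++ B)).
  - by rewrite ltn0Sn lt_in.
  - by rewrite Ews -!catA.
  - by rewrite !mem_cat Et mem_cat gi !orbT.
  exact: H.
move: Eqs; rewrite Eq => /esym Es.
have [[t1 [F1 F2]]|[t1 [F1 F2]]] := cat_split Es.
  (* The separating z lies to the left of the image of tau; q is read from the right,
     from tau on, where no a_0 has been met. *)
  have t0 : alpha 0 \notin t1.
    by apply: contra y0; rewrite F2 !mem_cat => ->.
  have tau0 : alpha 0 \notin phi tau.
    by apply: contra y0; rewrite F2 !mem_cat => ->; rewrite !orbT.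
  have q20 : alpha 0 \notin subst phi q2.
    by apply: contra y0; rewrite F2 !mem_cat => ->; rewrite !orbT.
  have H : first2 (alpha 0) zed (subst (rev \o phi) (rev q1)) != Some zed.
    apply: (@first2_transfer_after _ (alpha 0) zed (rev p2) (rev p1) (rev q2) (rev q1) tau).
    - have := pqE'; rewrite Ep Eq' !rev_cat !rev_cons -!cats1 -!catA.
      by [].
    - by rewrite mem_cat !mem_rev -mem_cat; move: tp; rewrite !mem_cat orbC.
    - by rewrite mem_cat !mem_rev -mem_cat; move: tq; rewrite !mem_cat orbC.
    - by rewrite subst_rev mem_rev C2.
    - by rewrite subst_rev mem_rev.
    rewrite subst_rev; apply/eqP => E.
    have [_ [w1 [w2 [Ew nw1 _]]]] := first2_mem E.
    have {}Ew : subst phi p1 = rev w2 ++ zed :: rev w1.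
      by rewrite -[LHS]revK Ew rev_cat rev_cons -cats1 -catA.
    have [||] := @barrier (A ++ rev w2) (rev w1 ++ phi tau ++ subst phi p2 ++ B).
    - by rewrite Ews Ew -!catA.
    - rewrite !(mem_cat (alpha 0)) mem_rev (negbTE nw1) (negbTE tau0) /= -mem_cat.
      by rewrite (negbTE a0_right).
    by move=> H; move/negP: an_left; apply; rewrite Ew catA mem_cat H.
  move: H; rewrite subst_rev F1 rev_cat rev_cons -cats1 -catA first2_z ?eqxx //.
  by rewrite mem_rev.
have [[t2 [G1 G2]]|[t2 [G1 G2]]] := cat_split F1.
  (* It lies in the image of tau, hence also separates a_0 from a_n in w. *)
  have [||] := @barrier (A ++ subst phi p1 ++ t1) (t2 ++ subst phi p2 ++ B).
  - by rewrite Ews G1 -!catA.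
  - rewrite mem_cat => /orP[t20|]; last by rewrite (negbTE a0_right).
    by move: y0; rewrite G2 !mem_cat t20.
  rewrite !mem_cat orbA -mem_cat (negbTE an_left) /= => t1n.
  by move: xn; rewrite F2 !mem_cat t1n !orbT.
(* It lies to the right of the image of tau; q is read from tau on. *)
have H : first2 (alpha n) zed (subst phi q2) != Some zed.
  apply: (@first2_transfer_after _ (alpha n) zed p1 p2 q1 q2 tau) => //.
  - by rewrite -Ep -Eq'.
  - by apply: contra an_left; rewrite mem_cat => ->; rewrite orbT.
  - by apply: contra xn; rewrite F2 !mem_cat => ->; rewrite !orbT.
  apply/eqP => E; have [_ [w1 [w2 [Ew nw1 _]]]] := first2_mem E.
  have [||] := @barrier (A ++ subst phi p1 ++ phi tau ++ w1) (w2 ++ B).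
  - by rewrite Ews Ew -!catA.
  - move=> H; move: a0_right; rewrite Ew !mem_cat inE.
    by move: H; rewrite mem_cat => /orP[->|->]; rewrite !orbT.
  rewrite mem_cat (negbTE An) /= !mem_cat (negbTE nw1) orbF => /orP[H|H].
    by move: an_left; rewrite mem_cat H orbT.
  by move: xn; rewrite F2 G2 !mem_cat H !orbT.
move: H; rewrite G1 first2_z ?eqxx //.
by apply: contra xn; rewrite F2 G2 !mem_cat => ->; rewrite !orbT.
Qed.

(** Hence each boundary between a_i and a_(i+1) is the end of the image of
a letter of p, and this letter determines i; there are n boundaries but fewer
than n letters. *)
Lemma never_cut : False.
Proof.
have H (i : 'I_n) : exists v, v \in p /\ exists s, phi v = rcons s (alpha i).
  have [l [r [Es nl]]] := boundary (ltn_ord i).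
  have [[p1 [p2 [Ep El Er]]]|[p1 [tau [p2 [f [g [Ep Et f0 g0 [El Er]]]]]]]] :=
    subst_split Es; last by case: (inside_linear (ltn_ord i) Ep Et f0 g0 El Er nl).
  suff [v [vp Hv]] : exists v, v \in p1 /\ exists s, phi v = rcons s (alpha i).
    by exists v; rewrite Ep mem_cat vp.
  elim/last_ind: p1 {Ep Er} El => [|p1 v IH]; first by case: (l).
  have -> : subst phi (rcons p1 v) = subst phi p1 ++ phi v.
    by rewrite -cats1 subst_cat /subst /= cats0.
  case/lastP E : (phi v) => [|s c].
    by rewrite cats0 => /IH[u [up Hu]]; exists u; rewrite mem_rcons inE up orbT.
  rewrite -rcons_cat => /rcons_inj[_ ->]; exists v; rewrite mem_rcons mem_head.
  by split=> //; exists s.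
have [c cP] := choice H.
have c_inj : injective c.
  move=> i j cij; have [_ [s Es]] := cP i; have [_ [s' Es']] := cP j.
  by move: Es'; rewrite -cij Es => /rcons_inj[_ ij]; apply: val_inj.
have U : uniq (map c (enum 'I_n)) by rewrite map_inj_uniq // enum_uniq.
have sub : {subset map c (enum 'I_n) <= p}.
  by move=> v /mapP[i _ ->]; have [] := cP i.
have := uniq_leq_size U sub; rewrite size_map size_enum_ord.
by rewrite leqNgt small.
Qed.
End Preserved.

(** A new separating z could only appear in the image of q, which
[never_cut] excludes; outside, the content of the image is what counts. *)
Lemma uncut_step n A B phi p q : Id varA01 p q -> Id varE1sigma2 p q ->
  Id varE1sigma2 (rev p) (rev q) -> size p < n ->
  uncut n (A ++ subst phi p ++ B) -> uncut n (A ++ subst phi q ++ B).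
Proof.
move=> pqA pqE pqE' small Qw.
have ctx : Id varA01 (A ++ subst phi p ++ B) (A ++ subst phi q ++ B).
  by apply: (fic_ctx (fic_Id _)); apply: (fic_subst (fic_Id _)).
have con := A01_mem ctx; have [Q1 Q2 Q3 Q4] := Qw.
have C := mem_subst_eq phi (A01_mem pqA).
split.
- by move=> c; rewrite -con => /Q1.
- by move=> i /Q2; rewrite con.
- by move=> i j /Q3; rewrite (A01_subseq _ _ ctx).
move=> w1 w2 Ew; have [[t [E1 E2]]|[t [Et E3]]] := cat_split Ew.
  have [|H|H] := Q4 w1 (t ++ subst phi p ++ B); first by rewrite E1 -catA.
    by left; move: H; rewrite E2 !mem_cat C.
  by right.
have [[s [E1 E2]]|[s [E1 E2]]] := cat_split Et.
  apply: contrapT => /not_orP[/negP a0 /negP an].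
  apply: (never_cut Qw pqA pqE pqE' small E1); last by rewrite -E3.
  by rewrite -E2.
have [|H|H] := Q4 (A ++ subst phi p ++ s) w2; first by rewrite E1 -!catA.
  by left.
by right; move: H; rewrite E3 E2 !mem_cat C.
Qed.

Lemma mem_squares s x : reflect (exists2 i, i \in s & x = alpha i) (x \in squares s).
Proof.
apply: (iffP flattenP) => [[w /mapP[i si ->]]|[i si ->]].
  by rewrite !inE orbb => /eqP->; exists i.
by exists [:: alpha i; alpha i]; rewrite ?inE ?eqxx //; apply: (map_f (fun i => _) si).
Qed.

Lemma squares_sorted i j s : sorted ltn s -> i < j ->
  ~~ subseq [:: alpha j; alpha i] (squares s).
Proof.
elim: s => //= k s IH ps ij; rewrite /squares /= -/(squares s).
have IH' := IH (path_sorted ps) ij.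
have [jk|jk] := eqVneq (alpha j) (alpha k); last first.
  by rewrite (negbTE jk).
rewrite -(alpha_inj jk); have /negbTE-> : alpha i != alpha j.
  by apply/eqP => /alpha_inj ji; rewrite ji ltnn in ij.
rewrite sub1seq; apply/negP => /mem_squares[i' si' /alpha_inj ii'].
have := order_path_min ltn_trans ps; move/allP/(_ _ si'); rewrite -ii' -(alpha_inj jk).
by rewrite ltnNge ltnW.
Qed.

Lemma zed_squares s : zed \notin squares s.
Proof. by apply/negP => /mem_squares[]. Qed.

Lemma clean_uncut n : 0 < n -> uncut n (clean_word n).
Proof.
move=> n0; rewrite /clean_word; split.
- move=> x; rewrite in_cons mem_cat mem_seq1 => /or3P[/eqP->|xs|/eqP->]; [by left| |by left].
  have [i] := mem_squares _ _ xs.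
  by rewrite mem_iota add0n ltnS => /andP[_ ile] ->; right; exists i.
- move=> i ile; rewrite inE mem_cat; apply/or3P; constructor 2.
  by apply/mem_squares; exists i; rewrite // mem_iota add0n ltnS.
- move=> i j /andP[ij _].
  have zh w : subseq [:: alpha j; alpha i] (zed :: w) = subseq [:: alpha j; alpha i] w by [].
  have zl w : subseq [:: alpha j; alpha i] (rcons w zed) = subseq [:: alpha j; alpha i] w.
    rewrite -[LHS]subseq_rev -[RHS]subseq_rev rev_rcons /=.
    by [].
  by rewrite zh cats1 zl; apply: squares_sorted => //; apply: iota_ltn_sorted.
have a0s : alpha 0 \in squares (iota 0 n.+1) by apply/mem_squares; exists 0.
have ans : alpha n \in squares (iota 0 n.+1).
  by apply/mem_squares; exists n; rewrite // mem_iota add0n ltnSn.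
move: (squares _) (zed_squares (iota 0 n.+1)) a0s ans => s zs a0s ans [|c w1] w2 [].
  by move=> <-; left; rewrite mem_cat a0s.
move=> _ Ew; have [[t [E _]]|[t [_ ->]]] := cat_split Ew.
  by rewrite E mem_cat mem_head orbT in zs.
by right; rewrite inE mem_cat ans orbT.
Qed.

Lemma cut_not_uncut n : 0 < n -> ~ uncut n (cut_word n).
Proof.
move=> n0 [_ _ _ /(_ [:: zed; alpha 0; alpha 0] (squares (iota 1 n) ++ [:: zed]) erefl)].
rewrite mem_cat mem_seq1 !inE => -[/orP[a0|/eqP//]|/or3P[/eqP//|/eqP a0|/eqP a0]].
- have [i] := mem_squares _ _ a0.
  by rewrite mem_iota => /andP[i0 _] /alpha_inj i00; rewrite -i00 in i0.
- by move: n0; rewrite (alpha_inj a0).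
by move: n0; rewrite (alpha_inj a0).
Qed.

Lemma count_squares s i : i \in s -> 1 < count_mem (alpha i) (squares s).
Proof.
elim: s => // k s IH; rewrite inE /squares /= -/(squares s) => /orP[/eqP->|/IH lt].
  by rewrite eqxx.
by rewrite (leq_trans lt) // addnA leq_addl.
Qed.

(** The z after a_0^2 is an inner occurrence, as the letters a_i are all
squared. *)
Lemma cut_clean (R : word -> word -> Prop) n : deletes_inner R ->
  R (cut_word n) (clean_word n).
Proof.
move=> H; apply: (H [::] zed [:: alpha 0; alpha 0] (squares (iota 1 n)) [::]).
move=> x xs; have /mem_squares[i ii ->] : x \in squares (iota 0 n.+1) by [].
apply: leq_trans (count_squares ii) _.
rewrite -[squares (iota 0 n.+1)]/([:: alpha 0; alpha 0] ++ squares (iota 1 n)).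
by move: (squares _) => s; clear; count_lia.
Qed.

(** A finite basis has sides shorter than some n; its identities
would hold in the syntactic monoid of the language [uncut n], which would then
belong to V although it separates the two words. *)
Theorem not_finitely_based (V : mclass) :
  deletes_inner (Id V) -> subclass varA01 V -> subclass varE1sigma2 V ->
  subclass (dual varE1sigma2) V -> ~ finitely_based V.
Proof.
move=> inner AV EV DV [Sigma VE].
pose n := (\max_(e <- Sigma) maxn (size e.1) (size e.2)).+1.
have sz e : e \in Sigma -> size e.1 < n /\ size e.2 < n.
  move=> es; have : maxn (size e.1) (size e.2) < n.
    pose F (e' : identity) := maxn (size e'.1) (size e'.2).
    by rewrite ltnS; apply: (@leq_bigmax_seq _ Sigma xpredT F e).
  by rewrite gtn_max => /andP[].
have step u v : (u, v) \in Sigma -> size u < n ->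
    forall phi A B, uncut n (A ++ subst phi u ++ B) -> uncut n (A ++ subst phi v ++ B).
  move=> es lt phi A B.
  have Vuv : Id V u v by move=> M /VE; apply.
  apply: uncut_step => //; try exact: (Id_sub _ Vuv).
  by apply/Id_dual; apply: (Id_sub _ Vuv).
have VS : V (syntactic (uncut n)).
  apply/VE => -[u v] es; apply: syntactic_satisfies => phi p q.
  have [lu lv] := sz _ es; split; first exact: step.
  have Vvu : Id V v u by move=> M /VE H f; apply/esym/(H (u, v)).
  apply: uncut_step => //; try exact: (Id_sub _ Vvu).
  by apply/Id_dual; apply: (Id_sub _ Vvu).
have := satisfies_syntactic (cut_clean n inner _ VS).
by move=> /(_ [::] [::]); rewrite /= !cats0 => H; apply: (@cut_not_uncut n) => //;
  apply/H/clean_uncut.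
Qed.

(** * Proper subvarieties *)

Lemma rel_ext (R S : word -> word -> Prop) :
  (forall u v, R u v <-> S u v) -> R = S.
Proof.
move=> H; apply: functional_extensionality_dep => u.
by apply: functional_extensionality_dep => v; apply: propext.
Qed.

Lemma good_join V W : good (Id V) -> good (Id W) -> good (Id (join V W)).
Proof.
move=> gV gW; suff -> : Id (join V W) = (fun u v => Id V u v /\ Id W u v).
  exact: good_meet.
apply: rel_ext => u v; split=> [H|[]]; last exact: Id_join.
by split; [apply: (Id_sub (@join_l V W))|apply: (Id_sub (@join_r V W))].
Qed.

Lemma Id_dual_mirror V : Id (dual V) = mirror (Id V).
Proof. by apply: rel_ext => u v; apply: Id_dual. Qed.

Lemma good_dual V : good (Id V) -> good (Id (dual V)).
Proof. by rewrite Id_dual_mirror; apply: good_mirror. Qed.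

Lemma mirrorK (R : word -> word -> Prop) : mirror (mirror R) = R.
Proof. by apply: rel_ext => u v; rewrite /mirror !revK. Qed.

Lemma good_of_item (R : word -> word -> Prop) : based R ->
  [\/ holds R p_star, holds R p_first | holds R (flip p_first)] -> good R.
Proof.
move=> bR [H|H|H]; first by split; [|apply: inner_of_star].
  by split; [|apply: inner_of_first].
rewrite -[R]mirrorK; apply: good_mirror; split; first exact: based_mirror.
by apply: inner_of_first; [apply: based_mirror|apply/holds_flip].
Qed.

(** The basis consists of those of [base] and [items] that hold
in W. The extra item makes the congruence that it generates good, so that
transfer applies. *)
Lemma finitely_based_of_item W : variety W -> good (Id W) ->
  [\/ holds (Id W) p_star, holds (Id W) p_first | holds (Id W) (flip p_first)] ->
  finitely_based W.
Proof.
move=> VW gW star.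
pose L := [seq e <- base ++ items | `[< holds (Id W) e >]].
pose Sigma := map identity_of L; exists Sigma.
pose R := Id (var [set` Sigma]).
have RL e : e \in base ++ items -> holds (Id W) e -> holds R e.
  move=> ei He; apply: (holds_identity (fic_Id _)) => M HM.
  suff eS : identity_of e \in Sigma.
    by have := HM _ eS; case: (identity_of e).
  by apply: map_f; rewrite mem_filter ei andbT; apply/asboolP.
have bR : based R.
  split; first exact: fic_Id.
  by move=> e eb; apply: RL; [rewrite mem_cat eb|exact: (based_holds gW)].
have gR : good R.
  apply: good_of_item => //.
  by case: star => H; [constructor 1|constructor 2|constructor 3]; apply: RL.
have SR : items_sub (Id W) R.
  by move=> e ei; apply: RL; rewrite mem_cat ei orbT.
move=> M; split=> [WM e /mapP[e' + ->]|HM].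
  rewrite mem_filter => /andP[/asboolP He' _].
  by have := identity_holds He' M WM; case: (identity_of e').
apply/(birkhoff VW) => -[u v] /= uv.
have: R u v by exact: (good_transfer gR gW SR uv).
exact.
Qed.

(** The contrapositive of transfer. *)
Lemma missing_item W K : variety W -> good (Id W) -> good (Id K) ->
  ~ subclass K W -> exists e, [/\ e \in items, holds (Id W) e & ~ holds (Id K) e].
Proof.
move=> VW gW gK nKW; apply: contrapT => none; apply: nKW => M KM.
apply/(birkhoff VW) => -[u v] /= uv; suff : Id K u v by apply.
apply: (good_transfer gK gW _ uv) => e ei He; apply: contrapT => nHe.
by apply: none; exists e.
Qed.

(** These three patterns are their own mirror images up to the names
of letters. *)
Lemma flip_symmetric (R : word -> word -> Prop) : fic R ->
  [/\ holds R p_comm -> holds R (flip p_comm),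
      holds R p_fill -> holds R (flip p_fill)
    & holds R p_star -> holds R (flip p_star)].
Proof.
move=> HR; split=> H ws.
- by apply: (fic_conv (H [:: nth [::] ws 1; nth [::] ws 0])); list_eq.
- by apply: (fic_conv (H [:: nth [::] ws 0; [::]; nth [::] ws 3; nth [::] ws 2])); list_eq.
by apply: (fic_conv (H [:: nth [::] ws 1; nth [::] ws 0])); list_eq.
Qed.

Lemma mem_other (T : eqType) (l k m : seq T) e :
  all (fun e => (e \in k) || (e \in m)) l -> e \in l -> e \notin k -> e \in m.
Proof. by move=> /allP H /H /orP[->|]. Qed.

(** An item failing in E^1{sigma_2} is not among the three that hold
there, and all the others imply [p_first]. *)
Lemma missing_E_first W : variety W -> good (Id W) ->
  ~ subclass varE1sigma2 W -> holds (Id W) p_first.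
Proof.
move=> VW gW nE; have [e [ei He nHe]] := missing_item VW gW good_E1sigma2 nE.
apply: (first_of_items gW (e := e)) => //.
apply: (mem_other (k := [:: p_star; flip p_firsts; flip p_first]) _ ei) => //.
by apply/negP => /E1sigma2_items.
Qed.

Lemma missing_dualE_first W : variety W -> good (Id W) ->
  ~ subclass (dual varE1sigma2) W -> holds (Id W) (flip p_first).
Proof.
move=> VW gW nE; have gE := good_dual good_E1sigma2.
have [e [ei He nHe]] := missing_item VW gW gE nE.
have [Hcomm Hfill _] := flip_symmetric gW.
have [_ _ Hstar] := flip_symmetric good_E1sigma2.
rewrite Id_dual_mirror in nHe.
have bM := based_mirror gW; apply/holds_flip.
have [ee|nee] := boolP (e \in [:: p_comm; p_fill]).
  apply: (first_of_items bM (e := e)).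
    by move: ee; rewrite !inE => /orP[]->; rewrite ?orbT.
  apply/holds_flip; move: ee He; rewrite !inE.
  by case/orP=> /eqP->; [apply: Hcomm|apply: Hfill].
apply: (first_of_items bM (e := flip e)); last by apply/holds_flip; rewrite flipK.
rewrite -[flip e \in _](mem_map (can_inj flipK)) flipK.
apply: (mem_other (k := [:: p_comm; p_fill; p_star; p_firsts; p_first]) _ ei) => //.
rewrite (mem_cat _ [:: p_comm; p_fill]) negb_or nee; apply/negP => ee; apply: nHe.
apply/holds_flip; move: ee; rewrite !inE.
case/or3P=> /eqP->; [apply: Hstar| |]; by apply: E1sigma2_items.
Qed.

Lemma missing_A_star W : variety W -> good (Id W) ->
  ~ subclass varA01 W -> holds (Id W) p_star.
Proof.
move=> VW gW nA; have [e [ei He nHe]] := missing_item VW gW good_A01 nA.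
apply: (star_of_items gW (e := e)) => //.
apply: (mem_other (k := [:: p_fill; p_firsts; flip p_firsts; p_first; flip p_first])
  _ ei) => //.
by apply/negP => ee; apply/nHe/A01_patterns; rewrite mem_cat ee orbT.
Qed.

Definition the_join : mclass := join (join varA01 varE1sigma2) (dual varE1sigma2).

Lemma good_the_join : good (Id the_join).
Proof.
apply: good_join; last exact: good_dual good_E1sigma2.
by apply: good_join; [exact: good_A01|exact: good_E1sigma2].
Qed.

Lemma A01_the_join : subclass varA01 the_join.
Proof. by move=> M AM; apply: join_l; apply: join_l. Qed.

Lemma E_the_join : subclass varE1sigma2 the_join.
Proof. by move=> M AM; apply: join_l; apply: join_r. Qed.

Lemma dualE_the_join : subclass (dual varE1sigma2) the_join.
Proof. by move=> M AM; apply: join_r. Qed.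

(** A subvariety containing the three joined ones is V; each missing one
provides an identity for [finitely_based_of_item]. *)
Lemma limit_the_join : limit_variety the_join.
Proof.
split; first exact: variety_smallest.
  apply: not_finitely_based; first exact: good_inner good_the_join.
  - exact: A01_the_join.
  - exact: E_the_join.
  exact: dualE_the_join.
move=> W VW WV nWV.
have gW : good (Id W).
  split; first split; first exact: fic_Id.
    by move=> e eb ws; apply: (Id_sub WV); apply: based_holds eb ws; exact: good_the_join.
  by move=> p x c d q H; apply: (Id_sub WV); apply: (good_inner good_the_join).
apply: finitely_based_of_item => //.
have [AW|nA] := pselect (subclass varA01 W); last by constructor 1; apply: missing_A_star.
have [EW|nE] := pselect (subclass varE1sigma2 W); last first.
  by constructor 2; apply: missing_E_first.
have [DW|nD] := pselect (subclass (dual varE1sigma2) W); last first.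
  by constructor 3; apply: missing_dualE_first.
case: nWV => M; split; first exact: WV.
by apply: join_sub => //; apply: join_sub.
Qed.

(** * Comparison with the other limit varieties *)

Lemma extra_identity X u v :
  Id X u v -> ~ Id varA01 u v -> ~ eqclass the_join X.
Proof.
move=> Xuv nA E; apply: nA; apply: (Id_sub A01_the_join) => M VM.
by apply: Xuv; apply/E.
Qed.

Lemma missing_identity X u v :
  Id the_join u v -> ~ Id X u v -> ~ eqclass the_join X.
Proof. by move=> Vuv nX E; apply: nX => M XM; apply: Vuv; apply/E. Qed.

Section Excluded.
Import Letters.

Lemma A01_squares : ~ Id varA01 [:: x; x; y; y] [:: y; y; x; x].
Proof. by move=> /(A01_subseq y x). Qed.

Lemma A01_repeat : ~ Id varA01 [:: x; y; x; z] [:: x; y; x; z; x].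
Proof. by move=> /(A01_subseq z x). Qed.

Lemma A01_repeat_rev : ~ Id varA01 [:: z; x; y; x] [:: x; z; x; y; x].
Proof. by move=> /(A01_subseq x z). Qed.

Lemma Id_var (Sigma : set identity) u v : Sigma (u, v) -> Id (var Sigma) u v.
Proof. by move=> S M; apply. Qed.

Lemma not_J : ~ eqclass the_join varJ.
Proof. by apply: extra_identity A01_squares; apply: Id_var; left. Qed.

Lemma not_dual_J : ~ eqclass the_join (dual varJ).
Proof.
apply: extra_identity A01_squares; apply/Id_dual/(fic_sym (fic_Id _)).
by apply: Id_var; left.
Qed.

Lemma not_J1 : ~ eqclass the_join varJ1.
Proof. by apply: extra_identity A01_repeat; apply: Id_var; left. Qed.

Lemma not_dual_J1 : ~ eqclass the_join (dual varJ1).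
Proof. by apply: extra_identity A01_repeat_rev; apply/Id_dual/Id_var; left. Qed.

Lemma not_J2 : ~ eqclass the_join varJ2.
Proof. by apply: extra_identity A01_repeat; apply: Id_var; left. Qed.

Lemma not_dual_J2 : ~ eqclass the_join (dual varJ2).
Proof. by apply: extra_identity A01_repeat_rev; apply/Id_dual/Id_var; left. Qed.

Local Open Scope group_scope.

(** Without nonempty squares among the factors of W, every element g
of M(W) is 1 or satisfies g^2 = 0, so squares commute. *)
Lemma square_free_rees (W : seq word) : (forall u, factor W (u ++ u) -> u = [::]) ->
  Id (varM W) [:: x; x; y; y] [:: y; y; x; x].
Proof.
move=> Wsf; apply: Id_generated => f; rewrite /= !eval_cons !eval_nil !mulgA !mulg1.
have sq (g : rees W) : g = 1 \/ g * g = None.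
  case: g => [[u Wu]|]; last by right.
  have [Wuu|nW] := boolP (factor W (u ++ u)); last by right; apply: insubN.
  left; have u0 := Wsf _ Wuu; rewrite u0 in Wu *.
  have -> : (1 : rees W) = rees_one W by [].
  by rewrite /rees_one insubT; congr Some; apply: val_inj.
have z_l (g : rees W) : (None : rees W) * g = None by [].
have z_r (g : rees W) : g * None = None by case: g.
rewrite -[_ * f y * f y]mulgA -[_ * f x * f x]mulgA.
have [->|->] := sq (f x); first by rewrite !mulg1 !mul1g.
by have [->|->] := sq (f y); rewrite ?mulg1 ?mul1g ?z_l ?z_r.
Qed.
Local Close Scope group_scope.

Definition square_free (w : word) : bool :=
  all (fun i => all (fun k => [&& i + k + k <= size w &
      take k (drop i w) == take k (drop (i + k) w)] ==> (k == 0))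
    (iota 0 (size w).+1)) (iota 0 (size w).+1).

Lemma square_freeP w u : square_free w -> infix (u ++ u) w -> u = [::].
Proof.
move=> sf /infixP[p [q Ew]]; have sz : size w = size p + size u + size u + size q.
  by rewrite Ew !size_cat !addnA.
have lep : size p <= size w by rewrite sz -!addnA leq_addr.
have leu : size u <= size w by rewrite sz -addnA addnCA leq_addr.
have /allP/(_ (size p)) := sf; rewrite mem_iota ltnS lep => /(_ isT).
move=> /allP/(_ (size u)); rewrite mem_iota ltnS leu => /(_ isT).
rewrite sz leq_addr Ew addnC -drop_drop -!catA !drop_size_cat //.
by rewrite !take_size_cat // eqxx => /eqP/size0nil.
Qed.

Lemma not_M W : all square_free W -> ~ eqclass the_join (varM W).
Proof.
move=> /allP sf; apply: extra_identity A01_squares; apply: square_free_rees => u.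
by case/hasP=> w /sf; apply: square_freeP.
Qed.
End Excluded.

Section Presentations.
Local Open Scope group_scope.

(** Products are composed in reading order. The state 0 is a sink and
stands for failure. *)
Definition transformation : Type := nat -> nat.
HB.instance Definition _ := gen_eqMixin transformation.
HB.instance Definition _ := gen_choiceMixin transformation.

Definition transformation_mul (f g : transformation) : transformation :=
  fun n => g (f n).
Definition transformation_one : transformation := fun n => n.
Fact transformation_mulA : associative transformation_mul. Proof. by []. Qed.
Fact transformation_mul1 : left_id transformation_one transformation_mul.
Proof. by []. Qed.
Fact transformation_1mul : right_id transformation_one transformation_mul.
Proof. by []. Qed.
HB.instance Definition _ := isMonoid.Build transformation
  transformation_mulA transformation_mul1 transformation_1mul.

Definition sink : transformation := fun=> 0%N.

(** Generators acting by maps that fix the sink and satisfy the relations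
define a morphism from the presented monoid, so its identities hold for these
maps. *)
Lemma Id_presented (X : choiceType) rels (h : X -> transformation)
    (g : letter -> X) u v :
  (forall a, h a 0%N = 0%N) ->
  (forall r, r \in rels -> free_lift h sink r.1 = free_lift h sink r.2) ->
  Id (generated (adjoin1 (presented rels))) u v ->
  eval (h \o g : letter -> transformation) u = eval (h \o g : letter -> transformation) v.
Proof.
move=> h0 hrels /(_ _ (@generated_self _)) uv.
have oh a : sink * h a = sink by apply: functional_extensionality_dep => n; apply: h0.
have m : monoid_morphism (@adjoin1_lift _ rels _ h sink).
  exact: adjoin1_lift_morphism.
pose f (a : letter) : adjoin1 (presented rels) :=
  Some (\pi_(presented rels)%qT (gen (g a))).
have E w : eval (h \o g : letter -> transformation) w = adjoin1_lift h sink (eval f w).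
  rewrite (eval_hom _ _ m) /eval; apply: eq_bigr => a _.
  by rewrite /f /= presented_lift_pi //= big_nil.
by rewrite !E (uv f).
Qed.

(** The generators a, b, c of A as partial maps on the states 1, 2, 3. *)
Definition act_A (i : 'I_3) : transformation := fun n =>
  match val i, n with
  | 0, (1 | 2) => 2
  | 1, (1 | 3) => n
  | 2, (1 | 2) => 3
  | _, _ => 0
  end%N.

(** The generators a, b, c of K as partial maps on the states 1, 2, 3, 4. *)
Definition act_K (i : 'I_3) : transformation := fun n =>
  match val i, n with
  | 0, 3 => 3
  | 1, 1 => 2
  | 1, (3 | 4) => 4
  | 2, 2 => 3
  | _, _ => 0
  end%N.

(** [p_star] followed by t x, which makes it hold in A_0^1. It fails in
A^1 with x, y, t sent to b, a, c: there bbaacb is nonzero, while baba is zero. *)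
Definition p_star_tail : pattern := ([:: 0; 0; 1; 1; 2; 0], [:: 0; 1; 0; 1; 2; 0])%N.

Lemma A1_not_star_tail : ~ Id varA1 (identity_of p_star_tail).1 (identity_of p_star_tail).2.
Proof.
pose g (a : letter) : 'I_3 :=
  match a.2 with 0 => inord 1 | 1 => inord 0 | _ => inord 2 end%N.
have h0 a : act_A a 0%N = 0%N by case: a => -[|[|[|]]].
apply: (contra_not (@Id_presented _ _ act_A g _ _ h0 _)).
- move=> r; rewrite !inE => ri; apply: functional_extensionality_dep => n; move: ri.
  by case/or3P=> [/eqP->|/eqP->|/or4P[]/eqP->];
    rewrite /= ?big_cons ?big_nil; case: n => [|[|[|[|]]]].
(* Starting from the state 1, the first word leads to 3 and the second to the sink. *)
move=> /(congr1 (fun s : transformation => s 1%N)).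
rewrite !eval_cons !eval_nil /= /act_A.
by rewrite /mul /= /transformation_mul /= !inordK.
Qed.

Lemma K1_not_sqr : ~ Id varK1 (identity_of (flip p_sqr)).1 (identity_of (flip p_sqr)).2.
Proof.
pose g (a : letter) : 'I_3 := if a.2 == 0 then inord 1 else inord 2.
have h0 a : act_K a 0%N = 0%N by case: a => -[|[|[|]]].
apply: (contra_not (@Id_presented _ _ act_K g _ _ h0 _)).
- move=> r; rewrite !inE => ri; apply: functional_extensionality_dep => n; move: ri.
  by case/or4P=> [/eqP->|/eqP->|/eqP->|]; last case/or4P=> [/eqP->|/eqP->|/eqP->|];
    last case/orP=> /eqP->;
    rewrite /= ?big_cons ?big_nil; case: n => [|[|[|[|[|]]]]].
(* Starting from the state 1, bcb leads to 4 and bbcb to the sink. *)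
move=> /(congr1 (fun s : transformation => s 1%N)).
rewrite !eval_cons !eval_nil /= /act_K.
by rewrite /mul /= /transformation_mul /= !inordK.
Qed.
End Presentations.

Lemma holds_join V W e :
  holds (Id V) e -> holds (Id W) e -> holds (Id (join V W)) e.
Proof. by move=> HV HW ws; apply: Id_join. Qed.

Lemma holds_dual V e : holds (Id V) (flip e) -> holds (Id (dual V)) e.
Proof. by move=> H; rewrite Id_dual_mirror; apply/holds_flip. Qed.

Lemma E_star_tail : holds (Id varE1sigma2) p_star_tail /\ holds (Id varE1sigma2) (flip p_star_tail).
Proof.
have star : holds (Id varE1sigma2) p_star by apply: E1sigma2_items.
have HE := fic_Id varE1sigma2; split=> ws;
  set X := nth [::] ws 0; set Y := nth [::] ws 1; set T := nth [::] ws 2.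
  by apply: (rewrite_at HE (ws := [:: X; Y]) (p := [::]) (q := T ++ X) star); list_eq.
by apply: (rewrite_at HE (ws := [:: Y; X]) (p := X ++ T) (q := [::]) star); list_eq.
Qed.

Lemma the_join_star_tail :
  holds (Id the_join) p_star_tail /\ holds (Id the_join) (flip p_star_tail).
Proof.
have [EA EA'] := E_star_tail.
split; (apply: holds_join; [apply: holds_join => //; exact: A01_model_check|]);
  by apply: holds_dual; rewrite ?flipK.
Qed.

Lemma not_above_A1 X : subclass varA1 X -> ~ eqclass the_join X.
Proof.
move=> AX; apply: (missing_identity (identity_holds the_join_star_tail.1)) => /(Id_sub AX).
exact: A1_not_star_tail.
Qed.

Lemma Id_dual_flip V e :
  Id (dual V) (identity_of (flip e)).1 (identity_of (flip e)).2 <->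
  Id V (identity_of e).1 (identity_of e).2.
Proof.
suff E P : rev (map (pair 0) (rev P) : word) = map (pair 0) P :> word.
  by rewrite Id_dual !E.
by rewrite -map_rev revK.
Qed.

Lemma not_above_dual_A1 X : subclass (dual varA1) X -> ~ eqclass the_join X.
Proof.
move=> AX; apply: (missing_identity (identity_holds the_join_star_tail.2)) => /(Id_sub AX).
by move/Id_dual_flip; apply: A1_not_star_tail.
Qed.

Lemma not_K1 : ~ eqclass the_join varK1.
Proof.
apply: missing_identity K1_not_sqr.
exact: identity_holds (based_holds good_the_join (e := flip p_sqr) isT).
Qed.

Lemma not_dual_K1 : ~ eqclass the_join (dual varK1).
Proof.
have H := based_holds good_the_join (e := flip (flip p_sqr)) isT.
apply: (missing_identity (identity_holds H)).
by move/Id_dual_flip; apply: K1_not_sqr.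
Qed.

Theorem theorem7p5 :
  let V := join (join varA01 varE1sigma2) (dual varE1sigma2) in
  limit_variety V /\
  ~ eqclass V (join varA1 (dual varA1)) /\
  ~ eqclass V varJ /\
  ~ eqclass V (dual varJ) /\
  ~ eqclass V varJ1 /\
  ~ eqclass V (dual varJ1) /\
  ~ eqclass V varJ2 /\
  ~ eqclass V (dual varJ2) /\
  ~ eqclass V varK1 /\
  ~ eqclass V (dual varK1) /\
  ~ eqclass V (varM [:: word_xzxyty]) /\
  ~ eqclass V (varM [:: word_xyzxty; word_xzytxy]) /\
  ~ eqclass V (join varA1 varE1sigma2) /\
  ~ eqclass V (join (dual varA1) (dual varE1sigma2)).
Proof.
split; first exact: limit_the_join.
split; first exact: not_above_A1 (@join_l _ _).
split; first exact: not_J.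
split; first exact: not_dual_J.
split; first exact: not_J1.
split; first exact: not_dual_J1.
split; first exact: not_J2.
split; first exact: not_dual_J2.
split; first exact: not_K1.
split; first exact: not_dual_K1.
split; first exact: not_M.
split; first exact: not_M.
split; first exact: not_above_A1 (@join_l _ _).
exact: not_above_dual_A1 (@join_l _ _).
Qed.
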